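(* Let $n,m$ be positive integers, $\Delta>0$, and let $f:\mathcal C\to\mathbb R^n$ and $g:\mathcal C\to\mathbb R^{n\times m}$ be completely continuous and locally Lipschitz in $\mathcal C$. Consider the system $$\dot x(t)=f(x_t)+g(x_t)\,(u(t)+d(t)),\quad t\ge 0,\qquad x(\tau)=\xi_0(\tau),\ \tau\in[-\Delta,0],\quad \xi_0\in\mathcal C, \qquad ( * )$$ where $x(t)\in\mathbb R^n$, $u(t)\in\mathbb R^m$ is the control signal and $d(t)\in\mathbb R^m$ is the actuator disturbance, which is Lebesgue measurable and locally essentially bounded. Let $M_a$ be a functional as described in the context. Let $V:\mathbb R^n\times\mathcal Q\to\mathbb R^+$ be a functional in the class $\mathcal V$, with the corresponding maps $a$, $b$ (defined in the context from $V,f,g$), and let $\alpha_1,\alpha_2,\alpha_3$ be functions of class $\mathcal K_\infty$ such that for all $\phi\in\mathcal C$: (i) $\alpha_1(|\phi(0)|)\le V(\phi(0),\phi_{[-\Delta,0)})\le\alpha_2(M_a(\phi))$; (ii) $b(\phi)=0\ \Rightarrow\ a(\phi)\le 0$; (iii) $a^2(\phi)+|b(\phi)|^4\ge\alpha_3^2(M_a(\phi))$. Suppose moreover that there exist positive reals $r,p$ such that (iv) $\displaystyle\sup_{\{\psi\in\mathcal C:\ 0<|b(\psi)|\le r\}}\frac{a(\psi)}{|b(\psi)|}\le p$. Then: 1) for such $r$, the map $k_r:\mathcal C\to\mathbb R^m$ (defined in the context) is completely continuous and locally Lipschitz in $\mathcal C$; 2) there exist a function $\beta$ of class $\mathcal{KL}$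 and a function $\gamma$ of class $\mathcal K$, both independent of $r$ and $p$ (that is, the same $\beta,\gamma$ serve for all positive reals $r,p$ satisfying (iv)), such that, for any positive real $q$, for the closed-loop system given by $( * )$ with $$u(t)=k_r(x_t)-q\,b^T(x_t),$$ the solution exists for all $t\ge0$ (for every initial condition $\xi_0\in\mathcal C$ and every Lebesgue measurable, locally essentially bounded disturbance $d$) and satisfies, for all $t\ge 0$, $$|x(t)|\le\beta(\|x_0\|_\infty,t)+\gamma\!\left(\sqrt{\tfrac{2}{q}}\,\|d_{[0,t)}\|_\infty\right)+\gamma\!\left(\sqrt{\tfrac{2}{q}}\,(2p+r)\right).$$
   Context: **Basic notation.** $\mathbb R^+=[0,+\infty)$; $|\cdot|$ is the Euclidean norm of a vector or the induced matrix norm; $\|\cdot\|_\infty$ is the essential supremum norm. A function $v:\mathbb R^+\to\mathbb R^m$ is essentially bounded if $\operatorname{ess\,sup}_{t\ge0}|v(t)|<+\infty$. For $0\le T_1<T_2$, $v_{[T_1,T_2)}:\mathbb R^+\to\mathbb R^m$ equals $v(t)$ for $t\in[T_1,T_2)$ and $0$ elsewhere; $v$ is locally essentially bounded if $v_{[0,T)}$ is essentially bounded for every $T>0$. **Spaces.** $\mathcal C$ is the space of continuous functions $[-\Delta,0]\to\mathbb R^n$ (with the norm $\|\cdot\|_\infty$). $\mathcal Q$ is the space of functions $[-\Delta,0)\to\mathbb R^n$ that are bounded, continuous except at a finite number of points, and right-continuous. For $\phi\in\mathcal C$, $\phi_{[-\Delta,0)}\in\mathcal Q$ is the restriction of $\phi$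 to $[-\Delta,0)$. For $x:[-\Delta,c)\to\mathbb R^n$, $0<c\le+\infty$, and $t\in[0,c)$, $x_t(\tau)=x(t+\tau)$ for $\tau\in[-\Delta,0]$; in particular $x_0=\xi_0$. **Regularity of maps.** A map $F$ from $\mathcal C$ to a space of real matrices is completely continuous if it is continuous and takes closed bounded subsets of $\mathcal C$ into bounded sets. It is locally Lipschitz in $\mathcal C$ if for every $\phi\in\mathcal C$ there exist $\delta,\eta>0$ such that $|F(\phi_1)-F(\phi_2)|\le\eta\|\phi_1-\phi_2\|_\infty$ for all $\phi_1,\phi_2$ in the closure of $\{\psi\in\mathcal C:\|\psi-\phi\|_\infty<\delta\}$. A functional $V:\mathbb R^n\times\mathcal Q\to\mathbb R^+$ is called locally Lipschitz in $\mathcal C$ if the map $\phi\mapsto V(\phi(0),\phi_{[-\Delta,0)})$ is locally Lipschitz in $\mathcal C$. **Comparison functions.** $\gamma:\mathbb R^+\to\mathbb R^+$ is of class $\mathcal K$ if it is continuous, zero at zero and strictly increasing; of class $\mathcal K_\infty$ if moreover unbounded; of class $\mathcal L$ if it is continuous and monotonically decreases to zero as its argument tends to $+\infty$. $\beta:\mathbb R^+\times\mathbb R^+\to\mathbb R^+$ is of class $\mathcal{KL}$ if $\beta(\cdot,t)$ is of class $\mathcal K$ for each $t\ge0$ and $\beta(s,\cdot)$ is of class $\mathcal L$ for each $s\ge0$. **$M_a$.** $M_a$ denotes a functional $\mathcal C\to\mathbb R^+$ such that, for some class $\mathcal K_\infty$ functions $\gamma_a,\overline\gamma_a$, $\gamma_a(|\phi(0)|)\le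 M_a(\phi)\le\overline\gamma_a(\|\phi\|_\infty)$ for all $\phi\in\mathcal C$. **Invariant differentiability.** For $x\in\mathbb R^n$, $\phi\in\mathcal Q$ and a continuous $\mathcal Y:[0,\Delta]\to\mathbb R^n$ with $\mathcal Y(0)=x$, define $\psi_h^{(x,\phi,\mathcal Y)}\in\mathcal Q$, $h\in[0,\Delta)$, by $\psi_0^{(x,\phi,\mathcal Y)}=\phi$ and, for $h>0$, $\psi_h^{(x,\phi,\mathcal Y)}(s)=\phi(s+h)$ for $s\in[-\Delta,-h)$ and $=\mathcal Y(s+h)$ for $s\in[-h,0)$. A functional $V:\mathbb R^n\times\mathcal Q\to\mathbb R^+$ is invariantly differentiable if at every $(x,\phi)\in\mathbb R^n\times\mathcal Q$: - for every continuous $\mathcal Y:[0,\Delta]\to\mathbb R^n$ with $\mathcal Y(0)=x$, the right-hand derivative $\left.\frac{\partial V(x,\psi_h^{(x,\phi,\mathcal Y)})}{\partial h}\right|_{h=0}$ exists, is finite, and does not depend on $\mathcal Y$; - the derivative $\frac{\partial V(x,\phi)}{\partial x}$ (a row vector) exists and is finite; - for every $z\in\mathbb R^n$, every continuous $\mathcal Y:[0,\Delta]\to\mathbb R^n$ with $\mathcal Y(0)=x$, and every $h\in[0,\Delta)$, $$V\big(x+z,\psi_h^{(x,\phi,\mathcal Y)}\big)-V(x,\phi)=\frac{\partial V(x,\phi)}{\partial x}z+\left.\frac{\partial V(x,\psi_\ell^{(x,\phi,\mathcal Y)})}{\partial\ell}\right|_{\ell=0}h+o\big(\sqrt{|z|^2+h^2}\big),$$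 with $\lim_{s\to0^+}o(\sqrt s)/\sqrt s=0$. **Class $\mathcal V$.** For $\phi\in\mathcal C$, $h\in[0,\Delta)$, let $\phi^h\in\mathcal C$ be given by $\phi^h(s)=\phi(s+h)$ for $s\in[-\Delta,-h)$ and $\phi^h(s)=\phi(0)$ for $s\in[-h,0]$. $\mathcal V$ is the class of functionals $V:\mathbb R^n\times\mathcal Q\to\mathbb R^+$ that are locally Lipschitz in $\mathcal C$ and invariantly differentiable, and for which the two maps on $\mathcal C$ $$\phi\mapsto\left.\frac{\partial V(\phi(0),\phi^h_{[-\Delta,0)})}{\partial h}\right|_{h=0},\qquad \phi\mapsto\left.\frac{\partial V(x,\phi_{[-\Delta,0)})}{\partial x}\right|_{x=\phi(0)}$$ are completely continuous and locally Lipschitz in $\mathcal C$ (derivatives in $h$ at $0$ are right-hand derivatives). **The maps $a$, $b$, $k_r$.** Given $V\in\mathcal V$ and $f,g$, define $a:\mathcal C\to\mathbb R$ and $b:\mathcal C\to\mathbb R^m$ (row vector) by $$a(\phi)=\left.\frac{\partial V(x,\phi_{[-\Delta,0)})}{\partial x}\right|_{x=\phi(0)}f(\phi)+\left.\frac{\partial V(\phi(0),\phi^\ell_{[-\Delta,0)})}{\partial\ell}\right|_{\ell=0},\qquad b(\phi)=\left.\frac{\partial V(x,\phi_{[-\Delta,0)})}{\partial x}\right|_{x=\phi(0)}g(\phi).$$ For a positive real $r$, define $k_r:\mathcal C\to\mathbb R^m$ by $$k_r(\phi)=\begin{cases}-\dfrac{a(\phi)+\sqrt{a^2(\phi)+|b(\phi)|^4}}{|b(\phi)|^2}\,b^T(\phi),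 & |b(\phi)|>r,\\[2mm] -\dfrac{a(\phi)+\sqrt{a^2(\phi)+|b(\phi)|^4}}{r^2}\,b^T(\phi), & |b(\phi)|\le r.\end{cases}$$ **Solutions.** Solutions of the differential equation are understood in the usual Carathéodory sense (locally absolutely continuous on $t\ge0$, satisfying the equation almost everywhere). *)

(* Defs.v *)
From HB Require Import structures.
From mathcomp Require Import all_boot all_order all_algebra.
From mathcomp Require Import all_classical all_reals all_analysis ess_sup_inf.

Set Implicit Arguments.
Unset Strict Implicit.
Unset Printing Implicit Defensive.

Import Order.TTheory GRing.Theory Num.Theory.
Import numFieldNormedType.Exports.

Local Open Scope classical_set_scope.
Local Open Scope ring_scope.

(* A function defined on an interval D of the real line is represented by its
   extension by 0 to the whole of R (one representative per function), so that
   spaces of functions are sets of functions R -> 'cV[R]_n. A map defined on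
   such a space is a total Rocq function, of which only the values on the space
   are ever constrained or used. *)

Section Norms.
Variable R : realType.

(* Euclidean norm, used for row and column vectors only; the norm of a
   rectangular matrix is opnorm. *)
Definition enorm (p q : nat) (A : 'M[R]_(p, q)) : R :=
  Num.sqrt (\sum_i \sum_j A i j ^+ 2).

Definition opnorm (p q : nat) (A : 'M[R]_(p, q)) : R :=
  sup [set enorm (A *m x) | x in [set x : 'cV[R]_q | enorm x <= 1]].

Definition truncation (n : nat) (D : set R) (v : R -> 'cV[R]_n) : R -> 'cV[R]_n :=
  patch (fun=> 0) D v.

(* Since functions vanish off their domain and enorm is nonnegative, the
   essential supremum over R is the one over the domain. *)
Definition ess_norm (n : nat) (v : R -> 'cV[R]_n) : \bar R :=
  ess_sup (@lebesgue_measure R) (fun s => (enorm (v s))%:E).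

(* Meaningful when ess_norm v is finite (fine +oo = 0). *)
Definition norm_infty (n : nat) (v : R -> 'cV[R]_n) : R := fine (ess_norm v).

Definition locally_ess_bounded (n : nat) (v : R -> 'cV[R]_n) : Prop :=
  forall T : R, 0 < T -> (ess_norm (truncation `[0%R, T[ v) < +oo)%E.

(* Lebesgue (not merely Borel) measurability on [0, +oo), componentwise; the
   sigma-algebra on the source is the one carrying completed_lebesgue_measure. *)
Definition lebesgue_measurable_fun (n : nat) (v : R -> 'cV[R]_n) : Prop :=
  forall i : 'I_n,
    measurable_fun
      (`[0%R, +oo[ : set (caratheodory_type
         ((wlength (idfun : R -> R))^*%mu)))
      (fun t => v t i 0 : measurableTypeR R).

End Norms.

Section Spaces.
Variables (R : realType) (n : nat) (Delta : R).

Definition spaceC : set (R -> 'cV[R]_n) :=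
  [set phi : R -> 'cV[R]_n | {within `[- Delta, 0], continuous phi} /\
             forall s : R, s \notin `[- Delta, 0] -> phi s = 0].

Definition spaceQ : set (R -> 'cV[R]_n) :=
  [set phi : R -> 'cV[R]_n |
    [/\ exists M : R, forall s : R, s \in `[- Delta, 0[ -> enorm (phi s) <= M,
        exists2 S : set R, finite_set S &
          forall s : R, s \in `[- Delta, 0[ -> ~ S s ->
            phi @ within [set` `[- Delta, 0[] (nbhs s) --> phi s,
        forall s : R, s \in `[- Delta, 0[ -> phi @ s^'+ --> phi s &
        forall s : R, s \notin `[- Delta, 0[ -> phi s = 0]].

Definition restrQ (phi : R -> 'cV[R]_n) : R -> 'cV[R]_n :=
  truncation `[- Delta, 0[ phi.

Definition segment (x : R -> 'cV[R]_n) (t : R) : R -> 'cV[R]_n :=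
  truncation `[- Delta, 0] (fun tau => x (t + tau)).

Definition closureC (A : set (R -> 'cV[R]_n)) : set (R -> 'cV[R]_n) :=
  [set phi | spaceC phi /\
     forall e : R, 0 < e -> exists2 psi, A psi & norm_infty (phi \- psi) < e].

Definition openballC (phi : R -> 'cV[R]_n) (delta : R) : set (R -> 'cV[R]_n) :=
  [set psi | spaceC psi /\ norm_infty (psi \- phi) < delta].

End Spaces.

Section Regularity.
(* N is the norm of the target space. *)
Variables (R : realType) (n : nat) (Delta : R) (W : zmodType) (N : W -> R).
Local Notation C := (@spaceC R n Delta).

Definition continuousC (F : (R -> 'cV[R]_n) -> W) : Prop :=
  forall phi, C phi -> forall e : R, 0 < e ->
    exists2 delta : R, 0 < delta &
      forall psi, C psi -> norm_infty (psi \- phi) < delta ->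
        N (F psi - F phi) < e.

Definition completely_continuous (F : (R -> 'cV[R]_n) -> W) : Prop :=
  continuousC F /\
  forall A : set (R -> 'cV[R]_n),
    A `<=` C -> closureC Delta A `<=` A ->
    (exists M : R, forall phi, A phi -> norm_infty phi <= M) ->
    exists M : R, forall phi, A phi -> N (F phi) <= M.

Definition locally_lipschitz (F : (R -> 'cV[R]_n) -> W) : Prop :=
  forall phi, C phi -> exists delta eta : R,
    [/\ 0 < delta, 0 < eta &
     forall phi1 phi2,
       closureC Delta (openballC Delta phi delta) phi1 ->
       closureC Delta (openballC Delta phi delta) phi2 ->
       N (F phi1 - F phi2) <= eta * norm_infty (phi1 \- phi2)].

End Regularity.

Section ComparisonFunctions.
Variable R : realType.
(* Functions on [0, +oo); their values at negative arguments are irrelevant. *)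

Definition classK (gamma : R -> R) : Prop :=
  [/\ {within `[0%R, +oo[, continuous gamma}, gamma 0 = 0 &
      forall s1 s2, 0 <= s1 -> s1 < s2 -> gamma s1 < gamma s2].

Definition classKinfty (gamma : R -> R) : Prop :=
  classK gamma /\ forall M : R, exists2 s, 0 <= s & M < gamma s.

(* Nonincreasing rather than strictly decreasing, as beta 0 = 0 must be allowed
   when beta is of class KL. *)
Definition classL (gamma : R -> R) : Prop :=
  [/\ {within `[0%R, +oo[, continuous gamma},
      forall s1 s2, 0 <= s1 -> s1 <= s2 -> gamma s2 <= gamma s1 &
      gamma s @[s --> +oo] --> (0 : R)].

Definition classKL (beta : R -> R -> R) : Prop :=
  (forall t, 0 <= t -> classK (beta ^~ t)) /\
  (forall s, 0 <= s -> classL (beta s)).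

End ComparisonFunctions.

Section Functionals.
Variables (R : realType) (n : nat) (Delta : R).
Local Notation C := (@spaceC R n Delta).
Local Notation Q := (@spaceQ R n Delta).

Definition Ma_functional (Ma : (R -> 'cV[R]_n) -> R) : Prop :=
  exists gamma_a gamma_a' : R -> R,
    [/\ classKinfty gamma_a, classKinfty gamma_a' &
     forall phi, C phi ->
       gamma_a (enorm (phi 0)) <= Ma phi <= gamma_a' (norm_infty phi)].

(* For h = 0 and phi in Q this is phi. *)
Definition psi_shift (phi Y : R -> 'cV[R]_n) (h : R) : R -> 'cV[R]_n :=
  fun s => if s \in `[- Delta, - h[ then phi (s + h)
           else if s \in `[- h, 0[ then Y (s + h) else 0.

Definition hold (phi : R -> 'cV[R]_n) (h : R) : R -> 'cV[R]_n :=
  fun s => if s \in `[- Delta, - h[ then phi (s + h)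
           else if s \in `[- h, 0] then phi 0 else 0.

Definition right_quotient (F : R -> R) : R -> R :=
  fun h => h^-1 * (F h - F 0).

Implicit Type V : 'cV[R]_n -> (R -> 'cV[R]_n) -> R.

Definition grad V (x : 'cV[R]_n) (phi : R -> 'cV[R]_n) : 'rV[R]_n :=
  \row_i 'D_(delta_mx i 0) (fun y => V y phi) x.

(* The remainder of the expansion is a little-o for each fixed Y: its rate is
   uniform in (z, h) but may depend on x, phi and Y. *)
Definition invariantly_differentiable V : Prop :=
  forall x phi, Q phi ->
  exists dV : R,
  [/\ forall Y, {within `[0%R, Delta], continuous Y} -> Y 0 = x ->
        right_quotient (fun h => V x (psi_shift phi Y h)) h
          @[h --> 0^'+] --> dV,
      differentiable (fun y => V y phi) x &
      forall Y, {within `[0%R, Delta], continuous Y} -> Y 0 = x ->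
      forall e : R, 0 < e -> exists2 delta : R, 0 < delta &
      forall (z : 'cV[R]_n) (h : R), 0 <= h < Delta ->
        Num.sqrt (enorm z ^+ 2 + h ^+ 2) < delta ->
        `| V (x + z) (psi_shift phi Y h) - V x phi
           - ((grad V x phi *m z) 0 0 + dV * h) |
          <= e * Num.sqrt (enorm z ^+ 2 + h ^+ 2)].

Definition V_C V (phi : R -> 'cV[R]_n) : R := V (phi 0) (restrQ Delta phi).

Definition dVdh V (phi : R -> 'cV[R]_n) : R :=
  lim (right_quotient (fun h => V (phi 0) (restrQ Delta (hold phi h))) h
         @[h --> 0^'+]).

Definition dVdx V (phi : R -> 'cV[R]_n) : 'rV[R]_n :=
  grad V (phi 0) (restrQ Delta phi).

Definition classV V : Prop :=
  [/\ forall x phi, Q phi -> 0 <= V x phi,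
      locally_lipschitz Delta (@Num.norm R R) (V_C V),
      invariantly_differentiable V,
      completely_continuous Delta (@Num.norm R R) (dVdh V) /\
      locally_lipschitz Delta (@Num.norm R R) (dVdh V) &
      completely_continuous Delta (@enorm R 1 n) (dVdx V) /\
      locally_lipschitz Delta (@enorm R 1 n) (dVdx V)].

Variable m : nat.
Implicit Types (f : (R -> 'cV[R]_n) -> 'cV[R]_n)
  (g : (R -> 'cV[R]_n) -> 'M[R]_(n, m)).

Definition map_a V f (phi : R -> 'cV[R]_n) : R :=
  (dVdx V phi *m f phi) 0 0 + dVdh V phi.

Definition map_b V g (phi : R -> 'cV[R]_n) : 'rV[R]_m := dVdx V phi *m g phi.

Definition map_k V f g (r : R) (phi : R -> 'cV[R]_n) : 'cV[R]_m :=
  let a := map_a V f phi in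
  let b := map_b V g phi in
  let c := a + Num.sqrt (a ^+ 2 + enorm b ^+ 4) in
  if r < enorm b then - (c / enorm b ^+ 2) *: b^T
  else - (c / r ^+ 2) *: b^T.

End Functionals.

Section Solutions.
Variables (R : realType) (n m : nat) (Delta : R).

(* A finite family of pairwise non-overlapping subintervals of [0, T] is a list
   of pairs of endpoints. *)
Definition absolutely_continuous (T : R) (x : R -> 'cV[R]_n) : Prop :=
  forall e : R, 0 < e -> exists2 delta : R, 0 < delta &
  forall s : seq (R * R),
    (forall p, p \in s -> 0 <= p.1 /\ p.1 <= p.2 /\ p.2 <= T) ->
    pairwise (fun p q => (p.2 <= q.1) || (q.2 <= p.1)) s ->
    \sum_(p <- s) (p.2 - p.1) < delta ->
    \sum_(p <- s) enorm (x p.2 - x p.1) < e.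

(* Caratheodory solution on [-Delta, c) of
     x'(t) = f(x_t) + g(x_t) (u(t) + d(t)),  x_0 = xi0,
   where c is a positive real or +oo. *)
Definition solution_on (f : (R -> 'cV[R]_n) -> 'cV[R]_n)
    (g : (R -> 'cV[R]_n) -> 'M[R]_(n, m)) (u d : R -> 'cV[R]_m)
    (xi0 : R -> 'cV[R]_n) (c : \bar R) (x : R -> 'cV[R]_n) : Prop :=
  [/\ forall tau : R, tau \in `[- Delta, 0] -> x tau = xi0 tau,
      forall T : R, 0 <= T -> (T%:E < c)%E -> absolutely_continuous T x &
      {ae @lebesgue_measure R, forall t : R, 0 <= t -> (t%:E < c)%E ->
        is_derive t (1 : R) x
          (f (segment Delta x t) + g (segment Delta x t) *m (u t + d t))}].

End Solutions.

(* Main.v *)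
Require Import Defs.
From HB Require Import structures.
From mathcomp Require Import all_boot all_order all_algebra.
From mathcomp Require Import all_classical all_reals all_analysis measurable_realfun ess_sup_inf.
From mathcomp Require Import ring lra.
Set Implicit Arguments.
Unset Strict Implicit.
Unset Printing Implicit Defensive.
Import Order.TTheory GRing.Theory Num.Theory.
Import numFieldNormedType.Exports.
Local Open Scope classical_set_scope.
Local Open Scope ring_scope.

(** The maps [a] and [b] are regular, that is, locally Lipschitz and bounded on
    bounded sets: both notions pass to sums and products ([regC_op2]). The
    feedback is [- (a + sqrt (a^2 + |b|^4)) / max(|b|, r)^2 *: b^T] ([map_kE]).
    The square root is the Euclidean norm of [(a, |b|^2)], hence Lipschitz in
    this pair, and the divisor is at least [r^2]; so the feedback is regular
    ([map_k_reg]).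

    Let [x] solve the closed loop and let [w] be the value of [V] on the
    segments of [x]. Invariant differentiability, with the trajectory itself as
    continuation, shows that the right Dini derivatives of [w] are bounded
    everywhere, so [w] is absolutely continuous ([V_traj_ac]), and that almost
    everywhere its right derivative is [a + b (u + d)] ([V_dini_ederiv]). Write
    [S] for [sqrt (a^2 + |b|^4)], which is at least [alpha3 (Ma)]. Where
    [|b| > r], the term [k_r] of the control turns [a] into [- S]; elsewhere it
    leaves a defect of at most [a + S <= (2 p + r) |b|], by (ii) and (iv). The
    term [- q |b|^2] absorbs the defect and [b d] by completing the square, so
    that [w' <= - rho w + c] with [rho] the composite of [alpha3] and the
    inverse of [alpha2] and [c = (|d|^2 + (2 p + r)^2) / (2 q)]
    ([scalar_dissipation], [dissipation]).

    While [rho w >= 2 c], the derivative of [w] is at most [- rho w / 2]. Hence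
    [w t] is at most the larger of the level where [rho] is [2 c] and of the
    solution [y] of [y + t * rho y / 2 = w 0] ([comparison_bound]): a function
    that stays above [y] up to time [t] has lost [t * rho y / 2]. This [y] is a
    function of class KL of [w 0] and [t] ([implicit_KL]), and the inverse of
    [alpha1] turns the bound on [w] into one on [|x|] ([iss_estimate]), with
    functions that involve neither [r] nor [p].

    Solutions exist locally by Picard iteration ([local_solution]), the
    disturbance being replaced by a Borel function equal to it almost everywhere
    ([borel_version]). They are unique ([solves_unique]), and global because the
    estimate above bounds them on bounded intervals: a bounded solution is
    Lipschitz, so it has a limit at the end of its interval and can be continued
    ([global_solution]). Estimates from derivatives known almost everywhere all
    rest on [ac_increment_le], the monotonicity of absolutely continuous
    functions. *)

(** * Euclidean norms *)

Section EuclideanNorm.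
Variable R : realType.

(** The sum of the squares of [B a_i - C b_i] is [B (A B - C ^ 2)]. *)
Lemma cauchy_schwarz_sum (I : finType) (a b : I -> R) :
  (\sum_i a i * b i) ^+ 2 <= (\sum_i a i ^+ 2) * (\sum_i b i ^+ 2).
Proof.
set A := \sum_i a i ^+ 2; set B := \sum_i b i ^+ 2; set C := \sum_i a i * b i.
have B0 : 0 <= B by apply: sumr_ge0 => i _; exact: sqr_ge0.
have [B_eq0|Bn0] := eqVneq B 0.
  have b0 i : b i = 0.
    apply/eqP; rewrite -sqrf_eq0; apply/eqP.
    by apply: (psumr_eq0P _ B_eq0) => // j _; exact: sqr_ge0.
  by rewrite [C]big1 ?expr0n/= ?B_eq0 ?mulr0// => i _; rewrite b0 mulr0.
have : 0 <= \sum_i (B * a i - C * b i) ^+ 2.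
  by apply: sumr_ge0 => i _; exact: sqr_ge0.
have -> : \sum_i (B * a i - C * b i) ^+ 2 = B * (A * B - C ^+ 2).
  transitivity (\sum_i (B ^+ 2 * a i ^+ 2 - 2 * B * C * (a i * b i)
                        + C ^+ 2 * b i ^+ 2)).
    by apply: eq_bigr => i _; ring.
  by rewrite !big_split/= sumrN -!mulr_sumr -/A -/B -/C; ring.
by rewrite pmulr_rge0 ?subr_ge0// lt_neqAle eq_sym Bn0.
Qed.

Section Fixed.
Variables p q : nat.
Implicit Types A B : 'M[R]_(p, q).

Lemma enormE A : enorm A = Num.sqrt (\sum_(ij : 'I_p * 'I_q) A ij.1 ij.2 ^+ 2).
Proof. by rewrite /enorm pair_big. Qed.

Lemma enorm_ge0 A : 0 <= enorm A.
Proof. exact: sqrtr_ge0. Qed.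

Lemma enorm_sqr A : enorm A ^+ 2 = \sum_(ij : 'I_p * 'I_q) A ij.1 ij.2 ^+ 2.
Proof. by rewrite enormE sqr_sqrtr// sumr_ge0// => i _; exact: sqr_ge0. Qed.

Lemma enorm0 : enorm (0 : 'M[R]_(p, q)) = 0.
Proof. by rewrite enormE big1 ?sqrtr0// => i _; rewrite mxE expr0n. Qed.

Lemma enormZ (c : R) A : enorm (c *: A) = `|c| * enorm A.
Proof.
apply/eqP; rewrite -(@eqrXn2 _ 2%N)// ?mulr_ge0 ?enorm_ge0//.
rewrite exprMn !enorm_sqr mulr_sumr real_normK ?num_real//.
by apply/eqP/eq_bigr => i _; rewrite mxE exprMn.
Qed.

Lemma enormN A : enorm (- A) = enorm A.
Proof. by rewrite -scaleN1r enormZ normrN normr1 mul1r. Qed.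

Lemma enormD A B : enorm (A + B) <= enorm A + enorm B.
Proof.
rewrite -(@ler_pXn2r _ 2%N)// ?nnegrE ?addr_ge0 ?enorm_ge0//.
rewrite sqrrD !enorm_sqr.
under eq_bigr do rewrite mxE sqrrD.
rewrite !big_split/= lerD2r lerD2l.
rewrite -mulr2n lerMn2r/=.
rewrite (le_trans (ler_norm _))// -(@ler_pXn2r _ 2%N)//;
  rewrite ?nnegrE ?normr_ge0 ?mulr_ge0 ?enorm_ge0//.
by rewrite real_normK ?num_real// exprMn !enorm_sqr cauchy_schwarz_sum.
Qed.

Lemma enormB A B : enorm (A - B) <= enorm A + enorm B.
Proof. by rewrite (le_trans (enormD _ _))// enormN. Qed.

Lemma enorm_distC A B : enorm (A - B) = enorm (B - A).
Proof. by rewrite -enormN opprB. Qed.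

Lemma enorm_dist (A B : 'M[R]_(p, q)) : `|enorm A - enorm B| <= enorm (A - B).
Proof.
rewrite ler_norml lerNl opprB !lerBlDl; apply/andP; split.
  by rewrite enorm_distC (le_trans _ (enormD _ _))// addrC subrK.
by rewrite (le_trans _ (enormD _ _))// addrC subrK.
Qed.

Lemma enorm_tri (A B C : 'M[R]_(p, q)) :
  enorm (A - C) <= enorm (A - B) + enorm (B - C).
Proof. by rewrite (le_trans _ (enormD _ _))// addrA subrK. Qed.

Lemma coord_le_enorm A i j : `|A i j| <= enorm A.
Proof.
rewrite -(@ler_pXn2r _ 2%N)// ?nnegrE ?enorm_ge0// enorm_sqr.
rewrite real_normK ?num_real// (bigD1 (i, j))//= lerDl.
by apply: sumr_ge0 => k _; exact: sqr_ge0.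
Qed.

Lemma enorm_le_sum A : enorm A <= \sum_i \sum_j `|A i j|.
Proof.
have h0 (s : seq ('I_p * 'I_q)) : 0 <= \sum_(ij <- s) `|A ij.1 ij.2|.
  by apply: sumr_ge0.
rewrite pair_big enormE/= -(ger0_norm (h0 _)) -sqrtr_sqr ler_wsqrtr//.
elim: (index_enum _) => [|x s IH]; first by rewrite !big_nil expr0n.
rewrite !big_cons sqrrD -addrA real_normK ?num_real// lerD2l.
by rewrite (le_trans IH)// lerDr mulrn_wge0// mulr_ge0.
Qed.

Lemma enorm_le_coord A (k : R) :
  (forall i j, `|A i j| <= k) -> enorm A <= (p * q)%:R * k.
Proof.
move=> Ak; apply: (le_trans (enorm_le_sum A)).
apply: (@le_trans _ _ (\sum_(i < p) \sum_(j < q) k)).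
  by apply: ler_sum => i _; apply: ler_sum => j _; exact: Ak.
by rewrite !sumr_const !card_ord -mulrnA mulr_natl mulnC.
Qed.

Lemma enorm_eq0 A : enorm A = 0 -> A = 0.
Proof.
move=> A0; apply/matrixP => i j; rewrite mxE; apply/eqP.
by rewrite -normr_le0 -A0 coord_le_enorm.
Qed.

Lemma mx_norm_le_enorm A : `|A| <= enorm A.
Proof.
rewrite /Num.Def.normr/= mx_normrE; apply: bigmax_le; first exact: enorm_ge0.
by move=> i _; exact: coord_le_enorm.
Qed.

Lemma enorm_le_mx_norm A : enorm A <= (p * q)%:R * `|A|.
Proof.
apply: enorm_le_coord => i j; rewrite [leRHS]/Num.Def.normr/= mx_normrE.
by apply: le_trans (le_bigmax _ _ (i, j)).
Qed.

End Fixed.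

Lemma enorm_trmx p q (A : 'M[R]_(p, q)) : enorm A^T = enorm A.
Proof.
rewrite /enorm exchange_big/=; congr Num.sqrt.
by apply: eq_bigr => i _; apply: eq_bigr => j _; rewrite mxE.
Qed.

Lemma enorm_mulmx p q s (A : 'M[R]_(p, q)) (B : 'M[R]_(q, s)) :
  enorm (A *m B) <= enorm A * enorm B.
Proof.
rewrite -(@ler_pXn2r _ 2%N)// ?nnegrE ?mulr_ge0 ?enorm_ge0//.
rewrite exprMn /enorm !sqr_sqrtr;
  try by do 2?[apply: sumr_ge0 => ? _]; exact: sqr_ge0.
rewrite mulr_suml; apply: ler_sum => i _.
rewrite [X in _ * X]exchange_big/= mulr_sumr; apply: ler_sum => j _.
by rewrite mxE cauchy_schwarz_sum.
Qed.

Lemma norm_row_mul_col q (u : 'rV[R]_q) (v : 'cV[R]_q) :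
  `|(u *m v) 0 0| <= enorm u * enorm v.
Proof. exact: le_trans (coord_le_enorm _ _ _) (enorm_mulmx _ _). Qed.

Lemma row_mul_trmx q (u : 'rV[R]_q) : (u *m u^T) 0 0 = enorm u ^+ 2.
Proof.
rewrite mxE /enorm big_ord1 sqr_sqrtr; last first.
  by apply: sumr_ge0 => i _; exact: sqr_ge0.
by apply: eq_bigr => i _; rewrite mxE expr2.
Qed.

(** The induced norm controls the Euclidean one, up to the number of columns:
    apply the matrix to the canonical basis. *)
Lemma enorm_le_opnorm p q (A : 'M[R]_(p, q)) : enorm A <= q%:R * opnorm A.
Proof.
have le_opnorm (v : 'cV[R]_q) : enorm v <= 1 -> enorm (A *m v) <= opnorm A.
  move=> v1; apply: ub_le_sup; last by exists v.
  exists (enorm A) => _ [u /= u1 <-].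
  by rewrite (le_trans (enorm_mulmx _ _))// ler_piMr ?enorm_ge0.
have AE : A = \sum_(j < q) (A *m delta_mx j (0 : 'I_1)) *m
    (delta_mx (0 : 'I_1) j : 'rV[R]_q).
  rewrite -[LHS]mulmx1 mx1_sum_delta mulmx_sumr; apply: eq_bigr => j _.
  by rewrite -mulmxA mul_delta_mx.
have enorm_delta (s t : nat) (i : 'I_s) (j : 'I_t) :
    enorm (delta_mx i j : 'M[R]_(s, t)) = 1.
  rewrite enormE (bigD1 (i, j))//= mxE !eqxx/= expr1n big1 ?addr0 ?sqrtr1//.
  by move=> [k l] /=; rewrite xpair_eqE mxE => /negbTE ->; rewrite expr0n.
have sum_le (s : seq 'I_q) :
    enorm (\sum_(j <- s) (A *m delta_mx j (0 : 'I_1)) *m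
      (delta_mx (0 : 'I_1) j : 'rV[R]_q)) <= (size s)%:R * opnorm A.
  elim: s => [|j s IH]; first by rewrite big_nil enorm0 mul0r.
  rewrite big_cons (le_trans (enormD _ _))//= -natr1 mulrDl mul1r addrC lerD//.
  rewrite (le_trans (enorm_mulmx _ _))// enorm_delta mulr1.
  by rewrite le_opnorm// enorm_delta.
have := sum_le (index_enum 'I_q).
by rewrite -AE -[index_enum _]enumT size_enum_ord.
Qed.

End EuclideanNorm.

(** * Continuity on subsets of the line *)

Section ContinuityOn.
Variable R : realType.

(** Induction along a segment: the step crosses [s] from the left and goes a
    little beyond it, so the supremum of the segments on which [P] holds can
    only be the right endpoint. *)
Lemma segment_induction (a b : R) (P : R -> Prop) : a <= b ->
  (forall s : R, a <= s <= b -> (forall t : R, a <= t -> t < s -> P t) ->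
     exists2 h : R, 0 < h &
       forall t : R, s <= t -> t <= s + h -> t <= b -> P t) ->
  forall t : R, a <= t <= b -> P t.
Proof.
move=> ab step.
pose S := [set s | a <= s <= b /\ forall t, a <= t -> t < s -> P t].
have Sa : S a.
  by split; [rewrite lexx ab|move=> t h1 h2; have := le_lt_trans h1 h2; rewrite ltxx].
have S0 : has_sup S by split; [exists a|exists b => s [/andP[]]].
set c := sup S.
have ac : a <= c by apply: ub_le_sup => //; exact: S0.2.
have cb : c <= b by apply: ge_sup; [exists a|move=> s [/andP[]]].
have Sc : S c.
  split; [by rewrite ac cb|move=> t at_ tc].
  have [s Ss ts] := sup_gt S0.1 tc.
  exact: Ss.2.
have [h h0 Ph] := step c Sc.1 Sc.2.
have Pall t : a <= t -> t <= c + h -> t <= b -> P t.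
  move=> at_ tch tb; have [ct|tc] := leP c t; [exact: Ph|exact: Sc.2].
have [bch|chb] := leP b (c + h).
  by move=> t /andP[at_ tb]; apply: Pall => //; exact: le_trans bch.
suff : c + h <= c by rewrite gerDl leNgt h0.
apply: ub_le_sup; first exact: S0.2.
split; first by rewrite (le_trans ac) ?lerDl ?ltW.
by move=> t at_ tch; apply: Pall => //; apply: ltW => //; exact: lt_trans chb.
Qed.

Definition cont_on (W : zmodType) (N : W -> R) (D : set R) (f : R -> W) :=
  forall s, D s -> forall e, 0 < e -> exists2 delta, 0 < delta &
    forall r, D r -> `|r - s| < delta -> N (f r - f s) < e.

Definition cont_onR (D : set R) (f : R -> R) :=
  forall s, D s -> forall e : R, 0 < e -> exists2 delta : R, 0 < delta &
    forall r, D r -> `|r - s| < delta -> `|f r - f s| < e.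

Definition even_subadditive (W : zmodType) (N : W -> R) :=
  (forall x y, N (x + y) <= N x + N y) /\ (forall x, N (- x) = N x).

Lemma normr_even_subadditive : even_subadditive (@Num.norm R R).
Proof. by split; [exact: ler_normD|exact: normrN]. Qed.

Lemma enorm_even_subadditive p q : even_subadditive (@enorm R p q).
Proof. by split; [exact: enormD|exact: enormN]. Qed.

Lemma cont_on_subset (W : zmodType) (N : W -> R) (D D' : set R) (f : R -> W) :
  D' `<=` D -> cont_on N D f -> cont_on N D' f.
Proof.
move=> DD cf s /DD Ds e e0; have [d d0 h] := cf s Ds e e0.
by exists d => // r /DD; exact: h.
Qed.

Lemma within_continuous_normP (V : normedModType R) (N : V -> R) (c : R)
    (D : set R) (f : R -> V) :
  (forall v, `|v| <= N v) -> (forall v, N v <= c * `|v|) ->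
  {within D, continuous f} <-> cont_on N D f.
Proof.
move=> lN Nl; rewrite subspace_continuousP; split => cf s Ds.
  move=> e e0.
  have e' : 0 < e / (`|c| + 1) by rewrite divr_gt0// ltr_wpDl.
  have /cvgrPdist_lt/(_ _ e') := cf s Ds; rewrite near_withinE.
  move=> /nbhs_ballP[d /= d0 h]; exists d => // r Dr rs.
  have := h r; rewrite /ball/= distrC => /(_ rs Dr).
  rewrite ltr_pdivlMr ?ltr_wpDl// distrC; apply: le_lt_trans.
  rewrite (le_trans (Nl _))// mulrC ler_wpM2l// (le_trans (ler_norm _))//.
  by rewrite lerDl.
apply/cvgrPdist_lt => e e0; rewrite near_withinE.
have [d d0 h] := cf s Ds e e0.
apply/nbhs_ballP; exists d => //= r; rewrite /ball/= distrC => rs Dr.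
by rewrite distrC (le_lt_trans (lN _))// h.
Qed.

Lemma within_continuous_realP (D : set R) (f : R -> R) :
  {within D, continuous f} <-> cont_onR D f.
Proof. by apply: (@within_continuous_normP _ (@Num.norm R R) 1) => v; rewrite ?mul1r. Qed.

Lemma within_continuous_mxP p q (D : set R) (f : R -> 'M[R]_(p, q)) :
  {within D, continuous f} <-> cont_on (@enorm R p q) D f.
Proof.
by apply: (within_continuous_normP _ _ (@mx_norm_le_enorm R p q)
  (@enorm_le_mx_norm R p q)).
Qed.

Lemma cont_on_bounded (W : zmodType) (N : W -> R) (a b : R) (f : R -> W) :
  even_subadditive N -> cont_on N `[a, b] f ->
  exists M, forall t, a <= t <= b -> N (f t) <= M.
Proof.
move=> [Nadd _] cf; have [ab|ba] := leP a b; last first.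
  exists 0 => t /andP[at_ tb].
  by have := le_lt_trans (le_trans at_ tb) ba; rewrite ltxx.
suff H : forall t, a <= t <= b ->
    exists M, forall u, a <= u <= t -> N (f u) <= M.
  by apply: (H b); rewrite ab lexx.
apply: segment_induction => // s sab IH.
have [d d0 h] := cf s sab 1 ltr01.
have near_s u : a <= u <= b -> `|u - s| < d -> N (f u) <= N (f s) + 1.
  move=> uab us; rewrite -[f u](subrK (f s)) (le_trans (Nadd _ _))//.
  by rewrite addrC lerD2l ltW// h.
have [M HM] : exists M, forall u, a <= u -> u <= s - d / 2 -> N (f u) <= M.
  have [asd|sda] := leP a (s - d / 2).
    have [|M HM] := IH _ asd; first by lra.
    by exists M => u au us; apply: HM; rewrite au.
  by exists 0 => u au us; have := le_lt_trans (le_trans au us) sda; rewrite ltxx.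
exists (d / 2); first lra.
move=> t st tsd tb; exists (Num.max M (N (f s) + 1)) => u /andP[au ut].
rewrite le_max; have [us|su] := leP u (s - d / 2); first by rewrite HM.
apply/orP; right; apply: near_s; first by rewrite au (le_trans ut).
by rewrite ltr_norml; apply/andP; split; lra.
Qed.

(** Heine's theorem: past a point [s], the modulus found up to a little before [s]
    is combined with the one given by continuity at [s]. *)
Lemma cont_on_uniform (W : zmodType) (N : W -> R) (a b : R) (f : R -> W) :
  even_subadditive N -> cont_on N `[a, b] f ->
  forall e, 0 < e -> exists2 delta, 0 < delta &
    forall u v, a <= u <= b -> a <= v <= b -> `|u - v| < delta ->
      N (f u - f v) < e.
Proof.
have close (d s u v : R) : 0 < d -> u <= s + d / 2 -> v <= s + d / 2 ->
    `|u - v| < d / 2 -> (s - d / 2 < u) || (s - d / 2 < v) ->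
    `|u - s| < d /\ `|v - s| < d.
  rewrite !ltr_norml => d0 us vs /andP[uv1 uv2] /orP[h|h];
    by split; apply/andP; split; lra.
move=> [Nadd Nopp] cf e e0; have [ab|ba] := leP a b; last first.
  exists 1 => // t v /andP[at_ tb].
  by have := le_lt_trans (le_trans at_ tb) ba; rewrite ltxx.
suff H : forall t, a <= t <= b -> exists2 delta, 0 < delta &
    forall u v, a <= u <= t -> a <= v <= t -> `|u - v| < delta ->
      N (f u - f v) < e.
  by apply: (H b); rewrite ab lexx.
apply: segment_induction => // s sab IH.
have e2 : 0 < e / 2 by rewrite divr_gt0.
have [d d0 h] := cf s sab _ e2.
have near_s u v : a <= u <= b -> `|u - s| < d ->  a <= v <= b -> `|v - s| < d ->
    N (f u - f v) < e.
  move=> uab us vab vs; rewrite -[f u](subrK (f s)) -addrA.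
  rewrite (le_lt_trans (Nadd _ _))// (splitr e) ltrD ?h//.
  by rewrite -Nopp opprB h.
have [d1 d10 Hd1] : exists2 d1, 0 < d1 & forall u v, a <= u -> u <= s - d / 2 ->
    a <= v -> v <= s - d / 2 -> `|u - v| < d1 -> N (f u - f v) < e.
  have [asd|sda] := leP a (s - d / 2).
    have [|d1 d10 HM] := IH _ asd; first by lra.
    by exists d1 => // u v au us av vs; apply: HM; apply/andP.
  exists 1 => // u v au us.
  by have := le_lt_trans (le_trans au us) sda; rewrite ltxx.
exists (d / 2); first lra.
move=> t st tsd tb; exists (Num.min d1 (d / 2)).
  by rewrite lt_min d10; lra.
move=> u v /andP[au ut] /andP[av vt]; rewrite lt_min => /andP[uv1 uv2].
have [/andP[us vs]|] := boolP ((u <= s - d / 2) && (v <= s - d / 2)).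
  exact: Hd1.
rewrite negb_and -!ltNge => H.
have [us vs] := close d s u v d0 (le_trans ut tsd) (le_trans vt tsd) uv2 H.
by apply: near_s => //; [rewrite au (le_trans ut)|rewrite av (le_trans vt)].
Qed.

End ContinuityOn.

(** * Comparison functions *)

Section Comparison.
Variable R : realType.
Implicit Types g : R -> R.

Lemma classK_le g : classK g -> forall s t, 0 <= s -> s <= t -> g s <= g t.
Proof.
move=> [_ _ gi] s t s0; rewrite le_eqVlt => /predU1P[->//|st].
by rewrite ltW// gi.
Qed.

Lemma classK_ge0 g : classK g -> forall s, 0 <= s -> 0 <= g s.
Proof. by move=> gK s s0; case: (gK) => _ <- _; exact: classK_le. Qed.

Lemma classK_gt0 g : classK g -> forall s, 0 < s -> 0 < g s.
Proof. by move=> [_ g0 gi] s s0; rewrite -g0 gi. Qed.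

Lemma classK_inj_le g : classK g -> forall s t, 0 <= s -> 0 <= t ->
  g s <= g t -> s <= t.
Proof.
move=> [_ _ gi] s t s0 t0 gst; rewrite leNgt; apply/negP => ts.
by have := gi _ _ t0 ts; rewrite ltNge gst.
Qed.

Lemma classK_cont g : classK g -> cont_onR `[0, +oo[ g.
Proof. by move=> [/within_continuous_realP]. Qed.

Lemma itv0y (s : R) : ([set` `[0%R, +oo[] : set R) s = (0 <= s) :> Prop.
Proof. by rewrite /= in_itv/= andbT. Qed.

Lemma classK_comp g1 g2 : classK g1 -> classK g2 -> classK (g1 \o g2).
Proof.
move=> g1K g2K; split; first last.
- case: (g1K) (g2K) => _ _ h1 [_ _ h2] s t s0 st /=.
  by apply: h1; [exact: classK_ge0|exact: h2].
- by case: g1K g2K => _ h1 _ [_ h2 _] /=; rewrite h2.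
apply/within_continuous_realP => s; rewrite itv0y => s0 e e0.
have gs0 : `[0, +oo[%classic (g2 s) by rewrite itv0y classK_ge0.
have [d d0 h] := classK_cont g1K gs0 e0.
have ss0 : `[0, +oo[%classic s by rewrite itv0y.
have [d' d'0 h'] := classK_cont g2K ss0 d0.
exists d' => // r; rewrite itv0y => r0 rs; apply: h; last first.
  by apply: h' => //; rewrite itv0y.
by rewrite itv0y classK_ge0.
Qed.

(** A monotone function that jumps misses a value. *)
Lemma monotone_onto_continuous g :
  (forall x y, 0 <= x -> x <= y -> g x <= g y) ->
  (forall x, 0 <= x -> 0 <= g x) ->
  (forall z, 0 <= z -> exists2 x, 0 <= x & g x = z) ->
  {within `[0, +oo[, continuous g}.
Proof.
move=> gmono g0 gonto; apply/within_continuous_realP => s.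
rewrite itv0y => s0 e e0.
have gs0 := g0 _ s0.
have e20 : 0 < e / 2 by rewrite divr_gt0.
have [s1 s10 gs1] := gonto (g s + e / 2) (addr_ge0 gs0 (ltW e20)).
have ss1 : s < s1.
  rewrite ltNge; apply/negP => /(gmono _ _ s10); rewrite gs1 leNgt.
  by rewrite ltrDl e20.
have [egs|gse] := leP (e / 2) (g s).
  have z0 : 0 <= g s - e / 2 by rewrite subr_ge0.
  have [s2 s20 gs2] := gonto _ z0.
  have ss2 : s2 < s.
    rewrite ltNge; apply/negP => /(gmono _ _ s0); rewrite gs2 leNgt.
    by rewrite ltrBlDr ltrDl e20.
  exists (Num.min (s1 - s) (s - s2)).
    by rewrite lt_min !subr_gt0 ss1.
  move=> r; rewrite itv0y => r0; rewrite lt_min !ltr_norml.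
  move=> /andP[/andP[rs1 rs2] /andP[rs3 rs4]].
  have h1 : g r <= g s + e / 2 by rewrite -gs1 gmono//; lra.
  have h2 : g s - e / 2 <= g r by rewrite -gs2 gmono//; lra.
  by apply/andP; split; lra.
exists (s1 - s); first by rewrite subr_gt0.
move=> r; rewrite itv0y => r0; rewrite ltr_norml => /andP[rs1 rs2].
have h1 : g r <= g s + e / 2 by rewrite -gs1 gmono//; lra.
have := g0 _ r0.
by move=> ?; rewrite ltr_norml; apply/andP; split; lra.
Qed.

Lemma onto_of_unbounded g : cont_onR `[0, +oo[ g -> g 0 = 0 ->
  (forall M : R, exists2 s, 0 <= s & M < g s) ->
  forall z, 0 <= z -> exists2 x, 0 <= x & g x = z.
Proof.
move=> gc g0 gu z z0; have [M M0 zM] := gu z.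
have cM : {within `[0, M], continuous g}.
  apply/within_continuous_realP; apply: (@cont_on_subset _ _ (@Num.norm R R)) gc => s.
  by rewrite itv0y /= in_itv/= => /andP[].
have := @IVT R g 0 M z M0 cM; rewrite g0.
have zM' : Num.min 0 (g M) <= z <= Num.max 0 (g M).
  by rewrite ge_min z0/= le_max (ltW zM) orbT.
by move=> /(_ zM')[c]; rewrite in_itv/= => /andP[c0 _] gcz; exists c.
Qed.

Lemma classKinfty_inverse g : classKinfty g -> exists2 gi, classKinfty gi &
  forall s, 0 <= s -> g (gi s) = s /\ gi (g s) = s.
Proof.
move=> [gK gu].
have [g0 gi_] : g 0 = 0 /\ (forall s1 s2, 0 <= s1 -> s1 < s2 -> g s1 < g s2).
  by case: gK.
have onto := onto_of_unbounded (classK_cont gK) g0 gu.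
have [gi Hgi] : exists gi, forall s, 0 <= s -> 0 <= gi s /\ g (gi s) = s.
  have H s : exists x, 0 <= s -> 0 <= x /\ g x = s.
    by have [/onto[x x0 gx]|_] := leP 0 s; [exists x|exists 0].
  by have [gi Hgi] := choice H; exists gi.
have mono x y : 0 <= x -> x <= y -> gi x <= gi y.
  move=> x0 xy; have y0 := le_trans x0 xy.
  have [[gx0 gx] [gy0 gy]] := (Hgi x x0, Hgi y y0).
  by apply: (classK_inj_le gK) => //; rewrite gx gy.
have left_inv s : 0 <= s -> gi (g s) = s.
  move=> s0; have gs0 := classK_ge0 gK s0.
  have [gx0 gx] := Hgi _ gs0.
  by apply/eqP; rewrite eq_le; apply/andP; split;
    apply: (classK_inj_le gK) => //; rewrite gx.
exists gi; last by move=> s s0; split; [exact: (Hgi s s0).2|exact: left_inv].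
split; last first.
  move=> M; exists (g (Num.max 0 M + 1)).
    by rewrite classK_ge0// addr_ge0// le_max lexx.
  rewrite left_inv ?addr_ge0// ?le_max ?lexx//.
  by rewrite ltr_pwDr// le_max lexx orbT.
split.
- apply: monotone_onto_continuous => //; first by move=> x /Hgi[].
  by move=> z z0; exists (g z); [exact: classK_ge0|exact: left_inv].
- by rewrite -{1}g0 left_inv.
- move=> s1 s2 s10 s12; rewrite lt_neqAle mono ?(ltW s12)// andbT.
  apply/eqP => E; have [_ h1] := Hgi _ s10.
  have [_ h2] := Hgi _ (le_trans s10 (ltW s12)).
  by move: s12; rewrite -h1 -h2 E ltxx.
Qed.

Lemma classKinfty_onto g : classKinfty g ->
  forall z, 0 <= z -> exists2 x, 0 <= x & g x = z.
Proof.
move=> gK z z0; have [gi [giK _] h] := classKinfty_inverse gK.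
by exists (gi z); [exact: classK_ge0|exact: (h z z0).1].
Qed.

Lemma classKinfty_comp g1 g2 :
  classKinfty g1 -> classKinfty g2 -> classKinfty (g1 \o g2).
Proof.
move=> [h1 u1] h2; split; first by apply: classK_comp h1 _; case: h2.
move=> M; have [s s0 Ms] := u1 M; have [t t0 gts] := classKinfty_onto h2 s0.
by exists t => //=; rewrite gts.
Qed.

(** The solution [y] of [y + t * rho y = s] bounds at time [t] any trajectory
    that starts at [s] and decreases at rate at least [rho]: as long as it stays
    above [y] it loses at least [rho y] per unit of time. This implicit bound
    spares the integration of the equation [w' = - rho w]. *)
Lemma implicit_KL rho : classKinfty rho -> exists2 bt : R -> R -> R,
  classKL bt & forall s t, 0 <= s -> 0 <= t ->
    0 <= bt s t /\ bt s t + t * rho (bt s t) = s.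
Proof.
move=> [rK ru]; have r0 : rho 0 = 0 by case: rK.
have gK t : 0 <= t -> classKinfty (fun y => y + t * rho y).
  move=> t0; split; last first.
    move=> M; exists (Num.max 0 M + 1).
      by rewrite addr_ge0// le_max lexx.
    have M0 : 0 <= Num.max 0 M by rewrite le_max lexx.
    apply: (@lt_le_trans _ _ (Num.max 0 M + 1)).
      by rewrite ltr_pwDr// le_max lexx orbT.
    by rewrite lerDl mulr_ge0// classK_ge0// addr_ge0.
  split.
  - apply/within_continuous_realP => s; rewrite itv0y => s0 e e0.
    have e1 : 0 < (e / 2) / (t + 1) by rewrite !divr_gt0// ltr_wpDl.
    have ss0 : `[0, +oo[%classic s by rewrite itv0y.
    have [d d0 h] := classK_cont rK ss0 e1.
    exists (Num.min d (e / 2)); first by rewrite lt_min d0 divr_gt0.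
    move=> r r0'; rewrite lt_min => /andP[rs1 rs2].
    have -> : r + t * rho r - (s + t * rho s) = (r - s) + t * (rho r - rho s).
      by ring.
    rewrite (le_lt_trans (ler_normD _ _))// (splitr e) ltr_leD//.
    rewrite normrM (ger0_norm t0).
    have := h r r0' rs1; rewrite ltr_pdivlMr ?ltr_wpDl// => h2.
    have := normr_ge0 (rho r - rho s).
    by nra.
  - by rewrite r0 mulr0 addr0.
  - move=> s1 s2 s10 s12; rewrite ltr_leD// ler_wpM2l//.
    by rewrite classK_le// ltW.
have [bt Hbt] : exists bt : R -> R -> R, forall s t, 0 <= s -> 0 <= t ->
    0 <= bt s t /\ bt s t + t * rho (bt s t) = s.
  have H (st : R * R) : exists y, 0 <= st.1 -> 0 <= st.2 ->
      0 <= y /\ y + st.2 * rho y = st.1.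
    have [s0|_] := leP 0 st.1; last by exists 0.
    have [t0|_] := leP 0 st.2; last by exists 0.
    by have [y y0 yE] := classKinfty_onto (gK _ t0) s0; exists y.
  have [bt Hbt] := choice H.
  by exists (fun s t => bt (s, t)) => s t; exact: (Hbt (s, t)).
exists bt => //; split.
- move=> t t0.
  have mono x y : 0 <= x -> x <= y -> bt x t <= bt y t.
    move=> x0 xy; have y0 := le_trans x0 xy.
    have [[h1 h2] [h3 h4]] := (Hbt _ _ x0 t0, Hbt _ _ y0 t0).
    by apply: (classK_inj_le (gK t t0).1) => //; rewrite h2 h4.
  split.
  + apply: monotone_onto_continuous => //; first by move=> x /Hbt/(_ t0)[].
    move=> z z0; have gz0 := classK_ge0 (gK t t0).1 z0.
    exists (z + t * rho z) => //; have [h1 h2] := Hbt _ _ gz0 t0.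
    by apply/eqP; rewrite eq_le; apply/andP; split;
      apply: (classK_inj_le (gK t t0).1) => //; rewrite h2.
  + have [h1 h2] := Hbt 0 t (lexx 0) t0; apply/eqP.
    rewrite eq_le h1 andbT -{2}h2 lerDl mulr_ge0//.
    by rewrite classK_ge0.
  + move=> s1 s2 s10 s12; have s20 := le_trans s10 (ltW s12).
    rewrite lt_neqAle mono ?(ltW s12)// andbT.
    apply/eqP => E; have [_ h1] := Hbt _ _ s10 t0; have [_ h2] := Hbt _ _ s20 t0.
    by move: s12; rewrite -h1 -h2 E ltxx.
- move=> s s0.
  have mono t1 t2 : 0 <= t1 -> t1 <= t2 -> bt s t2 <= bt s t1.
    move=> t10 t12; have t20 := le_trans t10 t12.
    have [[h1 h2] [h3 h4]] := (Hbt _ _ s0 t10, Hbt _ _ s0 t20).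
    apply: (classK_inj_le (gK _ t20).1) => //; rewrite h4 -{1}h2 lerD2l.
    by rewrite ler_wpM2r// classK_ge0.
  split=> //.
  + have rs0 : 0 <= rho s by exact: classK_ge0.
    (* The difference of the two equations bounds the variation in time. *)
    have lip t1 t2 : 0 <= t1 -> t1 <= t2 ->
        bt s t1 - bt s t2 <= (t2 - t1) * rho s.
      move=> t10 t12; have t20 := le_trans t10 t12.
      have [[h1 h2] [h3 h4]] := (Hbt _ _ s0 t10, Hbt _ _ s0 t20).
      have H : rho (bt s t2) <= rho (bt s t1) by rewrite classK_le// mono.
      have H2 : rho (bt s t2) <= rho s.
        rewrite classK_le// -[leRHS]h4 lerDl mulr_ge0//.
        exact: classK_ge0.
      have H3 : 0 <= rho (bt s t2) by exact: classK_ge0.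
      have : bt s t1 - bt s t2 <= (t2 - t1) * rho (bt s t2).
        have := ler_wpM2l t10 H; lra.
      move=> /le_trans; apply.
      by rewrite ler_wpM2l// subr_ge0.
    apply/within_continuous_realP => t; rewrite itv0y => t0 e e0.
    exists (e / (rho s + 1)); first by rewrite divr_gt0// ltr_wpDl.
    move=> r; rewrite itv0y => r0'; rewrite ltr_pdivlMr ?ltr_wpDl// => h.
    apply: le_lt_trans h.
    have nn := normr_ge0 (r - t).
    have [rt|tr] := leP r t.
      have := lip _ _ r0' rt; have := mono _ _ r0' rt.
      rewrite [`|r - t|]distrC (ger0_norm (x := t - r)) ?subr_ge0//.
      by move=> m1 m2; rewrite ger0_norm ?subr_ge0//; nra.
    have := lip _ _ t0 (ltW tr); have := mono _ _ t0 (ltW tr).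
    rewrite (ger0_norm (x := r - t)) ?subr_ge0 ?(ltW tr)//.
    by move=> m1 m2; rewrite distrC ger0_norm ?subr_ge0//; nra.
  + apply/cvgrPdist_lt => e e0; have re := classK_gt0 rK e0.
    exists (s / rho e); split; first exact: num_real.
    move=> t; rewrite ltr_pdivrMr// => st.
    have t0 : 0 <= t.
      rewrite leNgt; apply/negP => t0.
      have : t * rho e < 0 by rewrite nmulr_rlt0.
      by lra.
    have [h1 h2] := Hbt _ _ s0 t0.
    rewrite sub0r normrN ger0_norm// ltNge; apply/negP => ebt.
    have : t * rho e <= s.
      rewrite -h2 -[leLHS]add0r lerD// ler_wpM2l//.
      by apply: classK_le => //; exact: ltW.
    by rewrite leNgt st.
Qed.

Lemma classKL_comp (bt : R -> R -> R) g1 g2 :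
  classKL bt -> classK g1 -> classK g2 ->
  classKL (fun s t => g1 (bt (g2 s) t)).
Proof.
move=> [btK btL] g1K g2K.
have bt0 s t : 0 <= s -> 0 <= t -> 0 <= bt (g2 s) t.
  by move=> s0 t0; apply: (classK_ge0 (btK t t0)); exact: classK_ge0.
split=> [t t0|s s0].
  exact: (classK_comp g1K (classK_comp (btK t t0) g2K)).
have [bc bm bl] := btL _ (classK_ge0 g2K s0).
split.
- apply/within_continuous_realP => t; rewrite itv0y => t0 e e0.
  have b0 : `[0, +oo[%classic (bt (g2 s) t) by rewrite itv0y bt0.
  have [d d0 h] := classK_cont g1K b0 e0.
  have tt0 : `[0, +oo[%classic t by rewrite itv0y.
  move/within_continuous_realP : bc => /(_ t tt0 d d0)[d' d'0 h'].
  exists d' => // r r0 rt; apply: h; last exact: h'.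
  by move: r0; rewrite !itv0y => r0; exact: bt0.
- move=> t1 t2 t10 t12; apply: (classK_le g1K); last exact: bm.
  by apply: bt0 => //; exact: le_trans t12.
- apply/cvgrPdist_lt => e e0.
  have z0 : `[0, +oo[%classic (0 : R) by rewrite itv0y.
  have [d d0 h] := classK_cont g1K z0 e0.
  move/cvgrPdist_lt : bl => /(_ d d0)[M [Mr HM]].
  exists (Num.max M 0); split; first exact: num_real.
  move=> t; rewrite gt_max => /andP[Mt t0].
  have /= := HM _ Mt; rewrite distrC => Ht.
  have := h (bt (g2 s) t); rewrite itv0y => /(_ (bt0 _ _ s0 (ltW t0)) Ht).
  by case: g1K => _ -> _; rewrite distrC.
Qed.

Lemma classK_sqr : classK (fun s : R => s ^+ 2).
Proof.
split; last first.
- by move=> s t s0 st; rewrite ltr_pXn2r// nnegrE// (le_trans s0)// ltW.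
- by rewrite expr0n.
by apply: continuous_subspaceT; exact: exprn_continuous.
Qed.

Lemma classKinfty_half : classKinfty (fun s : R => s / 2).
Proof.
split; last first.
  by move=> M; exists (2 * (Num.max 0 M + 1)); have := le_max 0 0 M;
    have := le_max M 0 M; rewrite !lexx ?orbT/= => h1 h2; lra.
split; last first.
- by move=> s t _ st; rewrite ltr_pM2r.
- by rewrite mul0r.
by apply: continuous_subspaceT; exact: mulrr_continuous.
Qed.

End Comparison.

(** * The space of continuous functions and its norm *)

Section AlmostEverywhere.
Variable R : realType.
Local Notation mu := (@lebesgue_measure R).

Lemma ae_exists_in_itv (P : R -> Prop) (a b : R) : a < b ->
  {ae mu, forall t, P t} -> exists2 t, a < t < b & P t.
Proof.
move=> ab [N [mN N0 PN]]; apply: contrapT => H.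
have sub : `]a, b[ `<=` N.
  move=> t /=; rewrite in_itv/= => tab; apply: PN => /= Pt.
  by apply: H; exists t.
have : (mu `]a, b[%classic <= mu N)%E.
  by apply: le_measure; rewrite ?inE//; exact: measurable_itv.
rewrite N0 lebesgue_measure_itv/= lte_fin ab -EFinD lee_fin.
by rewrite subr_le0 leNgt ab.
Qed.

End AlmostEverywhere.

(** Sealed, so that the norm is reached through its characterization as a
    supremum only: comparing unfolded essential suprema is intractable. *)
HB.lock Definition normC (R : realType) (n : nat) (phi : R -> 'cV[R]_n) : R :=
  norm_infty phi.

Lemma normCE (R : realType) (n : nat) (phi : R -> 'cV[R]_n) :
  normC phi = norm_infty phi.
Proof. by rewrite unlock. Qed.

Section SpaceC.
Variables (R : realType) (n : nat) (Delta : R).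
Hypothesis Delta0 : 0 < Delta.
Local Notation C := (@spaceC R n Delta).
Local Notation mu := (@lebesgue_measure R).
Implicit Types phi psi : R -> 'cV[R]_n.

Lemma spaceC_cont phi : C phi -> cont_on (@enorm R n 1) `[- Delta, 0] phi.
Proof. by move=> [/within_continuous_mxP]. Qed.

Lemma spaceC_out phi (s : R) : C phi -> ~~ (- Delta <= s <= 0) -> phi s = 0.
Proof. by move=> [_ h] hs; apply: h; rewrite in_itv/=. Qed.

Lemma spaceCB phi psi : C phi -> C psi -> C (phi \- psi).
Proof.
move=> Cphi Cpsi; split; last first.
  by move=> s hs; rewrite /= Cphi.2// Cpsi.2// subrr.
apply/within_continuous_mxP => s hs e e0.
have e20 : 0 < e / 2 by rewrite divr_gt0.
have [d1 d10 h1] := spaceC_cont Cphi hs e20.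
have [d2 d20 h2] := spaceC_cont Cpsi hs e20.
exists (Num.min d1 d2); first by rewrite lt_min d10.
move=> r hr; rewrite lt_min => /andP[r1 r2] /=.
rewrite [X in enorm X](_ : _ = (phi r - phi s) - (psi r - psi s)); last first.
  by rewrite !opprD !opprK addrACA.
by rewrite (le_lt_trans (enormB _ _))// (splitr e) ltrD ?h1 ?h2.
Qed.

Lemma ess_norm_ge0 p (v : R -> 'cV[R]_p) : (0 <= ess_norm v)%E.
Proof.
apply: ess_sup_gee.
  have := @lebesgue_measure_itv R `]-oo, +oo[; rewrite set_itvNyy/= => ->.
  by rewrite ltry.
by apply: nearW => s; rewrite lee_fin enorm_ge0.
Qed.

Lemma norm_infty_ge0 p (v : R -> 'cV[R]_p) : 0 <= norm_infty v.
Proof. by rewrite fine_ge0// ess_norm_ge0. Qed.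

Lemma ess_norm_le p (v : R -> 'cV[R]_p) M : (forall s, enorm (v s) <= M) ->
  (ess_norm v <= M%:E)%E.
Proof. by move=> vM; apply/ess_supP; apply: nearW => s; rewrite lee_fin. Qed.

Lemma ae_le_norm_infty p (v : R -> 'cV[R]_p) : (ess_norm v < +oo)%E ->
  {ae mu, forall s, enorm (v s) <= norm_infty v}.
Proof.
move=> vfin; have vE : (norm_infty v)%:E = ess_norm v.
  by rewrite /norm_infty fineK// ge0_fin_numE// ess_norm_ge0.
have := ess_sup_ge mu (fun s => (enorm (v s))%:E).
by apply: filterS => s; rewrite -/(ess_norm v) -vE lee_fin.
Qed.

Lemma spaceC_bounded phi : C phi -> exists M, forall s, enorm (phi s) <= M.
Proof.
move=> Cphi.
have [M HM] := cont_on_bounded (enorm_even_subadditive R n 1) (spaceC_cont Cphi).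
exists (Num.max M 0) => s; rewrite le_max.
have [hs|hs] := boolP (- Delta <= s <= 0); first by rewrite HM.
by rewrite (spaceC_out Cphi hs) enorm0 lexx orbT.
Qed.

Lemma normC_ge0 phi : 0 <= normC phi.
Proof. by rewrite normCE norm_infty_ge0. Qed.

Lemma normC_le phi M : C phi -> 0 <= M ->
  (forall s, - Delta <= s <= 0 -> enorm (phi s) <= M) -> normC phi <= M.
Proof.
rewrite normCE => Cphi M0 HM; have /ess_norm_le HM' : forall s, enorm (phi s) <= M.
  move=> s; have [hs|hs] := boolP (- Delta <= s <= 0); first exact: HM.
  by rewrite (spaceC_out Cphi hs) enorm0.
rewrite -lee_fin /norm_infty fineK// ge0_fin_numE ?ess_norm_ge0//.
exact: le_lt_trans HM' (ltry _).
Qed.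

(** A continuous function that exceeds a bound at a point exceeds it on an
    interval, and an interval is not negligible. *)
Lemma le_normC phi s : C phi -> enorm (phi s) <= normC phi.
Proof.
rewrite normCE => Cphi; have [hs|hs] := boolP (- Delta <= s <= 0); last first.
  by rewrite (spaceC_out Cphi hs) enorm0 norm_infty_ge0.
have [M /ess_norm_le HM] := spaceC_bounded Cphi.
have ae := ae_le_norm_infty (le_lt_trans HM (ltry _)).
rewrite leNgt; apply/negP => lt_s.
have e0 : 0 < enorm (phi s) - norm_infty phi by rewrite subr_gt0.
have [d d0 h] := spaceC_cont Cphi hs e0.
have [/andP hs1 hs2] : - Delta <= s <= 0 /\ - Delta < 0 by rewrite oppr_lt0.
have ab : Num.max (- Delta) (s - d) < Num.min 0 (s + d).
  by rewrite lt_min !gt_max; do !(apply/andP; split); lra.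
have [t] := ae_exists_in_itv ab ae.
rewrite lt_min !gt_max => /andP[/andP[t1 t2] /andP[t3 t4]].
have := h t; rewrite /= in_itv/= (ltW t1) (ltW t3) => /(_ isT).
have td : `|t - s| < d by rewrite ltr_norml; apply/andP; split; lra.
move=> /(_ td) h1 h2.
have := enorm_dist (phi t) (phi s); rewrite ler_norml => /andP[h3 h4].
by lra.
Qed.

Lemma normC_sub_le phi psi chi : C phi -> C psi -> C chi ->
  normC (phi \- chi) <= normC (phi \- psi) + normC (psi \- chi).
Proof.
move=> h1 h2 h3; apply: normC_le; first exact: spaceCB.
  by rewrite addr_ge0// normC_ge0.
move=> s hs; rewrite /= (le_trans (enorm_tri _ (psi s) _))// lerD//.
  exact: (le_normC _ (spaceCB h1 h2)).
exact: (le_normC _ (spaceCB h2 h3)).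
Qed.

Lemma spaceC0 : C (fun=> 0).
Proof.
split=> //; apply/within_continuous_mxP => s _ e e0; exists 1 => // r _ _.
by rewrite subrr enorm0.
Qed.

Lemma normC_le_sub phi psi : C phi -> C psi ->
  normC phi <= normC (phi \- psi) + normC psi.
Proof.
move=> h1 h2; apply: normC_le => //.
  by rewrite addr_ge0// normC_ge0.
move=> s hs; rewrite -[phi s](subrK (psi s)) (le_trans (enormD _ _))// lerD//.
  exact: (le_normC _ (spaceCB h1 h2)).
exact: le_normC.
Qed.

Lemma normCBB phi : normC (phi \- phi) = 0.
Proof.
apply/eqP; rewrite eq_le normC_ge0 andbT.
rewrite (_ : _ \- _ = fun=> 0); last by apply/funext => s /=; rewrite subrr.
by apply: normC_le => //; [exact: spaceC0|move=> s _; rewrite enorm0].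
Qed.

(** ** Segments of a trajectory *)

Implicit Types x y : R -> 'cV[R]_n.

Lemma segmentE x t (s : R) : - Delta <= s <= 0 -> segment Delta x t s = x (t + s).
Proof. by move=> hs; rewrite /segment /truncation /patch mem_set//= in_itv. Qed.

Lemma segment_out x t (s : R) : ~~ (- Delta <= s <= 0) -> segment Delta x t s = 0.
Proof.
move=> hs; rewrite /segment /truncation /patch memNset//= in_itv/=.
exact/negP.
Qed.

Lemma segment0 x t : segment Delta x t 0 = x t.
Proof. by rewrite segmentE ?addr0// oppr_le0 ltW/=. Qed.

Lemma spaceC_segment x t : cont_on (@enorm R n 1) `[t - Delta, t] x ->
  C (segment Delta x t).
Proof.
move=> cx; split; last first.
  by move=> s; rewrite in_itv/= => /segment_out.
apply/within_continuous_mxP => s; rewrite /= in_itv/= => hs e e0.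
have [|d d0 h] := cx (t + s) _ e e0.
  by rewrite /= in_itv/=; case/andP: hs => *; apply/andP; split; lra.
exists d => // r; rewrite /= in_itv/= => hr rs; rewrite !segmentE//.
apply: h; last by rewrite opprD addrACA subrr add0r.
by rewrite /= in_itv/=; case/andP: hr => *; apply/andP; split; lra.
Qed.

Lemma spaceC_segment_of x T t : cont_on (@enorm R n 1) `[- Delta, T] x ->
  0 <= t <= T -> C (segment Delta x t).
Proof.
move=> cx /andP[t0 tT]; apply: spaceC_segment; apply: cont_on_subset cx => s.
by rewrite /= !in_itv/= => /andP[? ?]; apply/andP; split; lra.
Qed.

Lemma eq_segment x y t : (forall s, t - Delta <= s <= t -> x s = y s) ->
  segment Delta x t = segment Delta y t.
Proof.
move=> xy; apply/funext => s.
have [hs|hs] := boolP (- Delta <= s <= 0); last by rewrite !segment_out.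
rewrite !segmentE//; apply: xy.
by case/andP: hs => *; apply/andP; split; lra.
Qed.

Lemma segment_id phi : C phi -> segment Delta phi 0 = phi.
Proof.
move=> Cphi; apply/funext => s; have [hs|hs] := boolP (- Delta <= s <= 0).
  by rewrite segmentE// add0r.
by rewrite segment_out// (spaceC_out Cphi).
Qed.

Lemma normC_segment_sub_le x y t u M :
  C (segment Delta x t) -> C (segment Delta y u) -> 0 <= M ->
  (forall s, - Delta <= s <= 0 -> enorm (x (t + s) - y (u + s)) <= M) ->
  normC (segment Delta x t \- segment Delta y u) <= M.
Proof.
move=> h1 h2 M0 H; apply: normC_le => //; first exact: spaceCB.
by move=> s hs; rewrite /= !segmentE// H.
Qed.

Lemma normC_segment_le x t M : C (segment Delta x t) -> 0 <= M ->
  (forall s, - Delta <= s <= 0 -> enorm (x (t + s)) <= M) ->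
  normC (segment Delta x t) <= M.
Proof.
by move=> h1 M0 H; apply: normC_le => // s hs; rewrite segmentE// H.
Qed.

Lemma segment_uniformly_continuous x T : cont_on (@enorm R n 1) `[- Delta, T] x ->
  forall e, 0 < e -> exists2 d, 0 < d & forall t u, 0 <= t <= T -> 0 <= u <= T ->
    `|t - u| < d ->
    normC (segment Delta x t \- segment Delta x u) <= e.
Proof.
move=> cx e e0.
have [d d0 h] := cont_on_uniform (enorm_even_subadditive R n 1) cx e0.
exists d => // t u tT uT tu.
apply: normC_segment_sub_le (spaceC_segment_of cx tT)
  (spaceC_segment_of cx uT) (ltW e0) _ => s /andP[s1 s2].
case/andP: tT uT => t0 tT /andP[u0 uT].
apply/ltW/h; first by apply/andP; split; lra.
  by apply/andP; split; lra.
by rewrite opprD addrACA subrr addr0.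
Qed.

Lemma segment_bounded x T : cont_on (@enorm R n 1) `[- Delta, T] x ->
  exists M, forall t, 0 <= t <= T -> normC (segment Delta x t) <= M.
Proof.
move=> cx; have [M HM] := cont_on_bounded (enorm_even_subadditive R n 1) cx.
exists (Num.max M 0) => t tT; apply: normC_segment_le.
- exact: spaceC_segment_of tT.
- by rewrite le_max lexx orbT.
- move=> s /andP[s1 s2]; rewrite le_max HM//.
  by case/andP: tT => *; apply/andP; split; lra.
Qed.

End SpaceC.

(** * Regular maps on the space of continuous functions *)

Section Regular.
Variables (R : realType) (n : nat) (Delta : R).
Hypothesis Delta0 : 0 < Delta.
Local Notation C := (@spaceC R n Delta).

Definition lipC (W : zmodType) (N : W -> R) (F : (R -> 'cV[R]_n) -> W) :=
  forall phi, C phi -> exists2 delta, 0 < delta & exists2 eta, 0 < eta &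
    forall phi1 phi2, C phi1 -> C phi2 -> normC (phi1 \- phi) <= delta ->
      normC (phi2 \- phi) <= delta ->
      N (F phi1 - F phi2) <= eta * normC (phi1 \- phi2).

Definition bndC (W : zmodType) (N : W -> R) (F : (R -> 'cV[R]_n) -> W) :=
  forall M, exists2 B, 0 <= B & forall phi, C phi -> normC phi <= M ->
    N (F phi) <= B.

(** Completely continuous and locally Lipschitz, without closures: Lipschitz
    near every point, and bounded on every ball. *)
Definition regC (W : zmodType) (N : W -> R) (F : (R -> 'cV[R]_n) -> W) :=
  lipC N F /\ bndC N F.

Section Equivalence.
Variables (W : zmodType) (N : W -> R) (F : (R -> 'cV[R]_n) -> W).

Lemma lipC_of_locally_lipschitz :
  locally_lipschitz Delta N F -> lipC N F.
Proof.
move=> Fl phi Cphi; have [d [eta [d0 eta0 h]]] := Fl phi Cphi.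
exists (d / 2); first by rewrite divr_gt0.
exists eta => // phi1 phi2 C1 C2 h1 h2.
have inball psi : C psi -> normC (psi \- phi) <= d / 2 ->
    Defs.closureC Delta (openballC Delta phi d) psi.
  move=> Cpsi hpsi; split; [exact: Cpsi|move=> e e0].
  exists psi; last by rewrite -normCE (normCBB Delta).
  by split; [exact: Cpsi|rewrite -normCE; apply: le_lt_trans hpsi _; lra].
rewrite normCE; apply: h; first exact: inball C1 h1.
exact: inball C2 h2.
Qed.

Lemma regC_of_cc_lip : completely_continuous Delta N F ->
  locally_lipschitz Delta N F -> regC N F.
Proof.
move=> [_ Fb] Fl; split; first exact: lipC_of_locally_lipschitz.
move=> M; have [||| B HB] := Fb [set phi | C phi /\ normC phi <= M].
- by move=> phi [].
- move=> phi [Cphi h]; split; [exact: Cphi|apply/ler_addgt0Pl => e e0].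
  have [psi [Cpsi psiM]] := h e e0; rewrite -normCE => hpsi.
  rewrite (le_trans (normC_le_sub Delta0 Cphi Cpsi))//.
  by apply: lerD psiM; exact: ltW.
- by exists M => phi []; rewrite -normCE.
exists (Num.max B 0); first by rewrite le_max lexx orbT.
by move=> phi Cphi hphi; rewrite le_max HB.
Qed.

Lemma locally_lipschitz_of_lipC : lipC N F -> locally_lipschitz Delta N F.
Proof.
move=> Fl phi Cphi; have [d d0 [eta eta0 h]] := Fl phi Cphi.
exists d, eta; split=> //.
have inball psi : Defs.closureC Delta (openballC Delta phi d) psi ->
    C psi /\ normC (psi \- phi) <= d.
  move=> [Cpsi hpsi]; split; [exact: Cpsi|apply/ler_addgt0Pl => e e0].
  have [chi [Cchi]] := hpsi e e0; rewrite -!normCE => hchi hpc.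
  apply: le_trans (normC_sub_le Delta0 Cpsi Cchi Cphi) _.
  by apply: lerD; exact: ltW.
move=> phi1 phi2 /inball[C1 h1] /inball[C2 h2].
by rewrite -normCE; exact: h.
Qed.

Lemma lipC_continuousC : lipC N F -> continuousC Delta N F.
Proof.
move=> Fl phi Cphi e e0; have [d d0 [eta eta0 h]] := Fl phi Cphi.
exists (Num.min d (e / eta)); first by rewrite lt_min d0 divr_gt0.
move=> psi Cpsi; rewrite -normCE lt_min ltr_pdivlMr// => /andP[h1 h2].
have dd : normC (phi \- phi) <= d by rewrite (normCBB Delta) ltW.
apply: le_lt_trans (h _ _ Cpsi Cphi (ltW h1) dd) _.
by rewrite mulrC.
Qed.

Lemma completely_continuous_of_regC : regC N F -> completely_continuous Delta N F.
Proof.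
move=> [Fl Fb]; split; first exact: lipC_continuousC.
move=> A AC _ [M HM]; have [B _ HB] := Fb M.
by exists B => phi Aphi; apply: HB; [exact: AC|rewrite normCE; exact: HM].
Qed.

End Equivalence.

Lemma regC_norm_equiv (W : zmodType) (N N' : W -> R) (c : R)
  (F : (R -> 'cV[R]_n) -> W) : 0 < c -> (forall w, N' w <= c * N w) ->
  regC N F -> regC N' F.
Proof.
move=> c0 NN [Fl Fb]; split.
  move=> phi /Fl[d d0 [eta eta0 h]]; exists d => //.
  exists (c * eta); first by rewrite mulr_gt0.
  move=> phi1 phi2 C1 C2 h1 h2; rewrite (le_trans (NN _))// -mulrA.
  by rewrite ler_wpM2l ?(ltW c0)// h.
move=> M; have [B B0 HB] := Fb M; exists (c * B); first by rewrite mulr_ge0// ltW.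
move=> phi Cphi h; rewrite (le_trans (NN _))//.
by rewrite ler_wpM2l ?(ltW c0)// HB.
Qed.

(** An operation that is bounded and Lipschitz on bounded sets preserves
    regularity: near any point, both arguments range over bounded sets. *)
Lemma regC_op2 (W1 W2 W3 : zmodType) (N1 : W1 -> R) (N2 : W2 -> R) (N3 : W3 -> R)
    (op : W1 -> W2 -> W3) F1 F2 :
  (forall B, 0 <= B -> exists2 L, 0 < L & forall x x' y y',
     N1 x <= B -> N1 x' <= B -> N2 y <= B -> N2 y' <= B ->
     N3 (op x y) <= L /\
     N3 (op x y - op x' y') <= L * (N1 (x - x') + N2 (y - y'))) ->
  regC N1 F1 -> regC N2 F2 -> regC N3 (fun phi => op (F1 phi) (F2 phi)).
Proof.
move=> Hop [l1 b1] [l2 b2]; split; last first.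
  move=> M; have [[B1 B10 H1] [B2 B20 H2]] := (b1 M, b2 M).
  have [|L L0 HL] := Hop (Num.max B1 B2); first by rewrite le_max B10.
  exists L; first exact: ltW.
  move=> phi Cphi hphi; apply: (HL _ (F1 phi) _ (F2 phi) _ _ _ _).1;
  by rewrite le_max ?H1 ?H2 ?orbT.
move=> phi Cphi.
have [d1 d10 [eta1 eta10 h1]] := l1 _ Cphi.
have [d2 d20 [eta2 eta20 h2]] := l2 _ Cphi.
have [B1 B10 H1] := b1 (d1 + normC phi).
have [B2 B20 H2] := b2 (d2 + normC phi).
have [|L L0 HL] := Hop (Num.max B1 B2); first by rewrite le_max B10.
exists (Num.min d1 d2); first by rewrite lt_min d10.
exists (L * (eta1 + eta2)); first by rewrite mulr_gt0// addr_gt0.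
have lemin z : z <= Num.min d1 d2 -> z <= d1 /\ z <= d2.
  by rewrite le_min => /andP.
move=> phi1 phi2 C1 C2 /lemin[p11 p12] /lemin[p21 p22].
have N1le psi : C psi -> normC (psi \- phi) <= d1 ->
    N1 (F1 psi) <= Num.max B1 B2.
  move=> Cpsi hpsi; rewrite le_max H1//.
  by rewrite (le_trans (normC_le_sub Delta0 Cpsi Cphi))// lerD2r.
have N2le psi : C psi -> normC (psi \- phi) <= d2 ->
    N2 (F2 psi) <= Num.max B1 B2.
  move=> Cpsi hpsi; rewrite le_max H2 ?orbT//.
  by rewrite (le_trans (normC_le_sub Delta0 Cpsi Cphi))// lerD2r.
have := (HL _ _ _ _ (N1le _ C1 p11) (N1le _ C2 p21)
  (N2le _ C1 p12) (N2le _ C2 p22)).2.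
move=> /le_trans; apply.
by rewrite -mulrA ler_wpM2l ?(ltW L0)// mulrDl lerD ?h1 ?h2.
Qed.

Lemma regC_mulmx p q s (F1 : _ -> 'M[R]_(p, q)) (F2 : _ -> 'M[R]_(q, s)) :
  regC (@enorm R p q) F1 -> regC (@enorm R q s) F2 ->
  regC (@enorm R p s) (fun phi => F1 phi *m F2 phi).
Proof.
apply: regC_op2 => B B0; exists (B ^+ 2 + B + 1).
  by rewrite ltr_wpDl// addr_ge0// sqr_ge0.
move=> x x' y y' h1 h2 h3 h4; split.
  rewrite (le_trans (enorm_mulmx _ _))//.
  have := ler_pM (enorm_ge0 x) (enorm_ge0 y) h1 h3; lra.
have -> : x *m y - x' *m y' = (x - x') *m y + x' *m (y - y').
  by rewrite mulmxBl mulmxBr addrA subrK.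
rewrite (le_trans (enormD _ _))//.
have i1 := enorm_mulmx (x - x') y; have i2 := enorm_mulmx x' (y - y').
have j1 := ler_wpM2l (enorm_ge0 (x - x')) h3.
have j2 := ler_wpM2r (enorm_ge0 (y - y')) h2.
have k1 := enorm_ge0 (x - x'); have k2 := enorm_ge0 (y - y').
have k3 : 0 <= (B ^+ 2 + 1) * (enorm (x - x') + enorm (y - y')).
  by rewrite mulr_ge0 ?addr_ge0// sqr_ge0.
by lra.
Qed.

Lemma regC_add (W : zmodType) (N : W -> R) (F1 F2 : _ -> W) :
  even_subadditive N ->
  regC N F1 -> regC N F2 -> regC N (fun phi => F1 phi + F2 phi).
Proof.
move=> [Nadd Nopp]; apply: regC_op2 => B B0; exists (B + B + 1).
  by rewrite ltr_wpDl// addr_ge0.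
move=> x x' y y' h1 h2 h3 h4; split.
  by rewrite (le_trans (Nadd _ _))//; lra.
have N00 w : 0 <= N w.
  have := Nadd w (- w); have := Nadd 0 0; rewrite subrr addr0 Nopp.
  by lra.
rewrite opprD addrACA (le_trans (Nadd _ _))//.
have k1 := N00 (x - x'); have k2 := N00 (y - y').
have : 0 <= (B + B) * (N (x - x') + N (y - y')) by rewrite mulr_ge0 ?addr_ge0.
by lra.
Qed.

End Regular.

(** * Regularity of the feedback *)

Section FeedbackRegularity.
Variables (R : realType) (n : nat) (Delta : R).
Hypothesis Delta0 : 0 < Delta.
Local Notation normR := (@Num.norm R R).
Local Notation regR := (@regC R n Delta R normR).

Lemma hypot_lipschitz (x y x' y' : R) :
  `|Num.sqrt (x ^+ 2 + y ^+ 2) - Num.sqrt (x' ^+ 2 + y' ^+ 2)|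
    <= `|x - x'| + `|y - y'|.
Proof.
have H (u v u' v' : R) : Num.sqrt (u ^+ 2 + v ^+ 2) <=
    Num.sqrt (u' ^+ 2 + v' ^+ 2) + (`|u - u'| + `|v - v'|).
  set S := Num.sqrt (u' ^+ 2 + v' ^+ 2).
  have S0 : 0 <= S by exact: sqrtr_ge0.
  have S2 : S ^+ 2 = u' ^+ 2 + v' ^+ 2.
    by rewrite sqr_sqrtr// addr_ge0 ?sqr_ge0.
  have d1 := normr_ge0 (u - u'); have d2 := normr_ge0 (v - v').
  have le_abs (a b : R) : a ^+ 2 <= b ^+ 2 -> 0 <= b -> `|a| <= b.
    move=> ab b0; rewrite -(@ler_pXn2r _ 2%N)// ?nnegrE//.
    by rewrite real_normK ?num_real.
  have u'S : `|u'| <= S by apply: le_abs => //; rewrite S2 lerDl sqr_ge0.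
  have v'S : `|v'| <= S by apply: le_abs => //; rewrite S2 lerDr sqr_ge0.
  rewrite -(@ler_pXn2r _ 2%N)// ?nnegrE ?sqrtr_ge0 ?addr_ge0//.
  rewrite sqr_sqrtr ?addr_ge0 ?sqr_ge0//.
  have sqr_le (a a' : R) : a ^+ 2 <= (`|a'| + `|a - a'|) ^+ 2.
    rewrite -[leLHS]real_normK ?num_real//.
    rewrite ler_pXn2r// ?nnegrE ?addr_ge0 ?normr_ge0//.
    by rewrite -{1}[a](subrK a') addrC ler_normD.
  apply: le_trans (lerD (sqr_le u u') (sqr_le v v')) _.
  have u2 := real_normK (num_real u'); have v2 := real_normK (num_real v').
  have p1 : 0 <= (S - `|u'|) * `|u - u'| by rewrite mulr_ge0// subr_ge0.
  have p2 : 0 <= (S - `|v'|) * `|v - v'| by rewrite mulr_ge0// subr_ge0.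
  have p3 : 0 <= `|u - u'| * `|v - v'| by rewrite mulr_ge0.
  by nra.
rewrite ler_norml lerNl opprB !lerBlDl H andbT.
by rewrite [`|x - _|]distrC [`|y - _|]distrC H.
Qed.

Lemma regC_abs (W : zmodType) (N : W -> R) (F : (R -> 'cV[R]_n) -> W) (op : W -> R) :
  (forall B : R, 0 <= B -> exists2 L : R, 0 < L & forall x x', N x <= B -> N x' <= B ->
     `|op x| <= L /\ `|op x - op x'| <= L * N (x - x')) ->
  regC Delta N F -> (forall w, 0 <= N w) -> regR (fun phi => op (F phi)).
Proof.
move=> Hop rF N0; apply: (regC_op2 Delta0 (op := fun x _ => op x) _ rF rF).
move=> B /Hop[L L0 HL]; exists L => // x x' y y' h1 h2 _ _.
have [i1 i2] := HL _ _ h1 h2; split=> //.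
by rewrite (le_trans i2)// ler_wpM2l ?(ltW L0)// lerDl.
Qed.

Lemma regC_mulR (F1 F2 : (R -> 'cV[R]_n) -> R) :
  regR F1 -> regR F2 -> regR (fun phi => F1 phi * F2 phi).
Proof.
apply: (regC_op2 Delta0) => B B0; exists (B ^+ 2 + B + 1).
  by rewrite ltr_wpDl// addr_ge0// sqr_ge0.
move=> x x' y y' h1 h2 h3 h4; split.
  have := ler_pM (normr_ge0 x) (normr_ge0 y) h1 h3.
  by rewrite normrM; lra.
have -> : x * y - x' * y' = (x - x') * y + x' * (y - y') by ring.
rewrite (le_trans (ler_normD _ _))// !normrM.
have j1 := ler_wpM2l (normr_ge0 (x - x')) h3.
have j2 := ler_wpM2r (normr_ge0 (y - y')) h2.
have k3 : 0 <= (B ^+ 2 + 1) * (`|x - x'| + `|y - y'|).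
  by rewrite mulr_ge0 ?addr_ge0// sqr_ge0.
by lra.
Qed.

Variables (m : nat) (V : 'cV[R]_n -> (R -> 'cV[R]_n) -> R).
Variables (f : (R -> 'cV[R]_n) -> 'cV[R]_n) (g : (R -> 'cV[R]_n) -> 'M[R]_(n, m)).
Hypothesis Vh_reg : regR (dVdh Delta V).
Hypothesis Vx_reg : regC Delta (@enorm R 1 n) (dVdx Delta V).
Hypothesis f_reg : regC Delta (@enorm R n 1) f.
Hypothesis g_reg : regC Delta (@enorm R n m) g.

Lemma map_a_reg : regR (map_a Delta V f).
Proof.
apply: (regC_add Delta0 (normr_even_subadditive R)) => //.
apply: (regC_abs (op := fun M : 'M[R]_1 => M 0 0) _ (regC_mulmx Delta0 Vx_reg f_reg)).
  move=> B B0; exists (B + 1); first by rewrite ltr_wpDl.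
  move=> x x' h1 h2; split.
    by rewrite (le_trans (coord_le_enorm _ _ _))// (le_trans h1)// lerDl.
  have := coord_le_enorm (x - x') 0 0; rewrite !mxE => /le_trans; apply.
  by rewrite ler_peMl ?enorm_ge0// lerDr.
by move=> w; exact: enorm_ge0.
Qed.

Lemma map_b_reg : regC Delta (@enorm R 1 m) (map_b Delta V g).
Proof. exact: regC_mulmx. Qed.

(** The two branches of the feedback agree on the sphere [|b| = r], so that
    one formula describes both. *)
Lemma map_kE r phi : map_k Delta V f g r phi =
  - ((map_a Delta V f phi +
      Num.sqrt (map_a Delta V f phi ^+ 2 + enorm (map_b Delta V g phi) ^+ 4)) *
     (Num.max (enorm (map_b Delta V g phi)) r) ^- 2) *: (map_b Delta V g phi)^T.
Proof.
by rewrite /map_k; case: ltP.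
Qed.

(** The square root is singular where [a] and [b] both vanish; it is Lipschitz
    there all the same, being the Euclidean norm of [(a, |b|^2)]. The divisor is
    at least [r ^ 2]. *)
Lemma map_k_reg r : 0 < r -> regC Delta (@enorm R m 1) (map_k Delta V f g r).
Proof.
move=> r0; rewrite (_ : map_k Delta V f g r = (fun phi =>
  - ((map_a Delta V f phi +
      Num.sqrt (map_a Delta V f phi ^+ 2 + enorm (map_b Delta V g phi) ^+ 4)) *
     (Num.max (enorm (map_b Delta V g phi)) r) ^- 2) *: (map_b Delta V g phi)^T));
  last by apply/funext => phi; rewrite map_kE.
have sqrt_reg : regR (fun phi =>
    Num.sqrt (map_a Delta V f phi ^+ 2 + enorm (map_b Delta V g phi) ^+ 4)).
  apply: (regC_op2 Delta0 (op := fun a (b : 'rV[R]_m) =>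
    Num.sqrt (a ^+ 2 + enorm b ^+ 4)) _ map_a_reg map_b_reg).
  move=> B B0; exists (B ^+ 2 + 3 * B + 1).
    by rewrite ltr_wpDl// addr_ge0 ?mulr_ge0// sqr_ge0.
  have pow4 (b : 'rV[R]_m) : enorm b ^+ 4 = (enorm b ^+ 2) ^+ 2.
    by rewrite -exprM.
  move=> a a' b b' h1 h2 h3 h4; rewrite !pow4; split.
    have := hypot_lipschitz a (enorm b ^+ 2) 0 0.
    rewrite expr0n/= addr0 sqrtr0 !subr0 => /le_trans; apply.
    rewrite [X in _ + X]ger0_norm ?sqr_ge0//.
    have : enorm b ^+ 2 <= B ^+ 2 by rewrite ler_pXn2r// nnegrE enorm_ge0.
    by lra.
  rewrite (le_trans (hypot_lipschitz _ _ _ _))//.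
  have -> : enorm b ^+ 2 - enorm b' ^+ 2 =
    (enorm b - enorm b') * (enorm b + enorm b') by ring.
  rewrite normrM [X in _ + _ * X <= _]ger0_norm ?addr_ge0 ?enorm_ge0//.
  have i1 := enorm_dist b b'; have i2 := normr_ge0 (a - a').
  have i3 := enorm_ge0 (b - b').
  have i4 : `|enorm b - enorm b'| * (enorm b + enorm b') <=
      enorm (b - b') * (2 * B).
    by apply: ler_pM => //; rewrite ?addr_ge0 ?enorm_ge0//; lra.
  have i5 : 0 <= (B ^+ 2 + 3 * B) * `|a - a'|.
    by rewrite mulr_ge0// addr_ge0 ?mulr_ge0// sqr_ge0.
  have i6 : 0 <= (B ^+ 2 + B + 1) * enorm (b - b').
    by rewrite mulr_ge0// addr_ge0 ?addr_ge0// sqr_ge0.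
  by lra.
have inv_reg : regR (fun phi =>
    (Num.max (enorm (map_b Delta V g phi)) r) ^- 2).
  apply: (regC_abs (op := fun b : 'rV[R]_m => (Num.max (enorm b) r) ^- 2) _
    map_b_reg); last by move=> w; exact: enorm_ge0.
  move=> B B0; exists (r ^- 2 + 2 * r ^- 3).
    by rewrite addr_gt0 ?mulr_gt0 ?invr_gt0 ?exprn_gt0.
  move=> b b' _ _; set u := Num.max (enorm b) r; set v := Num.max (enorm b') r.
  have ru : r <= u by rewrite le_max lexx orbT.
  have rv : r <= v by rewrite le_max lexx orbT.
  have u0 : 0 < u by exact: lt_le_trans ru.
  have v0 : 0 < v by exact: lt_le_trans rv.
  have uv : `|u - v| <= enorm (b - b').
    have := enorm_dist b b'; rewrite !ler_norml /u /v => /andP[i1 i2].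
    have i3 := enorm_ge0 (b - b').
    move: (enorm b) (enorm b') (enorm (b - b')) i1 i2 i3 => x y z i1 i2 i3.
    by case: (leP x r) => ?; case: (leP y r) => ?; apply/andP; split; lra.
  have iu : u^-1 <= r^-1 by rewrite lef_pV2 ?posrE.
  have iv : v^-1 <= r^-1 by rewrite lef_pV2 ?posrE.
  have r3 : 0 < r ^- 3 by rewrite invr_gt0 exprn_gt0.
  have iu0 : 0 < u^-1 by rewrite invr_gt0.
  have iv0 : 0 < v^-1 by rewrite invr_gt0.
  split.
    rewrite ger0_norm ?invr_ge0 ?exprn_ge0 ?(ltW u0)//.
    rewrite (@le_trans _ _ (r ^- 2))//.
      by rewrite lef_pV2 ?posrE ?exprn_gt0// ler_pXn2r// nnegrE ltW.
    by rewrite lerDl mulr_ge0 ?ltW.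
  have -> : u ^- 2 - v ^- 2 =
      (v - u) * (u^-1 * (v^-1 * v^-1) + u^-1 * (u^-1 * v^-1)).
    by field; rewrite !gt_eqF.
  rewrite normrM distrC [X in _ * X]ger0_norm; last first.
    by rewrite addr_ge0 ?mulr_ge0 ?ltW.
  have r3E : r ^- 3 = r^-1 * (r^-1 * r^-1) by rewrite !exprS expr0 mulr1 !invfM.
  have i1 : u^-1 * (v^-1 * v^-1) <= r ^- 3.
    by rewrite r3E; do 2?[apply: ler_pM => //]; rewrite ?mulr_ge0 ?ltW.
  have i2 : u^-1 * (u^-1 * v^-1) <= r ^- 3.
    by rewrite r3E; do 2?[apply: ler_pM => //]; rewrite ?mulr_ge0 ?ltW.
  rewrite mulrC; apply: ler_pM => //.
    by rewrite addr_ge0 ?mulr_ge0 ?ltW.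
  have : 0 < r ^- 2 by rewrite invr_gt0 exprn_gt0.
  by lra.
have c_reg := regC_mulR (regC_add Delta0 (normr_even_subadditive R) map_a_reg
  sqrt_reg) inv_reg.
apply: (regC_op2 Delta0 (op := fun c (b : 'rV[R]_m) => - c *: b^T) _ c_reg map_b_reg).
move=> B B0; exists (B ^+ 2 + B + 1).
  by rewrite ltr_wpDl// addr_ge0// sqr_ge0.
move=> x x' y y' h1 h2 h3 h4; split.
  rewrite enormZ enorm_trmx normrN.
  have := ler_pM (normr_ge0 x) (enorm_ge0 y) h1 h3; lra.
have -> : - x *: y^T - - x' *: y'^T = - (x - x') *: y^T - x' *: (y - y')^T.
  by apply/matrixP => i j; rewrite !mxE; ring.
rewrite (le_trans (enormB _ _))// !enormZ !enorm_trmx normrN.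
have j1 := ler_wpM2l (normr_ge0 (x - x')) h3.
have j2 := ler_wpM2r (enorm_ge0 (y - y')) h2.
have k3 : 0 <= (B ^+ 2 + 1) * (`|x - x'| + enorm (y - y')).
  by rewrite mulr_ge0 ?addr_ge0 ?enorm_ge0// sqr_ge0.
by lra.
Qed.

End FeedbackRegularity.

(** * Absolutely continuous functions and their derivatives *)

Section Derivatives.
Variable R : realType.

Definition ederiv p q (x : R -> 'M[R]_(p, q)) (t : R) (v : 'M[R]_(p, q)) :=
  forall e : R, 0 < e -> exists2 d : R, 0 < d & forall h : R, `|h| < d ->
    enorm (x (t + h) - x t - h *: v) <= e * `|h|.

Lemma is_derive_cvgP p q (x : R -> 'M[R]_(p, q)) (t : R) v :
  is_derive t (1 : R) x v <->
  h^-1 *: (x (h + t) - x t) @[h --> 0^'] --> v.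
Proof.
have E : (fun h : R => h^-1 *: ((x \o shift t) (h *: (1 : R)) - x t)) =
         (fun h : R => h^-1 *: (x (h + t) - x t)).
  by apply/funext => h /=; rewrite /GRing.scale/= mulr1.
split=> [[dx <-]|cx].
  by rewrite -E; exact: dx.
split; first by apply/cvg_ex; exists v => /=; rewrite E.
by rewrite /derive/= E; apply/cvg_lim.
Qed.

Lemma is_deriveP p q (x : R -> 'M[R]_(p, q)) (t : R) v :
  is_derive t (1 : R) x v <-> ederiv x t v.
Proof.
rewrite is_derive_cvgP; split=> H.
  move=> e e0; have e1 : 0 < e / ((p * q)%:R + 1) by rewrite divr_gt0// ltr_wpDl.
  move/cvgrPdist_le : H => /(_ _ e1)[d /= d0 Hd]; exists d => // h hd.
  have [->|h0] := eqVneq h 0.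
    by rewrite addr0 subrr sub0r scale0r oppr0 enorm0 normr0 mulr0.
  have := Hd h; rewrite /ball_/= sub0r normrN => /(_ hd h0) => H1.
  have -> : x (t + h) - x t - h *: v = h *: (h^-1 *: (x (h + t) - x t) - v).
    by rewrite scalerBr scalerA mulfV// scale1r [h + t]addrC.
  rewrite enormZ mulrC ler_wpM2r// (le_trans (enorm_le_mx_norm _))//.
  rewrite distrC in H1; move: H1; rewrite ler_pdivlMr ?ltr_wpDl// => H1.
  rewrite (le_trans _ H1)// mulrC ler_wpM2l//.
  by rewrite lerDl.
apply/cvgrPdist_le => e e0; have [d d0 Hd] := H e e0.
exists d => //= h; rewrite /ball_/= sub0r normrN => hd h0.
rewrite distrC (le_trans (mx_norm_le_enorm _))//.
have := Hd h hd.
have -> : x (t + h) - x t - h *: v = h *: (h^-1 *: (x (h + t) - x t) - v).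
  by rewrite scalerBr scalerA mulfV// scale1r [h + t]addrC.
by rewrite enormZ mulrC ler_pM2r// normr_gt0.
Qed.

Lemma ederiv_of_coords n (x : R -> 'cV[R]_n) t (v : 'cV[R]_n) :
  (forall i, derivable (fun t => x t i 0) t 1 /\
     'D_1 (fun t => x t i 0) t = v i 0) -> ederiv x t v.
Proof.
move=> H; apply/is_deriveP; have dx : derivable x t 1.
  by apply/derivable_mxP => i j; rewrite (ord1 j); exact: (H i).1.
split=> //; rewrite derive_mx//; apply/colP => i; rewrite mxE.
exact: (H i).2.
Qed.

(** The upper right Dini derivative of [f] at [t] is at most [k]. *)
Definition dini_le (f : R -> R) (t k : R) :=
  forall e, 0 < e -> exists2 d, 0 < d &
    forall h, 0 <= h -> h < d -> f (t + h) - f t <= (k + e) * h.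

Lemma ederiv_dini n (x : R -> 'cV[R]_n) t v i : ederiv x t v ->
  dini_le (fun t => x t i 0) t (v i 0) /\
  dini_le (fun t => - x t i 0) t (- v i 0).
Proof.
move=> H; split=> e /H[d d0 Hd]; exists d => // h h0 hd;
  have := le_trans (coord_le_enorm _ i 0) (Hd h (_ : `|h| < d));
  rewrite (ger0_norm h0) => /(_ hd); rewrite !mxE ler_norml => /andP[h1 h2]; lra.
Qed.

Lemma ederiv_sub n (x y : R -> 'cV[R]_n) t v w : ederiv x t v -> ederiv y t w ->
  ederiv (x \- y) t (v - w).
Proof.
move=> Hx Hy e e0; have e2 : 0 < e / 2 by rewrite divr_gt0.
have [d1 d10 H1] := Hx _ e2; have [d2 d20 H2] := Hy _ e2.
exists (Num.min d1 d2); first by rewrite lt_min d10.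
move=> h; rewrite lt_min => /andP[h1 h2] /=.
rewrite [X in enorm X](_ : _ =
  (x (t + h) - x t - h *: v) - (y (t + h) - y t - h *: w)).
  rewrite (le_trans (enormB _ _))// (splitr e) mulrDl lerD ?H1 ?H2//.
by apply/matrixP => i j; rewrite !mxE; ring.
Qed.

Lemma ederiv_near n (x y : R -> 'cV[R]_n) t v (d : R) : 0 < d ->
  (forall s, `|s - t| < d -> x s = y s) -> ederiv x t v -> ederiv y t v.
Proof.
move=> d0 xy Hx e /Hx[d1 d10 H1]; exists (Num.min d1 d).
  by rewrite lt_min d10.
move=> h; rewrite lt_min => /andP[h1 h2]; rewrite -!xy ?subrr ?normr0//.
  exact: H1.
by rewrite addrC addKr.
Qed.

Lemma ederiv_in_itv n (x y : R -> 'cV[R]_n) a b t v : a < t < b ->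
  (forall s, a <= s <= b -> x s = y s) -> ederiv x t v -> ederiv y t v.
Proof.
move=> /andP[at_ tb] xy; apply: (@ederiv_near _ _ _ _ _ (Num.min (t - a) (b - t))).
  by rewrite lt_min !subr_gt0 at_.
move=> s; rewrite lt_min !ltr_norml => /andP[/andP[s1 s2] /andP[s3 s4]].
by apply: xy; apply/andP; split; lra.
Qed.

(** An increment is bounded by the rate [K] times the length, up to the growth
    of a monotone function [phi] that takes charge of the exceptional points. *)
Lemma increment_le (a b K : R) (f phi : R -> R) : a <= b -> cont_onR `[a, b] f ->
  (forall t u, a <= t -> t <= u -> u <= b -> phi t <= phi u) ->
  (forall t, a < t < b -> exists2 d, 0 < d & forall u, t <= u -> u < t + d ->
     u <= b -> f u - f t <= K * (u - t) + (phi u - phi t)) ->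
  f b - f a <= K * (b - a) + (phi b - phi a).
Proof.
move=> ab fc phim step.
suff H a' : a < a' -> a' <= b -> f b - f a' <= K * (b - a') + (phi b - phi a').
  have [->|anb] := eqVneq a b; first by rewrite !subrr mulr0 addr0.
  have ltab : a < b by rewrite lt_neqAle anb.
  apply/ler_addgt0Pl => e e0; have e3 : 0 < e / 2 by rewrite divr_gt0.
  have [|d d0 Hd] := fc a _ _ e3; first by rewrite /= in_itv/= lexx ab.
  have K0 : 0 < `|K| + 1 by rewrite ltr_wpDl.
  set a' := Num.min b (a + Num.min (d / 2) (e / 2 / (`|K| + 1))).
  have aa' : a < a'.
    by rewrite lt_min ltab ltrDl lt_min !divr_gt0.
  have a'b : a' <= b by rewrite ge_min lexx.
  have := H _ aa' a'b.
  have h1 : a' - a <= d / 2.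
    by rewrite lerBlDl ge_min lerD2l ge_min lexx !orbT.
  have h2 : (a' - a) * (`|K| + 1) <= e / 2.
    by rewrite -ler_pdivlMr// lerBlDl ge_min lerD2l ge_min lexx !orbT.
  have : `|f a' - f a| < e / 2.
    apply: Hd; first by rewrite /= in_itv/= (ltW aa').
    rewrite ger0_norm ?subr_ge0 ?(ltW aa')//; lra.
  have := phim a a' (lexx a) (ltW aa') a'b.
  have K1 : - (`|K| * (a' - a)) <= K * (a' - a).
    have := ler_norm (- K); rewrite normrN => h3.
    have := ler_wpM2r (_ : 0 <= a' - a) h3.
    by rewrite subr_ge0 (ltW aa') mulNr => /(_ isT); lra.
  rewrite ltr_norml => h3 /andP[h4 h5]; lra.
move=> aa' a'b.
have {}fc : cont_onR `[a', b] f.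
  apply: (@cont_on_subset _ _ (@Num.norm R R)) fc => s /=.
  by rewrite !in_itv/= => /andP[s1 s2]; rewrite s2 andbT ltW// (lt_le_trans aa').
suff H : forall t, a' <= t <= b -> f t - f a' <= K * (t - a') + (phi t - phi a').
  by apply: H; rewrite a'b lexx.
apply: segment_induction => // s /andP[a's sb] IH.
have Hs : f s - f a' <= K * (s - a') + (phi s - phi a').
  have [->|sna] := eqVneq s a'; first by rewrite !subrr mulr0 addr0.
  have lta's : a' < s by rewrite lt_neqAle eq_sym sna.
  apply/ler_addgt0Pl => e e0; have e3 : 0 < e / 2 by rewrite divr_gt0.
  have [|d d0 Hd] := fc s _ _ e3; first by rewrite /= in_itv/= a's.
  have K0 : 0 < `|K| + 1 by rewrite ltr_wpDl.
  set u := Num.max a' (s - Num.min (d / 2) (e / 2 / (`|K| + 1))).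
  have us : u < s.
    by rewrite gt_max lta's ltrBlDr ltrDl lt_min !divr_gt0.
  have a'u : a' <= u by rewrite le_max lexx.
  have := IH _ a'u us.
  have h1 : s - u <= d / 2.
    by rewrite lerBlDr -lerBlDl le_max lerD2l lerN2 ge_min lexx !orbT.
  have h2 : (s - u) * (`|K| + 1) <= e / 2.
    by rewrite -ler_pdivlMr// lerBlDr -lerBlDl le_max lerD2l lerN2 ge_min lexx !orbT.
  have : `|f u - f s| < e / 2.
    apply: Hd; first by rewrite /= in_itv/= a'u (le_trans (ltW us)).
    rewrite distrC ger0_norm ?subr_ge0 ?(ltW us)//; lra.
  have := phim u s (le_trans (ltW aa') a'u) (ltW us) sb.
  have K1 : - (`|K| * (s - u)) <= K * (s - u).
    have := ler_norm (- K); rewrite normrN => h3.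
    have := ler_wpM2r (_ : 0 <= s - u) h3.
    by rewrite subr_ge0 (ltW us) mulNr => /(_ isT); lra.
  rewrite ltr_norml => h3 /andP[h4 h5]; lra.
have [sltb|bs] := ltP s b; last first.
  exists 1 => // t st _ tb; suff -> : t = s by [].
  by apply/eqP; rewrite eq_le st (le_trans tb).
have [|d d0 Hd] := step s; first by rewrite sltb (lt_le_trans aa').
exists (d / 2); first by rewrite divr_gt0.
move=> t st tsd tb; have := Hd t st (_ : t < s + d) tb.
have -> : t < s + d by lra.
by move=> /(_ isT); lra.
Qed.

Lemma continuous_increment_le (a b k : R) (f : R -> R) : a <= b ->
  cont_onR `[a, b] f -> (forall t, a < t < b -> dini_le f t k) ->
  f b - f a <= k * (b - a).
Proof.
move=> ab fc fd; apply/ler_addgt0Pl => e e0.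
have e1 : 0 < e / (b - a + 1) by rewrite divr_gt0// ltr_wpDl// subr_ge0.
have := @increment_le a b (k + e / (b - a + 1)) f (fun=> 0) ab fc.
move=> /(_ (fun _ _ _ _ _ => lexx _)) H.
rewrite (le_trans (H _))//.
  move=> t tab; have [d d0 Hd] := fd t tab _ e1; exists d => // u tu utd _.
  have := Hd (u - t); rewrite subr_ge0 => /(_ tu).
  by rewrite (addrC t) subrK ltrBlDl subrr addr0; exact.
rewrite subrr addr0 mulrDl addrC lerD2r -mulrA ger_pMr// mulrC.
by rewrite ler_pdivrMr ?ltr_wpDl ?subr_ge0// mul1r lerDl.
Qed.

Definition nonoverlapping (s : seq (R * R)) :=
  pairwise (fun p q => (p.2 <= q.1) || (q.2 <= p.1)) s.

Definition ac_on (a b : R) (f : R -> R) := forall e, 0 < e -> exists2 d, 0 < d &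
  forall s : seq (R * R),
    (forall p, p \in s -> a <= p.1 /\ p.1 <= p.2 /\ p.2 <= b) ->
    nonoverlapping s -> \sum_(p <- s) (p.2 - p.1) < d ->
    \sum_(p <- s) `|f p.2 - f p.1| < e.

Lemma ac_on_cont a b f : ac_on a b f -> cont_onR `[a, b] f.
Proof.
move=> fac s; rewrite /= in_itv/= => /andP[sa sb] e /fac[d d0 H].
exists d => // r; rewrite in_itv/= => /andP[ra rb] rs.
have [rles|slr] := leP r s.
  have := H [:: (r, s)]; rewrite !big_seq1/= distrC; apply => //.
    by move=> p; rewrite inE => /eqP ->.
  by move: rs; rewrite distrC ger0_norm ?subr_ge0.
have := H [:: (s, r)]; rewrite !big_seq1/=; apply => //.
  by move=> p; rewrite inE => /eqP ->; rewrite (ltW slr).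
by move: rs; rewrite ger0_norm ?subr_ge0 ?(ltW slr).
Qed.

Lemma ac_on_add a b f g : ac_on a b f -> ac_on a b g -> ac_on a b (f \+ g).
Proof.
move=> fac gac e e0; have e2 : 0 < e / 2 by rewrite divr_gt0.
have [d1 d10 H1] := fac _ e2; have [d2 d20 H2] := gac _ e2.
exists (Num.min d1 d2); first by rewrite lt_min d10.
move=> s sab sno; rewrite lt_min => /andP[s1 s2].
apply: le_lt_trans (_ : \sum_(p <- s) (`|f p.2 - f p.1| + `|g p.2 - g p.1|) < e).
  apply: ler_sum => p _ /=; rewrite [X in `|X|](_ : _ =
    (f p.2 - f p.1) + (g p.2 - g p.1)); last by ring.
  exact: ler_normD.
by rewrite big_split/= (splitr e) ltrD ?H1 ?H2.
Qed.

Lemma ac_onN a b f : ac_on a b f -> ac_on a b (fun t => - f t).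
Proof.
move=> fac e /fac[d d0 H]; exists d => // s s1 s2 s3.
under eq_bigr do rewrite -opprD normrN.
exact: H.
Qed.

Lemma lipschitz_ac_on a b f L :
  (forall s t, a <= s -> s <= t -> t <= b -> `|f t - f s| <= L * (t - s)) ->
  ac_on a b f.
Proof.
move=> fL e e0; have L0 : 0 < `|L| + 1 by rewrite ltr_wpDl.
exists (e / (`|L| + 1)); first by rewrite divr_gt0.
move=> s sab _; rewrite ltr_pdivlMr// => h.
apply: le_lt_trans h; rewrite mulrC mulr_sumr.
rewrite !big_seq; apply: ler_sum => p ps; have [p1 [p2 p3]] := sab p ps.
rewrite (le_trans (fL _ _ p1 p2 p3))// ler_wpM2r// ?subr_ge0//.
by rewrite (le_trans (ler_norm _))// lerDl.
Qed.

Lemma ac_on_subset a b a' b' f : a <= a' -> b' <= b -> ac_on a b f ->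
  ac_on a' b' f.
Proof.
move=> aa' bb' fac e /fac[d d0 H]; exists d => // s s1; apply: H => p /s1.
by move=> [h1 [h2 h3]]; rewrite (le_trans aa')// (le_trans h3).
Qed.

End Derivatives.

(** * Lebesgue measure on the line *)

Section LebesgueLine.
Variable R : realType.
Local Notation mu := (@lebesgue_measure R).

Lemma ae_and (P Q : R -> Prop) : {ae mu, forall t, P t} ->
  {ae mu, forall t, Q t} -> {ae mu, forall t, P t /\ Q t}.
Proof.
move=> hP hQ; apply: (filterS2 _ _ hP hQ).
  exact: (ae_filter_ringOfSetsType mu).
by move=> t.
Qed.

Lemma ae_imp (P Q : R -> Prop) : (forall t, P t -> Q t) ->
  {ae mu, forall t, P t} -> {ae mu, forall t, Q t}.
Proof.
by move=> PQ; apply: filterS => //; exact: (ae_filter_ringOfSetsType mu).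
Qed.

Lemma negligible_open_cover (N : set R) (e : R) : mu.-negligible N -> 0 < e ->
  exists U : set R, [/\ open U, N `<=` U & (mu U < e%:E)%E].
Proof.
move=> [A [mA A0 NA]] e0.
have [|U [oU AU Ue]] := @lebesgue_regularity_outer R A e mA _ e0.
  exact: (eq_ind_r (fun z => (z < +oo)%E) (ltry 0) A0).
exists U; split=> //; first exact: subset_trans AU.
have mU : measurable U by exact: open_measurable.
rewrite (_ : U = (U `\` A) `|` A); last first.
  by apply/seteqP; split=> [x Ux|x [[]//|/AU//]]; have [Ax|nAx] := pselect (A x);
    [right|left].
apply: (@le_lt_trans _ _ (mu (U `\` A) + mu A)%E).
  by apply: measureU2 => //; exact: measurableD.
by rewrite A0 adde0; exact: Ue.
Qed.

Lemma sum_length_le (U : set R) (s : seq (R * R)) : measurable U ->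
  (forall p, p \in s -> p.1 <= p.2 /\ `]p.1, p.2] `<=` U) ->
  nonoverlapping s -> ((\sum_(p <- s) (p.2 - p.1))%:E <= mu U)%E.
Proof.
elim: s U => [|p s IH] U mU sU; first by rewrite big_nil measure_ge0.
rewrite /nonoverlapping/= => /andP[/allP hp hs].
have [p12 pU] := sU p (mem_head _ _).
have mp : measurable (`]p.1, p.2]%classic : set R) by exact: measurable_itv.
rewrite big_cons EFinD (_ : mu U = mu `]p.1, p.2]%classic + mu (U `\` `]p.1, p.2]))%E.
  apply: leeD.
    rewrite lebesgue_measure_itv/= lte_fin; case: ltP => // h.
    by rewrite lee_fin subr_le0.
  apply: IH => //; first exact: measurableD.
  move=> q qs; have qps : q \in p :: s by rewrite inE qs orbT.
  have [q12 qU] := sU q qps.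
  split=> // x xq; split; first exact: qU.
  move: xq; rewrite /= !in_itv/= => /andP[x1 x2] /andP[x3 x4].
  have /orP[] := hp _ qs => h.
    by have := lt_le_trans x1 (le_trans x4 h); rewrite ltxx.
  by have := lt_le_trans x3 (le_trans x2 h); rewrite ltxx.
rewrite -measureU//; first by rewrite setDUK.
  exact: measurableD.
by apply/seteqP; split=> // x [? []].
Qed.

(** Monotonicity from the sign of the derivative, for absolutely continuous
    functions: cover the exceptional null set by an open set [U] of small
    measure; there the variation of [f] is small, and elsewhere the derivative
    decides. *)
Lemma ac_increment_le_ge0 (a b k : R) (f : R -> R) : a <= b -> 0 <= k ->
  ac_on a b f ->
  {ae mu, forall t, a < t < b -> dini_le f t k} -> f b - f a <= k * (b - a).
Proof.
move=> ab k0 fac [N [mN N0 hN]].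
apply/ler_addgt0Pl => e e0; have e2 : 0 < e / 2 by rewrite divr_gt0.
have [d d0 Hd] := fac _ e2.
have [|U [oU NU Ud]] := @negligible_open_cover N d _ d0.
  by exists N; split.
have mU : measurable U by exact: open_measurable.
pose admissible t (s : seq (R * R)) := [/\
  forall p, p \in s -> a <= p.1 /\ p.1 <= p.2 /\ p.2 <= t,
  nonoverlapping s & forall p, p \in s -> `]p.1, p.2] `<=` U].
pose var s := \sum_(p <- s) `|f p.2 - f p.1|.
(* The variation of [f] on the part of [U] that lies before [t]. *)
pose phi t := sup [set var s | s in admissible t].
have var_lt t s : t <= b -> admissible t s -> var s < e / 2.
  move=> tb [s1 s2 s3]; apply: Hd => //.
    by move=> p /s1[h1 [h2 h3]]; rewrite h1 h2 (le_trans h3).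
  rewrite -lte_fin; apply: le_lt_trans Ud; apply: sum_length_le => //.
  by move=> p ps; have [_ []] := s1 p ps; split => //; exact: s3.
have adm_nil t : admissible t [::] by split.
have phi_ub t : t <= b -> has_ubound [set var s | s in admissible t].
  by move=> tb; exists (e / 2) => _ [s hs <-]; apply/ltW/(var_lt t).
have phi_mem t s : t <= b -> admissible t s -> var s <= phi t.
  by move=> tb hs; apply: ub_le_sup; [exact: phi_ub|exists s].
have phi_ge0 t : t <= b -> 0 <= phi t.
  by move=> tb; have := phi_mem _ _ tb (adm_nil t); rewrite /var big_nil.
have phi_mono t u : a <= t -> t <= u -> u <= b -> phi t <= phi u.
  move=> _ tu ub; apply: ge_sup; first by exists (var [::]), [::].
  move=> _ [s [s1 s2 s3] <-]; apply: phi_mem => //; split=> // p /s1.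
  by move=> [h1 [h2 h3]]; rewrite h1 h2 (le_trans h3).
have phi_b : phi b <= e / 2.
  apply: ge_sup; first by exists (var [::]), [::].
  by move=> _ [s hs <-]; apply/ltW/(var_lt b).
have phi_jump t u : a <= t -> t <= u -> u <= b -> `[t, u] `<=` U ->
    `|f u - f t| <= phi u - phi t.
  move=> at_ tu ub tuU; rewrite lerBrDr addrC -lerBrDr.
  apply: ge_sup; first by exists (var [::]), [::].
  move=> _ [s [s1 s2 s3] <-]; rewrite lerBrDr.
  rewrite (_ : var s + _ = var ((t, u) :: s)); last first.
    by rewrite /var big_cons addrC.
  apply: phi_mem => //; split.
  - move=> p; rewrite inE => /predU1P[->//|/s1[h1 [h2 h3]]].
    by rewrite h1 h2 (le_trans h3).
  - rewrite /nonoverlapping/= -/(nonoverlapping _) s2 andbT.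
    by apply/allP => p /s1[_ [_ h3]] /=; rewrite h3 orbT.
  - move=> p; rewrite inE => /predU1P[->/=|/s3//].
    by apply: subset_trans tuU => x /=; rewrite !in_itv/= => /andP[/ltW-> ->].
set e' := e / 2 / (b - a + 1).
have ba0 : 0 <= b - a by rewrite subr_ge0.
have e'0 : 0 < e' by rewrite !divr_gt0// ltr_wpDl.
have step t : a < t < b -> exists2 d, 0 < d & forall u, t <= u -> u < t + d ->
    u <= b -> f u - f t <= (k + e') * (u - t) + (phi u - phi t).
  move=> /[dup] tab /andP[at_ tb].
  have [dt|ndt] := pselect (dini_le f t k).
    have [d1 d10 Hd1] := dt _ e'0; exists d1 => // u tu utd ub.
    have := Hd1 (u - t); rewrite subr_ge0 => /(_ tu).
    rewrite (addrC t) subrK ltrBlDl => /(_ utd) h.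
    have := phi_mono _ _ (ltW at_) tu ub; lra.
  have tU : U t by apply/NU/hN => /= /(_ tab).
  move: oU => /(_ _ tU)/nbhs_ballP[d1 /= d10 Hd1]; exists d1 => // u tu utd ub.
  have : `|f u - f t| <= phi u - phi t.
    apply: phi_jump => //; first exact: ltW.
    move=> x; rewrite /= in_itv/= => /andP[tx xu]; apply: Hd1.
    by rewrite /ball/= distrC ger0_norm ?subr_ge0// ltrBlDl (le_lt_trans xu).
  have : 0 <= (k + e') * (u - t).
    by rewrite mulr_ge0 ?subr_ge0// addr_ge0// ltW.
  have := ler_norm (f u - f t); lra.
have := increment_le ab (ac_on_cont fac) phi_mono step.
have : e' * (b - a) <= e / 2.
  by rewrite /e' mulrAC ler_pdivrMr ?ltr_wpDl// ler_wpM2l// ?(ltW e2)// lerDl.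
by have := phi_ge0 _ ab; lra.
Qed.

(** A linear term makes the rate nonnegative. *)
Lemma ac_increment_le (a b k : R) (f : R -> R) : a <= b -> ac_on a b f ->
  {ae mu, forall t, a < t < b -> dini_le f t k} -> f b - f a <= k * (b - a).
Proof.
move=> ab fac fd.
have k0 : 0 <= k + `|k| by have := ler_norm (- k); rewrite normrN; lra.
have lin : ac_on a b (fun t => `|k| * t).
  apply: (@lipschitz_ac_on _ _ _ _ `|k|) => s t _ st _.
  by rewrite -mulrBr normrM normr_id (ger0_norm (x := t - s))// subr_ge0.
have /(ac_increment_le_ge0 ab k0 (ac_on_add fac lin)) :
    {ae mu, forall t, a < t < b ->
      dini_le (f \+ (fun t => `|k| * t)) t (k + `|k|)}.
  apply: ae_imp fd => t h tab e e0; have [d d0 Hd] := h tab e e0.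
  by exists d => // h' h'0 h'd /=; have := Hd _ h'0 h'd; lra.
by rewrite /=; lra.
Qed.

End LebesgueLine.

Section Antiderivatives.
Variable R : realType.
Local Notation mu := (@lebesgue_measure R).

Lemma itv_measure (b1 b2 : bool) (a b : R) : a <= b ->
  mu [set` Interval (BSide b1 a) (BSide b2 b)] = (b - a)%:E.
Proof.
move=> ab; rewrite lebesgue_measure_itv/= lte_fin; case: ltP => //.
by move=> ba; rewrite (_ : b = a) ?subrr//; apply/eqP; rewrite eq_le ba.
Qed.

Lemma itv_measure_fin (b1 b2 : bool) (a b : R) :
  (mu [set` Interval (BSide b1 a) (BSide b2 b)] < +oo)%E.
Proof.
rewrite lebesgue_measure_itv/=; case: ifP => _; last by rewrite ltry.
by rewrite -EFinB ltry.
Qed.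

(** Lebesgue differentiation, for a bounded integrand. *)
Lemma lipschitz_antiderivative (h : R -> R) (M A B : R) :
  measurable_fun setT h -> (forall t, `|h t| <= M) ->
  exists H : R -> R, [/\ forall t, t <= A -> H t = 0,
    forall s t, `|H t - H s| <= M * `|t - s| &
    {ae mu, forall t, A < t < B -> derivable H t 1 /\ 'D_1 H t = h t}].
Proof.
move=> mh hM; pose h0 := h \_ `]A, B[.
have mAB : measurable (`]A, B[%classic : set R) by exact: measurable_itv.
have h0E t : A < t < B -> h0 t = h t.
  by move=> tAB; rewrite /h0 patchE mem_set//= in_itv/=.
have h0_out t : ~~ (A < t < B) -> h0 t = 0.
  by move=> tAB; rewrite /h0 patchE memNset//= in_itv/=; exact/negP.
have M0 : 0 <= M by rewrite (le_trans _ (hM 0)).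
have h0M t : `|h0 t| <= M.
  by have [/h0E->//|/h0_out->] := boolP (A < t < B); rewrite normr0.
have int0 : mu.-integrable setT (EFin \o h0).
  have : mu.-integrable `]A, B[ (EFin \o h).
    apply: measurable_bounded_integrable => //.
    - exact: itv_measure_fin.
    - exact: measurable_funTS.
    - exists M; split; first exact: num_real.
      by move=> x Mx y _; exact: le_trans (hM y) (ltW Mx).
  by rewrite integrable_mkcond//= restrict_EFin.
have intS (D : set R) : measurable D -> mu.-integrable D (EFin \o h0).
  by move=> mD; apply: integrableS int0.
exists (fun t => \int[mu]_(x in [set` `]-oo, t]]) (h0 x)); split.
- move=> t tA; rewrite (@eq_Rintegral _ _ _ mu _ (fun=> 0)); last first.
    move=> x; rewrite inE/= in_itv/= => xt; apply: h0_out.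
    by rewrite negb_and -leNgt (le_trans xt).
  by rewrite Rintegral_cst ?mul0r//; exact: measurable_itv.
- have lip s t : s <= t ->
      `|\int[mu]_(x in [set` `]-oo, t]]) (h0 x) -
        \int[mu]_(x in [set` `]-oo, s]]) (h0 x)| <= M * `|t - s|.
    move=> st; rewrite (@Rintegral_itvB _ h0 -oo%O (BRight t) s)//; last exact: intS.
    apply: (le_trans (le_normr_Rintegral _ _)) => //; first exact: intS.
    apply: (@le_trans _ _ (\int[mu]_(x in [set` `]s, t]]) M)).
      apply: le_Rintegral => //.
      + have := intS `]s, t]%classic (measurable_itv _).
        by move=> /integrable_norm.
      + apply: measurable_bounded_integrable => //.
        * exact: itv_measure_fin.
        * exists M; split; first exact: num_real.
          by move=> x Mx y _ /=; rewrite ger0_norm// ltW.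
    by rewrite Rintegral_cst//= itv_measure//= ger0_norm ?subr_ge0.
  move=> s t; have [st|/ltW ts] := leP s t; first exact: lip.
  by rewrite distrC [`|t - s|]distrC lip.
- have := FTC1Ny (fun y => intS _ (measurable_itv _))
    (open_integrable_locally openT int0).
  apply: filterS; first exact: (ae_filter_ringOfSetsType mu).
  by move=> t [h1 h2] tAB; split=> //; rewrite -derive1E h2 h0E.
Qed.

(** Outside a null set, a Lebesgue measurable function is Borel measurable:
    only countably many preimages have to be corrected. *)
Lemma borel_version (f : R -> R) :
  measurable_fun (`[0%R, +oo[ : set (caratheodory_type
         ((wlength (idfun : R -> R))^*%mu))) (f : _ -> measurableTypeR R) ->
  exists g : R -> R, measurable_fun setT g /\
    {ae mu, forall t, 0 <= t -> g t = f t}.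
Proof.
move=> mf.
have mD : measurable (`[0%R, +oo[%classic : set R) by exact: measurable_itv.
have decomp (q : rat) : exists XM : set R * set R, [/\ measurable XM.1,
    measurable XM.2, mu XM.2 = 0%E &
    forall t, 0 <= t -> ~ XM.2 t -> (ratr q < f t <-> XM.1 t)].
  have : measurable (`[0%R, +oo[%classic `&` f @^-1` `]ratr q, +oo[ :
      set (caratheodory_type ((wlength (idfun : R -> R))^*%mu))).
    apply: mf; last exact: measurable_itv.
    by rewrite -completed_caratheodory_measurable g_sigma_completed_algebra_genE;
      exists `[0%R, +oo[%classic => //; exists set0; rewrite ?setU0//;
      exact: negligible_set0.
  rewrite -completed_caratheodory_measurable g_sigma_completed_algebra_genE.
  move=> [X mX [N [M [mM M0 NM]] XNE]].
  exists (X, M); split=> //= t t0 nMt.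
  have : (X `|` N) t <-> ratr q < f t.
    rewrite XNE /= in_itv/= in_itv/= !andbT t0; split=> [[]//|]; by split.
  move=> <-; split; last by left.
  by case=> // /NM.
have [XM HXM] := choice decomp.
pose M := \bigcup_q (XM q).2.
have mM : measurable M.
  by apply: bigcupT_measurable_rat => q; case: (HXM q).
have M0 : mu.-negligible M.
  rewrite (_ : M = \bigcup_(k in [set: nat])
      (if unpickle k is Some q then (XM q).2 else set0)).
    apply: negligible_bigcup => k; case: unpickle => [q|].
      by exists (XM q).2; case: (HXM q) => *; split.
    exact: negligible_set0.
  apply/seteqP; split=> t [q _ hq].
    exists (pickle q); first exact: I.
    rewrite pickleK; exact: hq.
  move: hq; case: unpickle => [q' hq|[]].
  by exists q'; [exact: I|exact: hq].
pose D : set R := `[0%R, +oo[ `\` M.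
have mD' : measurable D by exact: measurableD.
exists (f \_ D); split; last first.
  move: M0; apply: negligibleS => t /= ht; apply: contrapT => nMt; apply: ht.
  by move=> t0; rewrite patchE mem_set//; split=> //=; rewrite in_itv/= andbT.
apply/(measurable_restrictT _ _).1 => //.
apply: (measurability _ (RGenOInfty.measurableE R)) => _ [_ [y ->] <-].
rewrite (_ : D `&` f @^-1` `]y, +oo[ =
  D `&` \bigcup_(q in [set q : rat | y < ratr q]) (XM q).1).
  apply: measurableI => //; rewrite bigcup_mkcond.
  by apply: bigcupT_measurable_rat => q; case: ifP => // _; case: (HXM q).
have HD t q : D t -> (ratr q < f t <-> (XM q).1 t).
  move=> [/=]; rewrite in_itv/= andbT => t0 nMt; case: (HXM q) => _ _ _; apply=> //.
  by move=> ?; apply: nMt; exists q.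
apply/seteqP; split=> t [Dt]; rewrite /= in_itv/= andbT.
  move=> yft; split=> //.
  have [q] := rat_in_itvoo yft; rewrite in_itv/= => /andP[q1 q2].
  by exists q => //=; apply/HD.
by case=> q /= yq /(HD _ _ Dt) qft; split=> //; exact: lt_trans qft.
Qed.

End Antiderivatives.

(** * Uniqueness for delay differential equations *)

Lemma small_step (R : realType) (e1 e2 c1 K1 K2 : R) : 0 < e1 -> 0 < e2 ->
  0 < c1 -> 0 <= K1 -> 0 <= K2 ->
  exists h, [/\ 0 < h, h < e1, h < e2, K1 * h <= c1 & K2 * h <= 1 / 2].
Proof.
move=> e10 e20 c10 K10 K20.
have c20 : 0 < 1 / 2 :> R by rewrite divr_gt0.
have K10' : 0 < K1 + 1 by rewrite ltr_wpDl.
have K20' : 0 < K2 + 1 by rewrite ltr_wpDl.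
exists (Num.min (Num.min (e1 / 2) (e2 / 2))
  (Num.min (c1 / (K1 + 1)) (1 / 2 / (K2 + 1)))).
set h := Num.min _ _.
have h0 : 0 < h by rewrite !lt_min !divr_gt0.
have h1 : h <= e1 / 2 by rewrite !ge_min lexx.
have h2 : h <= e2 / 2 by rewrite !ge_min lexx !orbT.
have h3 : h * (K1 + 1) <= c1 by rewrite -ler_pdivlMr// !ge_min lexx !orbT.
have h4 : h * (K2 + 1) <= 1 / 2 by rewrite -ler_pdivlMr// !ge_min lexx !orbT.
by split; lra.
Qed.

Section Estimates.
Variables (R : realType) (n : nat).
Local Notation mu := (@lebesgue_measure R).

Definition coords_ac (a b : R) (z : R -> 'cV[R]_n) :=
  forall i, ac_on a b (fun t => z t i 0).

Lemma coords_acB a b (x y : R -> 'cV[R]_n) : coords_ac a b x ->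
  coords_ac a b y -> coords_ac a b (x \- y).
Proof.
move=> hx hy i; have -> : (fun t => (x \- y) t i 0) =
    (fun t => x t i 0) \+ (fun t => - y t i 0).
  by apply/funext => t; rewrite !mxE.
by apply: ac_on_add; [exact: hx|apply: ac_onN; exact: hy].
Qed.

Lemma coords_ac_of_lipschitz a b (z : R -> 'cV[R]_n) L :
  (forall s t, a <= s -> s <= t -> t <= b -> enorm (z t - z s) <= L * (t - s)) ->
  coords_ac a b z.
Proof.
move=> zL i; apply: (lipschitz_ac_on (L := L)) => s t as_ st tb.
apply: le_trans (zL _ _ as_ st tb).
by have := coord_le_enorm (z t - z s) i 0; rewrite !mxE.
Qed.

Lemma dini_le_mono (f : R -> R) t k k' : k <= k' -> dini_le f t k ->
  dini_le f t k'.
Proof.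
move=> kk' h e /h[d d0 H]; exists d => // h' h0 hd.
by rewrite (le_trans (H _ h0 hd))// ler_wpM2r// lerD2r.
Qed.

(** The scalar estimate is applied to each coordinate, hence the factor [n]. *)
Lemma ac_enorm_increment_le a b k (z : R -> 'cV[R]_n) : a <= b ->
  coords_ac a b z ->
  {ae mu, forall t, a < t < b -> exists2 v, ederiv z t v & enorm v <= k} ->
  enorm (z b - z a) <= n%:R * k * (b - a).
Proof.
move=> ab zac zd.
suff H i : `|(z b - z a) i 0| <= k * (b - a).
  rewrite -mulrA (le_trans (enorm_le_coord (k := k * (b - a)) _)) ?muln1//.
  by move=> i j; rewrite (ord1 j).
rewrite !mxE ler_norml lerNl; apply/andP; split.
  have := ac_increment_le ab (ac_onN (zac i)) (k := k) _.
  rewrite opprB opprK addrC; apply; apply: ae_imp zd => t h tab.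
  have [v hv vk] := h tab; have [_] := ederiv_dini i hv.
  apply: dini_le_mono; rewrite (le_trans _ vk)//.
  by rewrite (le_trans (ler_norm _))// normrN coord_le_enorm.
apply: (ac_increment_le ab (zac i)); apply: ae_imp zd => t h tab.
have [v hv vk] := h tab; have [+ _] := ederiv_dini i hv.
apply: dini_le_mono; rewrite (le_trans _ vk)//.
by rewrite (le_trans (ler_norm _))// coord_le_enorm.
Qed.

Lemma eq_at_right_end (a b s : R) (x y : R -> 'cV[R]_n) : a < s -> s <= b ->
  cont_on (@enorm R n 1) `[a, b] x -> cont_on (@enorm R n 1) `[a, b] y ->
  (forall u, a <= u -> u < s -> x u = y u) -> x s = y s.
Proof.
move=> as_ sb cx cy xy; have hs : `[a, b]%classic s by rewrite /= in_itv/= (ltW as_).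
apply/eqP; rewrite -subr_eq0; apply/eqP/enorm_eq0/eqP.
rewrite eq_le enorm_ge0 andbT; apply/ler_addgt0Pl => e e0; rewrite addr0.
have e2 : 0 < e / 2 by rewrite divr_gt0.
have [d1 d10 H1] := cx s hs _ e2; have [d2 d20 H2] := cy s hs _ e2.
pose u := Num.max a (s - Num.min (d1 / 2) (d2 / 2)).
have us : u < s by rewrite gt_max as_ ltrBlDr ltrDl lt_min !divr_gt0.
have au : a <= u by rewrite le_max lexx.
have h1 : s - u <= d1 / 2.
  by rewrite lerBlDr -lerBlDl le_max lerD2l lerN2 ge_min lexx !orbT.
have h2 : s - u <= d2 / 2.
  by rewrite lerBlDr -lerBlDl le_max lerD2l lerN2 ge_min lexx !orbT.
have hu : `[a, b]%classic u by rewrite /= in_itv/= au (le_trans (ltW us)).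
have su0 : `|u - s| = s - u by rewrite distrC ger0_norm// subr_ge0 ltW.
have i1 : enorm (x u - x s) < e / 2.
  by apply: H1 => //; rewrite su0 (le_lt_trans h1)// ltr_pdivrMr// ltr_pMr// ltr1n.
have i2 : enorm (y u - y s) < e / 2.
  by apply: H2 => //; rewrite su0 (le_lt_trans h2)// ltr_pdivrMr// ltr_pMr// ltr1n.
rewrite (xy u au us) in i1; rewrite enorm_distC in i1.
rewrite [leRHS](splitr e); apply: le_trans (enorm_tri _ (y u) _) _.
by apply: lerD; exact: ltW.
Qed.

End Estimates.

Section Disturbance.
Variables (R : realType) (m : nat) (d : R -> 'cV[R]_m).
Local Notation mu := (@lebesgue_measure R).
Hypothesis d_meas : lebesgue_measurable_fun d.
Hypothesis d_bnd : locally_ess_bounded d.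

Lemma ae_disturbance_le T :
  {ae mu, forall t, 0 <= t -> t < T ->
     enorm (d t) <= norm_infty (truncation `[0, T[ d)}.
Proof.
have [T0|T0] := ltP 0 T; last first.
  apply: aeW => t t0 tT; by have := le_lt_trans t0 (lt_le_trans tT T0); rewrite ltxx.
apply: ae_imp (ae_le_norm_infty (d_bnd T0)) => t h t0 tT.
by move: h; rewrite {1}/truncation /patch mem_set//= in_itv/= t0.
Qed.

(** The Borel version is cut off at the essential bound, so as to be bounded
    everywhere. *)
Lemma borel_disturbance T : exists D (db : R -> 'cV[R]_m), [/\ 0 <= D,
  forall i, measurable_fun setT (fun t => db t i 0),
  forall t, enorm (db t) <= D &
  {ae mu, forall t, 0 <= t -> t < T -> db t = d t /\ enorm (d t) <= D}].
Proof.
set D := norm_infty (truncation `[0, T[ d).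
have D0 : 0 <= D by exact: norm_infty_ge0.
have H i := borel_version (d_meas i).
have [b Hb] := choice H.
pose db t : 'cV[R]_m := \col_i Num.max (- D) (Num.min D (b i t)).
exists (Num.max D (m%:R * D)), db; split.
- by rewrite le_max D0.
- move=> i; rewrite (_ : (fun t => db t i 0) = (fun=> - D) \max ((fun=> D) \min b i)).
    apply: measurable_maxr => //; apply: measurable_minr => //.
    exact: (Hb i).1.
  by apply/funext => t; rewrite /db mxE.
- move=> t; rewrite le_max; apply/orP; right.
  rewrite -[m in m%:R]muln1; apply: enorm_le_coord => i j.
  rewrite mxE ler_norml le_max lexx/= ge_max ge_min lexx/= andbT.
  by rewrite -subr_ge0 opprK addr_ge0.
have Hb' : {ae mu, forall t, forall i, 0 <= t -> b i t = d t i 0}.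
  have fil := ae_filter_ringOfSetsType mu.
  by apply: filter_forall => i; exact: (Hb i).2.
apply: ae_imp (ae_and Hb' (ae_disturbance_le T)) => t [h1 h2] t0 tT; split.
  apply/colP => i; rewrite mxE h1//.
  have := le_trans (coord_le_enorm (d t) i 0) (h2 t0 tT).
  by rewrite -/D ler_norml => /andP[h3 h4]; rewrite min_r// max_r.
by rewrite le_max h2.
Qed.

End Disturbance.

Section DelayEquation.
Variables (R : realType) (n m : nat) (Delta : R).
Hypothesis Delta0 : 0 < Delta.
Variables (F : (R -> 'cV[R]_n) -> 'cV[R]_n).
Variables (G : (R -> 'cV[R]_n) -> 'M[R]_(n, m)).
Hypothesis F_reg : regC Delta (@enorm R n 1) F.
Hypothesis G_reg : regC Delta (@enorm R n m) G.
Variable d : R -> 'cV[R]_m.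
Hypothesis d_meas : lebesgue_measurable_fun d.
Hypothesis d_bnd : locally_ess_bounded d.
Local Notation mu := (@lebesgue_measure R).
Local Notation C := (@spaceC R n Delta).
Local Notation seg := (@segment R n Delta).

Definition vfield (phi : R -> 'cV[R]_n) (w : 'cV[R]_m) := F phi + G phi *m w.

(** The open interval avoids a one-sided derivative at [0]. *)
Definition solves (T : R) (x : R -> 'cV[R]_n) :=
  {ae mu, forall t, 0 < t < T -> ederiv x t (vfield (seg x t) (d t))}.

(** Near any [phi] the right-hand side is Lipschitz in the state, uniformly for
    bounded disturbances. *)
Lemma vfield_lipschitz phi D : C phi -> 0 <= D -> exists2 delta, 0 < delta &
  exists2 K, 0 < K & forall phi1 phi2 w, C phi1 -> C phi2 ->
    normC (phi1 \- phi) <= delta -> normC (phi2 \- phi) <= delta ->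
    enorm w <= D ->
    enorm (vfield phi1 w - vfield phi2 w) <= K * normC (phi1 \- phi2).
Proof.
move=> Cphi D0; have [d1 d10 [e1 e10 H1]] := F_reg.1 _ Cphi.
have [d2 d20 [e2 e20 H2]] := G_reg.1 _ Cphi.
exists (Num.min d1 d2); first by rewrite lt_min d10.
exists (e1 + e2 * D); first by rewrite ltr_wpDr// mulr_ge0// ltW.
have lemin z : z <= Num.min d1 d2 -> z <= d1 /\ z <= d2.
  by rewrite le_min => /andP.
move=> phi1 phi2 w C1 C2 /lemin[h11 h12] /lemin[h21 h22] wD.
rewrite /vfield opprD addrACA -mulmxBl (le_trans (enormD _ _))// mulrDl lerD ?H1//.
rewrite (le_trans (enorm_mulmx _ _))// mulrAC ler_pM ?enorm_ge0//.
exact: H2.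
Qed.

Lemma vfield_bounded M D : 0 <= D -> exists2 B, 0 <= B & forall phi w, C phi ->
  normC phi <= M -> enorm w <= D -> enorm (vfield phi w) <= B.
Proof.
move=> D0; have [[B1 B10 H1] [B2 B20 H2]] := (F_reg.2 M, G_reg.2 M).
exists (B1 + B2 * D); first by rewrite addr_ge0// mulr_ge0.
move=> phi w Cphi h wD; rewrite (le_trans (enormD _ _))// lerD ?H1//.
by rewrite (le_trans (enorm_mulmx _ _))// ler_pM ?enorm_ge0// H2.
Qed.

(** The distance of two solutions has a derivative bounded by [K] times the
    distance of their segments, which is at most [M]: before [s] the solutions
    agree. *)
Lemma solves_distance_le (T s tau K D M : R) x y :
  cont_on (@enorm R n 1) `[- Delta, T] x -> cont_on (@enorm R n 1) `[- Delta, T] y ->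
  coords_ac 0 T x -> coords_ac 0 T y -> solves T x -> solves T y ->
  0 <= s -> tau <= T -> 0 <= K -> 0 <= M ->
  {ae mu, forall t, 0 <= t -> t < T -> enorm (d t) <= D} ->
  (forall t w, s < t -> t < tau -> enorm w <= D ->
     enorm (vfield (seg x t) w - vfield (seg y t) w)
       <= K * normC (seg x t \- seg y t)) ->
  (forall u, - Delta <= u -> u <= s -> x u = y u) ->
  (forall u, s <= u -> u <= tau -> enorm (x u - y u) <= M) ->
  forall u, s <= u -> u <= tau -> enorm (x u - y u) <= n%:R * (K * M) * (u - s).
Proof.
have Dpos := Delta0; move=> cx cy ax ay dx dy s0 tauT K0 M0 dD HK xys HM u su ut.
have uT : u <= T by exact: le_trans tauT.
have -> : x u - y u = (x \- y) u - (x \- y) s.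
  by rewrite /= (xys s) ?subrr ?subr0//; lra.
apply: ac_enorm_increment_le => //.
  by apply: coords_acB => i; [apply: ac_on_subset (ax i)|apply: ac_on_subset (ay i)].
apply: ae_imp (ae_and (ae_and dx dy) dD) => t [[h1 h2] h3] /andP[st tu].
have t0 : 0 < t by exact: le_lt_trans st.
have tT : t < T by exact: lt_le_trans uT.
have t0T : 0 < t < T by rewrite t0.
have t0T' : 0 <= t <= T by rewrite (ltW t0) ltW.
exists (vfield (seg x t) (d t) - vfield (seg y t) (d t)).
  exact: ederiv_sub (h1 t0T) (h2 t0T).
apply: le_trans (HK t _ st (lt_le_trans tu ut) (h3 (ltW t0) tT)) _.
apply: ler_wpM2l => //; apply: normC_segment_sub_le => //.
- exact: spaceC_segment_of cx t0T'.
- exact: spaceC_segment_of cy t0T'.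
move=> v /andP[v1 v2]; have [tvs|/ltW stv] := leP (t + v) s.
  by rewrite xys ?subrr ?enorm0//; lra.
by apply: HM; lra.
Qed.

(** Two solutions that agree up to [s] agree a little longer: on a short
    interval their distance is at most half of its supremum. *)
Lemma solves_unique (T : R) x y :
  cont_on (@enorm R n 1) `[- Delta, T] x -> cont_on (@enorm R n 1) `[- Delta, T] y ->
  coords_ac 0 T x -> coords_ac 0 T y -> solves T x -> solves T y ->
  (forall s, - Delta <= s <= 0 -> x s = y s) ->
  forall t, - Delta <= t <= T -> x t = y t.
Proof.
have Dpos := Delta0; move=> cx cy ax ay dx dy xy0.
have [T0|T0] := leP 0 T; last first.
  by move=> t /andP[t1 t2]; apply: xy0; rewrite t1 (le_trans t2)// ltW.
suff H : forall t, 0 <= t <= T -> x t = y t.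
  move=> t /andP[t1 t2]; have [t0|t0] := leP t 0; first by rewrite xy0// t1.
  by apply: H; rewrite (ltW t0).
have [D [db [D0 _ _ HD]]] := borel_disturbance d_meas d_bnd T.
have dD : {ae mu, forall t, 0 <= t -> t < T -> enorm (d t) <= D}.
  by apply: ae_imp HD => t h t0 tT; case: (h t0 tT).
apply: segment_induction => // s /andP[s0 sT] IH.
have ND : - Delta < 0 by rewrite oppr_lt0.
have xylt u : - Delta <= u -> u < s -> x u = y u.
  move=> u1 u2; have [u0|/ltW u0] := leP u 0; first by rewrite xy0// u1.
  exact: IH.
have xyle u : - Delta <= u -> u <= s -> x u = y u.
  move=> u1; rewrite le_eqVlt => /predU1P[->|]; last exact: xylt.
  exact: eq_at_right_end (lt_le_trans ND s0) sT cx cy xylt.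
have sT' : 0 <= s <= T by rewrite s0.
have Cs := spaceC_segment_of cx sT'.
have segE : seg y s = seg x s.
  by apply: eq_segment => // u /andP[u1 u2]; rewrite xyle//; lra.
have [del del0 [K K0 HK]] := vfield_lipschitz Cs D0.
have [e1 e10 E1] := segment_uniformly_continuous cx del0.
have [e2 e20 E2] := segment_uniformly_continuous cy del0.
have nK0 : 0 <= n%:R * K by rewrite mulr_ge0// ltW.
have [h [h0 he1 he2 _ hK]] := small_step e10 e20 ltr01 (lexx 0) nK0.
exists h => //.
pose tau := Num.min (s + h) T.
have stau : s <= tau by rewrite le_min sT lerDl ltW.
have tauT : tau <= T by rewrite ge_min lexx orbT.
have tauh : tau <= s + h by rewrite ge_min lexx.
have Hlip t w : s < t -> t < tau -> enorm w <= D ->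
    enorm (vfield (seg x t) w - vfield (seg y t) w)
      <= K * normC (seg x t \- seg y t).
  move=> st tt wD.
  have ht : 0 <= t <= T.
    by rewrite (le_trans s0 (ltW st)) (le_trans (ltW tt)).
  have tsh : `|t - s| <= h.
    by rewrite ger0_norm ?subr_ge0 ?(ltW st)// lerBlDl (le_trans (ltW tt)).
  apply: HK => //; [exact: spaceC_segment_of ht|exact: spaceC_segment_of ht| |].
    exact: E1 (le_lt_trans tsh he1).
  rewrite -segE; exact: E2 (le_lt_trans tsh he2).
pose S := [set enorm (x u - y u) | u in `[s, tau]].
have Sub : has_ubound S.
  have [Mx HMx] := cont_on_bounded (enorm_even_subadditive R n 1) cx.
  have [My HMy] := cont_on_bounded (enorm_even_subadditive R n 1) cy.
  exists (Mx + My) => _ [u /= + <-]; rewrite in_itv/= => /andP[su ut].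
  have uT : - Delta <= u <= T.
    by rewrite (le_trans (ltW ND))/= ?(le_trans s0)// (le_trans ut).
  by rewrite (le_trans (enormB _ _))// lerD ?HMx ?HMy.
have Sle u : s <= u -> u <= tau -> enorm (x u - y u) <= sup S.
  by move=> su ut; apply: ub_le_sup => //; exists u => //=; rewrite in_itv/= su.
have S0 : 0 <= sup S.
  exact: le_trans (enorm_ge0 _) (Sle s (lexx s) stau).
have Shalf u : s <= u -> u <= tau -> enorm (x u - y u) <= sup S / 2.
  move=> su ut.
  apply: le_trans (solves_distance_le cx cy ax ay dx dy s0 tauT (ltW K0) S0 dD
    Hlip xyle Sle su ut) _.
  have -> : n%:R * (K * sup S) * (u - s) = sup S * (n%:R * K * (u - s)) by ring.
  apply: ler_wpM2l => //; rewrite -div1r; apply: le_trans hK.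
  by apply: ler_wpM2l => //; rewrite lerBlDl (le_trans ut).
have S_le0 : sup S <= 0.
  have : sup S <= sup S / 2.
    apply: ge_sup; first by exists (enorm (x s - y s)), s => //=; rewrite in_itv/= lexx.
    by move=> _ [v /= + <-]; rewrite in_itv/= => /andP[]; exact: Shalf.
  by rewrite ler_pdivlMr// mulr_natr mulr2n gerDl.
move=> t st tsh tT; apply/eqP; rewrite -subr_eq0; apply/eqP/enorm_eq0/eqP.
rewrite eq_le enorm_ge0 andbT; apply: le_trans S_le0; apply: Sle => //.
by rewrite le_min tsh.
Qed.

End DelayEquation.

(** * Local existence *)

Section Limits.
Variable R : realType.

Lemma le_of_halvings (x y c : R) : (forall k : nat, x <= y + c / 2 ^+ k) -> x <= y.
Proof.
move=> H; rewrite leNgt; apply/negP => yx.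
have xy0 : 0 < x - y by rewrite subr_gt0.
have c0 : 0 <= `|c| / (x - y) by rewrite divr_ge0// ltW.
have [k hk] : exists k : nat, `|c| / (x - y) < 2 ^+ k.
  exists (Num.bound (`|c| / (x - y))).
  apply: lt_le_trans (archi_boundP c0) _.
  by rewrite -natrX ler_nat ltnW// ltn_expl.
move: hk; rewrite ltr_pdivrMr// => hk.
have p2 : 0 < (2 ^+ k : R) by rewrite exprn_gt0.
have := H k; rewrite -lerBlDl ler_pdivlMr//.
have := ler_norm c; lra.
Qed.

(** The limit is the supremum of the lower bounds [u k - c / 2 ^ k]. *)
Lemma halving_limit (u : nat -> R) (c : R) :
  (forall k i, `|u (k + i)%N - u k| <= c / 2 ^+ k) ->
  exists l, forall k, `|u k - l| <= c / 2 ^+ k.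
Proof.
move=> H.
have c0 : 0 <= c by have := le_trans (normr_ge0 _) (H 0 0)%N; rewrite expr0 divr1.
have mono j k : (j <= k)%N -> c / 2 ^+ k <= c / 2 ^+ j.
  move=> jk; rewrite ler_wpM2l// lef_pV2 ?posrE ?exprn_gt0//.
  by rewrite ler_eXn2l// ltr1n.
have H2 j k : u k - c / 2 ^+ k <= u j + c / 2 ^+ j.
  have [jk|/ltnW kj] := leqP j k.
    have := H j (k - j)%N; rewrite subnKC// ler_norml => /andP[h1 h2].
    have : 0 <= c / 2 ^+ k by rewrite divr_ge0// exprn_ge0.
    by lra.
  have := H k (j - k)%N; rewrite subnKC// ler_norml => /andP[h1 h2].
  have : 0 <= c / 2 ^+ j by rewrite divr_ge0// exprn_ge0.
  by lra.
pose S := [set u k - c / 2 ^+ k | k in [set: nat]].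
have Sub j : ubound S (u j + c / 2 ^+ j) by move=> _ [k _ <-]; exact: H2.
exists (sup S) => k.
have h1 : u k - c / 2 ^+ k <= sup S.
  by apply: ub_le_sup; [exists (u 0%N + c / 2 ^+ 0)|exists k].
have h2 : sup S <= u k + c / 2 ^+ k.
  by apply: ge_sup => //; exists (u k - c / 2 ^+ k), k.
by rewrite ler_norml; apply/andP; split; lra.
Qed.

Lemma halving_limit_vec n (u : nat -> 'cV[R]_n) (c : R) :
  (forall k i, enorm (u (k + i)%N - u k) <= c / 2 ^+ k) ->
  exists l, forall k, enorm (u k - l) <= n%:R * c / 2 ^+ k.
Proof.
move=> H.
have Hi (i : 'I_n) : exists l, forall k, `|u k i 0 - l| <= c / 2 ^+ k.
  apply: halving_limit => k j; apply: le_trans (H k j).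
  by have := coord_le_enorm (u (k + j)%N - u k) i 0; rewrite !mxE.
have [l Hl] := choice Hi.
exists (\col_i l i) => k; rewrite -mulrA -[n in n%:R]muln1.
by apply: enorm_le_coord => i j; rewrite (ord1 j) !mxE.
Qed.

End Limits.

Section LocalExistence.
Variables (R : realType) (n m : nat) (Delta : R).
Hypothesis Delta0 : 0 < Delta.
Variables (F : (R -> 'cV[R]_n) -> 'cV[R]_n).
Variables (G : (R -> 'cV[R]_n) -> 'M[R]_(n, m)).
Hypothesis F_reg : regC Delta (@enorm R n 1) F.
Hypothesis G_reg : regC Delta (@enorm R n m) G.
Local Notation mu := (@lebesgue_measure R).
Local Notation C := (@spaceC R n Delta).
Local Notation seg := (@segment R n Delta).
Local Notation rhs := (@vfield R n m F G).

Lemma cont_onD (D : set R) (x y : R -> 'cV[R]_n) : cont_on (@enorm R n 1) D x ->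
  cont_on (@enorm R n 1) D y -> cont_on (@enorm R n 1) D (x \+ y).
Proof.
move=> cx cy s Ds e e0; have e2 : 0 < e / 2 by rewrite divr_gt0.
have [d1 d10 H1] := cx s Ds _ e2; have [d2 d20 H2] := cy s Ds _ e2.
exists (Num.min d1 d2); first by rewrite lt_min d10.
move=> r Dr; rewrite lt_min => /andP[r1 r2] /=.
rewrite opprD addrACA (le_lt_trans (enormD _ _))// (splitr e).
by rewrite ltrD ?H1 ?H2.
Qed.

Lemma lipschitz_cont_on (D : set R) (x : R -> 'cV[R]_n) L :
  (forall s t, enorm (x t - x s) <= L * `|t - s|) -> cont_on (@enorm R n 1) D x.
Proof.
move=> xL s _ e e0; have L0 : 0 < `|L| + 1 by rewrite ltr_wpDl.
exists (e / (`|L| + 1)); first by rewrite divr_gt0.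
move=> r _; rewrite ltr_pdivlMr// => h; apply: le_lt_trans h.
rewrite (le_trans (xL s r))// mulrC ler_wpM2l//.
by rewrite (le_trans (ler_norm _))// lerDl.
Qed.

Definition clamp (a b t : R) := Num.max a (Num.min b t).

Lemma clamp_id a b t : a <= t <= b -> clamp a b t = t.
Proof. by move=> /andP[h1 h2]; rewrite /clamp min_r// max_r. Qed.

Lemma clamp_in a b t : a <= b -> a <= clamp a b t <= b.
Proof. by move=> ab; rewrite /clamp le_max lexx ge_max ab ge_min lexx. Qed.

Lemma clamp_lipschitz a b s t : `|clamp a b s - clamp a b t| <= `|s - t|.
Proof.
have lip_of (op : R -> R) : (forall u v, u <= v -> 0 <= op v - op u <= v - u) ->
    forall u v, `|op u - op v| <= `|u - v|.
  move=> H u v; have [uv|/ltW vu] := leP u v.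
    have /andP[h1 h2] := H _ _ uv.
    by rewrite distrC [`|u - v|]distrC !ger0_norm// subr_ge0.
  have /andP[h1 h2] := H _ _ vu.
  by rewrite !ger0_norm// subr_ge0.
have lip_max (c : R) : forall u v : R, `|Num.max c u - Num.max c v| <= `|u - v|.
  apply: (lip_of (Num.max c)) => u v uv; case: (leP c u) => h1; case: (leP c v) => h2;
    by apply/andP; split; lra.
have lip_min (c : R) : forall u v : R, `|Num.min c u - Num.min c v| <= `|u - v|.
  apply: (lip_of (Num.min c)) => u v uv; case: (leP c u) => h1; case: (leP c v) => h2;
    by apply/andP; split; lra.
exact: le_trans (lip_max _ _ _) (lip_min _ _ _).
Qed.

Lemma clamp_le a b t : a <= b -> t <= a -> clamp a b t = a.
Proof.
by move=> ab ta; rewrite /clamp min_r ?(le_trans ta)// max_l.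
Qed.

Lemma clamp_ge a b t : a <= b -> b <= t -> clamp a b t = b.
Proof. by move=> ab bt; rewrite /clamp min_l// max_r. Qed.

Lemma measurable_cont (f : R -> R) : cont_onR setT f -> measurable_fun setT f.
Proof.
move=> cf; apply: continuous_measurable_fun => t; apply/cvgrPdist_lt => e e0.
have [d d0 H] := cf t I e e0; apply/nbhs_ballP; exists d => //= s.
by rewrite /ball/= distrC => st; rewrite distrC H.
Qed.

(** The integral operator of the equation: along a continuous trajectory whose
    segments stay in a region where the right-hand side is bounded by [B], some
    Lipschitz function has the right-hand side as derivative. *)
Lemma field_antiderivative (y : R -> 'cV[R]_n) (db : R -> 'cV[R]_m) a b B :
  0 <= a -> a <= b ->
  cont_on (@enorm R n 1) setT y ->
  (forall i, measurable_fun setT (fun t => db t i 0)) ->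
  (forall t s, a <= t <= b -> enorm (rhs (seg y t) (db s)) <= B) ->
  exists P : R -> 'cV[R]_n, [/\ forall t, t <= a -> P t = 0,
    forall s t, enorm (P t - P s) <= n%:R * B * `|t - s| &
    {ae mu, forall t, a < t < b -> ederiv P t (rhs (seg y t) (db t))}].
Proof.
move=> a0 ab cy mdb HB.
have cyb : cont_on (@enorm R n 1) `[- Delta, b] y.
  exact: cont_on_subset cy.
have cla t : 0 <= clamp a b t <= b.
  by have /andP[h1 h2] := clamp_in t ab; rewrite h2 andbT (le_trans a0).
have Cs t : C (seg y (clamp a b t)) by exact: spaceC_segment_of (cla t).
have cont_comp p q (H : (R -> 'cV[R]_n) -> 'M[R]_(p, q)) i j :
    lipC Delta (@enorm R p q) H ->
    measurable_fun setT (fun t => H (seg y (clamp a b t)) i j).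
  move=> lH; apply: measurable_cont => t _ e e0.
  have := lipC_continuousC lH (Cs t) e0; move=> [d d0 Hd].
  have d2 : 0 < d / 2 by rewrite divr_gt0.
  have [d1 d10 Hd1] := segment_uniformly_continuous cyb d2.
  exists d1 => // r _ rt.
  have := coord_le_enorm (H (seg y (clamp a b r)) - H (seg y (clamp a b t))) i j.
  rewrite !mxE; move=> /le_lt_trans; apply; apply: Hd => //; rewrite -normCE.
  apply: le_lt_trans (Hd1 _ _ (cla r) (cla t) _) _; last by lra.
  exact: le_lt_trans (clamp_lipschitz _ _ _ _) rt.
(* Clamping the time to the segment from [a] to [b] bounds the integrand on the
   whole line. *)
pose h t := rhs (seg y (clamp a b t)) (db t).
have mh i : measurable_fun setT (fun t => h t i 0).
  rewrite (_ : (fun t => h t i 0) = (fun t => F (seg y (clamp a b t)) i 0 +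
      \sum_j (G (seg y (clamp a b t)) i j * db t j 0))); last first.
    by apply/funext => t; rewrite /h /vfield !mxE.
  apply: measurable_funD; first exact: (cont_comp _ _ _ _ _ F_reg.1).
  apply: measurable_sum => j; apply: measurable_funM => //.
  exact: (cont_comp _ _ _ _ _ G_reg.1).
have hB i t : `|h t i 0| <= B.
  by apply: le_trans (coord_le_enorm _ _ _) _; apply: HB; exact: clamp_in.
have HP i := lipschitz_antiderivative a b (mh i) (hB i).
have [P HP'] := choice HP.
exists (fun t => \col_i P i t); split.
- by move=> t ta; apply/colP => i; rewrite !mxE; case: (HP' i) => ->.
- move=> s t; rewrite -mulrA -[n in n%:R]muln1; apply: enorm_le_coord => i j.
  by rewrite !mxE; case: (HP' i).
have ae : {ae mu, forall t, forall i, a < t < b ->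
    derivable (P i) t 1 /\ 'D_1 (P i) t = h t i 0}.
  have fil := ae_filter_ringOfSetsType mu.
  by apply: filter_forall => i; case: (HP' i).
apply: ae_imp ae => t H tab; apply: ederiv_of_coords => i.
rewrite (_ : (fun s => (\col_i0 P i0 s) i 0) = P i); last first.
  by apply/funext => s; rewrite mxE.
have := H i tab; rewrite /h clamp_id//.
by case/andP: tab => h1 h2; rewrite !ltW.
Qed.

End LocalExistence.

Section LocalSolution.
Variables (R : realType) (n m : nat) (Delta : R).
Hypothesis Delta0 : 0 < Delta.
Variables (F : (R -> 'cV[R]_n) -> 'cV[R]_n).
Variables (G : (R -> 'cV[R]_n) -> 'M[R]_(n, m)).
Hypothesis F_reg : regC Delta (@enorm R n 1) F.
Hypothesis G_reg : regC Delta (@enorm R n m) G.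
Local Notation mu := (@lebesgue_measure R).
Local Notation C := (@spaceC R n Delta).
Local Notation seg := (@segment R n Delta).
Local Notation rhs := (@vfield R n m F G).
Variable d : R -> 'cV[R]_m.
Hypothesis d_meas : lebesgue_measurable_fun d.
Hypothesis d_bnd : locally_ess_bounded d.

(** Picard iteration: [P] ranges over the increments of a trajectory that
    starts from [phi0] at time [t0], and the integral operator halves the
    distances on a short interval. *)
Lemma local_solution t0 phi0 : 0 <= t0 -> C phi0 ->
  exists2 tau : R, 0 < tau & exists y : R -> 'cV[R]_n,
  [/\ forall s, - Delta <= s <= 0 -> y (t0 + s) = phi0 s,
      exists L, forall s t, t0 <= s -> s <= t -> t <= t0 + tau ->
        enorm (y t - y s) <= L * (t - s) &
      {ae mu, forall t, t0 < t < t0 + tau -> ederiv y t (rhs (seg y t) (d t))}].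
Proof.
move=> t00 Cphi; have Dpos := Delta0.
have [D [db [D0 mdb dbD HD]]] := borel_disturbance d_meas d_bnd (t0 + 1).
have [del del0 [K K0 HK]] := vfield_lipschitz F_reg G_reg Cphi D0.
have [B B0 HB] := vfield_bounded F_reg G_reg (normC phi0 + del) D0.
(* [base] keeps the value of [phi0] at [0] after [t0]; the trajectories are its
   sums with increments that vanish up to [t0]. *)
pose base t := phi0 (clamp (- Delta) 0 (t - t0)).
have ND : - Delta <= 0 by rewrite oppr_le0 ltW.
have base_cont : cont_on (@enorm R n 1) setT base.
  move=> s _ e e0; have cl := clamp_in (s - t0) ND.
  have [|d1 d10 H1] := spaceC_cont Cphi (s := clamp (- Delta) 0 (s - t0)) _ e0.
    by rewrite /= in_itv.
  exists d1 => // r _ rs; apply: H1; first by rewrite /= in_itv/= clamp_in.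
  apply: le_lt_trans (clamp_lipschitz _ _ _ _) _.
  by rewrite opprB addrA subrK.
have base_ge t : t0 <= t -> base t = phi0 0.
  by move=> h; rewrite /base clamp_ge// subr_ge0.
have base_init s : - Delta <= s <= 0 -> base (t0 + s) = phi0 s.
  by move=> h; rewrite /base addrAC subrr add0r clamp_id.
have del2 : 0 < del / 2 by rewrite divr_gt0.
have [dm dm0 Hdm] := @cont_on_uniform R _ _ (t0 - Delta) (t0 + 1) base
  (enorm_even_subadditive R n 1) (cont_on_subset (@subsetT _ _) base_cont) _ del2.
pose nn : R := n%:R; have nn0 : 0 <= nn by rewrite ler0n.
pose L := nn * B; have L0 : 0 <= L by rewrite mulr_ge0.
have nK0 : 0 <= nn * K by rewrite mulr_ge0// ltW.
have [tau [tau0 /ltW tau1 taudm tauL tauK]] := small_step (@ltr01 R) dm0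
  del2 L0 nK0.
have t0tau : t0 <= t0 + tau by rewrite lerDl ltW.
pose incr (P : R -> 'cV[R]_n) := (forall t, t <= t0 -> P t = 0) /\
  forall s t, enorm (P t - P s) <= L * `|t - s|.
have traj_cont P : incr P -> cont_on (@enorm R n 1) setT (base \+ P).
  by move=> [_ PL]; apply: cont_onD => //; exact: lipschitz_cont_on PL.
have incr_le P t : incr P -> t <= t0 + tau -> enorm (P t) <= L * tau.
  move=> [P0 PL] tt; have [h|h] := leP t t0.
    by rewrite P0// enorm0 mulr_ge0// ltW.
  have := PL t0 t; rewrite (P0 t0)// subr0 ger0_norm ?subr_ge0 ?(ltW h)//.
  move=> /le_trans; apply; rewrite ler_wpM2l//; lra.
have trajC P t : incr P -> t0 <= t <= t0 + tau -> C (seg (base \+ P) t).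
  move=> hP /andP[h1 h2]; apply: spaceC_segment.
  exact: cont_on_subset (traj_cont P hP).
have traj_near P t : incr P -> t0 <= t <= t0 + tau ->
    normC (seg (base \+ P) t \- phi0) <= del.
  move=> hP /[dup] htau /andP[h1 h2].
  apply: normC_le; [exact: spaceCB (trajC _ _ hP htau) Cphi|exact: ltW|].
  move=> s /[dup] hs /andP[s1 s2]; rewrite /= segmentE// -(base_init s hs) /=.
  rewrite addrAC (le_trans (enormD _ _))//.
  rewrite [leRHS](splitr del) lerD//.
    have hd : `|(t + s) - (t0 + s)| < dm.
      have -> : (t + s) - (t0 + s) = t - t0 by ring.
      by rewrite ger0_norm ?subr_ge0// ltrBlDl (le_lt_trans h2)// ltrD2l.
    apply: ltW; apply: Hdm hd; apply/andP; split.
    - by rewrite (le_trans _ (lerD h1 s1)).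
    - by rewrite (le_trans (lerD h2 s2))// addr0 lerD2l.
    - by rewrite lerD2l.
    - by rewrite lerD2l (le_trans s2)// ler01.
  apply: le_trans tauL; apply: incr_le => //; lra.
pose next (P P' : R -> 'cV[R]_n) := {ae mu, forall t, t0 < t < t0 + tau ->
    ederiv P' t (rhs (seg (base \+ P) t) (db t))}.
have next_ex P : exists P', incr P -> incr P' /\ next P P'.
  have [hP|hP] := pselect (incr P); last by exists P.
  have [|P' [P'0 P'L P'd]] := @field_antiderivative R n m Delta F G F_reg G_reg
      (base \+ P) db t0 (t0 + tau) B t00 t0tau (traj_cont P hP) mdb.
    move=> t s ht; apply: HB => //; first exact: trajC.
    rewrite (le_trans (normC_le_sub Delta0 (trajC _ _ hP ht) Cphi))//.
    by rewrite addrC lerD2l traj_near.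
  by exists P' => _; split.
have incr_ac P a b : incr P -> coords_ac a b P.
  move=> [_ PL]; apply: (coords_ac_of_lipschitz (L := L)) => s t _ st _.
  by rewrite (le_trans (PL s t))// ger0_norm// subr_ge0.
have next_contract P P' Q Q' M : incr P -> incr P' -> incr Q -> incr Q' ->
    next P P' -> next Q Q' -> 0 <= M ->
    (forall t, t0 <= t <= t0 + tau -> enorm (P t - Q t) <= M) ->
    forall t, t0 <= t <= t0 + tau -> enorm (P' t - Q' t) <= M / 2.
  move=> hP hP' hQ hQ' PP' QQ' M0 HM t /andP[tt0 ttau].
  have -> : P' t - Q' t = (P' \- Q') t - (P' \- Q') t0.
    by rewrite /= (hP'.1 t0)// (hQ'.1 t0)// !subr0.
  apply: (@le_trans _ _ (nn * (K * M) * (t - t0))).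
    apply: ac_enorm_increment_le => //.
      by apply: coords_acB; exact: incr_ac.
    apply: ae_imp (ae_and PP' QQ') => s [h1 h2] /andP[s1 s2].
    have hs : t0 < s < t0 + tau by rewrite s1 (lt_le_trans s2).
    have hs' : t0 <= s <= t0 + tau.
      by rewrite (ltW s1) ltW// (lt_le_trans s2).
    exists (rhs (seg (base \+ P) s) (db s) - rhs (seg (base \+ Q) s) (db s)).
      by apply: ederiv_sub; [exact: h1|exact: h2].
    have CP := trajC _ _ hP hs'; have CQ := trajC _ _ hQ hs'.
    apply: le_trans (HK _ _ _ CP CQ (traj_near _ _ hP hs') (traj_near _ _ hQ hs')
      (dbD s)) _.
    rewrite ler_pM2l//; apply: normC_segment_sub_le => // v /andP[v1 v2] /=.
    rewrite opprD addrACA subrr add0r.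
    have [h|h] := leP (s + v) t0; first by rewrite hP.1// hQ.1// subrr enorm0.
    by apply: HM; rewrite (ltW h)/=; case/andP: hs' => *; lra.
  have h1 : nn * K * (t - t0) <= nn * K * tau by rewrite ler_wpM2l//; lra.
  have h2 := ler_wpM2l M0 (le_trans h1 tauK).
  by lra.
have [J HJ] := choice next_ex.
pose P_ k := iter k J (fun=> 0).
have incr0 : incr (fun=> 0).
  by split=> // s t; rewrite subrr enorm0 mulr_ge0.
have incr_k k : incr (P_ k) by elim: k => // k IH; exact: (HJ _ IH).1.
have next_k k : next (P_ k) (P_ k.+1) by exact: (HJ _ (incr_k k)).2.
pose M := 2 * (L * tau); have M0 : 0 <= M by rewrite !mulr_ge0// ltW.
have cauchy k i t : t0 <= t <= t0 + tau ->
    enorm (P_ (k + i)%N t - P_ k t) <= M / 2 ^+ k.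
  elim: k t => [|k IH] t ht.
    rewrite add0n expr0 divr1 (le_trans (enormB _ _))//.
    have /andP[_ ht2] := ht.
    have := incr_le _ _ (incr_k i) ht2; have := incr_le _ _ (incr_k 0%N) ht2.
    by rewrite /M; lra.
  have M20 : 0 <= M / 2 ^+ k by rewrite divr_ge0// exprn_ge0.
  have := next_contract _ _ _ _ _ (incr_k (k + i)%N) (incr_k (k + i).+1)
    (incr_k k) (incr_k k.+1) (next_k _) (next_k _) M20 IH t ht.
  by rewrite addSn exprSr invfM mulrA.
have cl_in t := clamp_in t t0tau.
have lim_ex t : exists l, forall k,
    enorm (P_ k (clamp t0 (t0 + tau) t) - l) <= nn * M / 2 ^+ k.
  by apply: halving_limit_vec => k i; apply: cauchy; exact: cl_in.
have [P HP] := choice lim_ex.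
have incrP : incr P.
  split.
    move=> t tt0; apply/enorm_eq0/eqP; rewrite eq_le enorm_ge0 andbT.
    apply: (@le_of_halvings _ _ _ (nn * M)) => k; rewrite add0r.
    have := HP t k; rewrite clamp_le// (incr_k k).1// sub0r enormN.
    exact.
  move=> s t; apply: (@le_of_halvings _ _ _ (2 * (nn * M))) => k.
  set cs := clamp t0 (t0 + tau) s; set ct := clamp t0 (t0 + tau) t.
  have h1 := HP s k; have h2 := HP t k.
  have h3 := (incr_k k).2 cs ct.
  have h4 : L * `|ct - cs| <= L * `|t - s|.
    by rewrite ler_wpM2l// clamp_lipschitz.
  have h5 := enorm_tri (P t) (P_ k ct) (P s).
  have h6 := enorm_tri (P_ k ct) (P_ k cs) (P s).
  rewrite [enorm (P t - P_ k ct)]enorm_distC in h5.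
  rewrite -mulrA; lra.
have [incrJ nextJ] := HJ _ incrP.
have fixP t : t0 <= t <= t0 + tau -> P t = J P t.
  move=> ht; apply/eqP; rewrite -subr_eq0; apply/eqP/enorm_eq0/eqP.
  rewrite eq_le enorm_ge0 andbT.
  apply: (@le_of_halvings _ _ _ (2 * (nn * M))) => k; rewrite add0r.
  have c0 : 0 <= nn * M / 2 ^+ k by apply: divr_ge0; [exact: mulr_ge0|exact: exprn_ge0].
  have HPk s : t0 <= s <= t0 + tau -> enorm (P_ k s - P s) <= nn * M / 2 ^+ k.
    by move=> hs; have := HP s k; rewrite clamp_id.
  have h1 := next_contract _ _ _ _ _ (incr_k k) (incr_k k.+1) incrP incrJ
    (next_k k) nextJ c0 HPk t ht.
  have h2 := HP t k.+1; rewrite clamp_id// in h2.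
  have h3 : nn * M / 2 ^+ k.+1 = nn * M / 2 ^+ k / 2.
    by rewrite exprSr invfM mulrA.
  have h4 := enorm_tri (P t) (P_ k.+1 t) (J P t).
  rewrite [enorm (P t - P_ _ _)]enorm_distC in h4.
  rewrite -mulrA; lra.
exists tau => //; exists (base \+ P); split.
- move=> s hs; rewrite /= base_init// incrP.1 ?addr0//.
  by case/andP: hs => _ s0; rewrite gerDl.
- exists L => s t ts st tt; rewrite /= !base_ge ?(le_trans ts)//.
  rewrite opprD addrACA subrr add0r (le_trans (incrP.2 s t))//.
  by rewrite ger0_norm// subr_ge0.
apply: ae_imp (ae_and nextJ HD) => t [h1 h2] /[dup] ht /andP[t1 t2].
have [|dE _] := h2 (le_trans t00 (ltW t1)); first by rewrite (lt_le_trans t2)// lerD2l.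
have {h1} := h1 ht; rewrite dE => h1.
have {}h1 : ederiv P t (rhs (seg (base \+ P) t) (d t)).
  by apply: ederiv_in_itv h1; [exact: ht|move=> s /fixP].
move=> e e0; have [d1 d10 H1] := h1 e e0.
exists (Num.min d1 (t - t0)); first by rewrite lt_min d10 subr_gt0.
move=> h; rewrite lt_min => /andP[hd]; rewrite ltr_norml => /andP[hh1 hh2] /=.
rewrite !base_ge; [|exact: ltW|by lra].
have -> : phi0 0 + P (t + h) - (phi0 0 + P t) = P (t + h) - P t.
  by rewrite opprD addrACA subrr add0r.
exact: H1.
Qed.

End LocalSolution.

(** * Continuation of solutions *)

Section Continuation.
Variables (R : realType) (n m : nat) (Delta : R).
Hypothesis Delta0 : 0 < Delta.
Variables (F : (R -> 'cV[R]_n) -> 'cV[R]_n).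
Variables (G : (R -> 'cV[R]_n) -> 'M[R]_(n, m)).
Hypothesis F_reg : regC Delta (@enorm R n 1) F.
Hypothesis G_reg : regC Delta (@enorm R n m) G.
Local Notation mu := (@lebesgue_measure R).
Local Notation C := (@spaceC R n Delta).
Local Notation seg := (@segment R n Delta).
Local Notation rhs := (@vfield R n m F G).
Variable d : R -> 'cV[R]_m.
Hypothesis d_meas : lebesgue_measurable_fun d.
Hypothesis d_bnd : locally_ess_bounded d.
Variable xi0 : R -> 'cV[R]_n.
Hypothesis xi0_C : C xi0.

(** Lipschitz rather than absolutely continuous: the disturbance is locally
    bounded, hence so is the derivative of a solution. *)
Definition sol (T : R) (x : R -> 'cV[R]_n) := [/\
  forall s, - Delta <= s <= 0 -> x s = xi0 s,
  exists L, forall s t, 0 <= s -> s <= t -> t <= T ->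
    enorm (x t - x s) <= L * (t - s) &
  solves Delta F G d T x].

(** A trajectory is the sum of its initial function, stopped at time [0], and of
    its increment from time [0] on. *)
Lemma cont_on_initial T (x : R -> 'cV[R]_n) : 0 <= T ->
  (forall s, - Delta <= s <= 0 -> x s = xi0 s) ->
  cont_on (@enorm R n 1) `[0, T] x -> cont_on (@enorm R n 1) `[- Delta, T] x.
Proof.
move=> T0 x0 cx.
have ND : - Delta <= 0 by rewrite oppr_le0 ltW.
have dec r : - Delta <= r <= T ->
    x r = xi0 (clamp (- Delta) 0 r) + (x (clamp 0 T r) - x 0).
  move=> /andP[r1 r2]; have [r0|r0] := leP r 0.
    by rewrite clamp_id ?r1// (clamp_le T0 r0) subrr addr0 x0// r1.
  rewrite (clamp_ge ND (ltW r0)) (clamp_id (a := 0)) ?(ltW r0)//.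
  by rewrite -x0 ?ND ?lexx// addrC subrK.
move=> s; rewrite /= in_itv/= => hs e e0; have e2 : 0 < e / 2 by rewrite divr_gt0.
have [|d1 d10 H1] := spaceC_cont xi0_C (s := clamp (- Delta) 0 s) _ e2.
  by rewrite /= in_itv/= clamp_in.
have [|d2 d20 H2] := cx (clamp 0 T s) _ _ e2.
  by rewrite /= in_itv/= clamp_in.
exists (Num.min d1 d2); first by rewrite lt_min d10.
move=> r; rewrite /= in_itv/= => hr; rewrite lt_min => /andP[rs1 rs2].
rewrite (dec r hr) (dec s hs).
have -> : xi0 (clamp (- Delta) 0 r) + (x (clamp 0 T r) - x 0) -
    (xi0 (clamp (- Delta) 0 s) + (x (clamp 0 T s) - x 0)) =
    (xi0 (clamp (- Delta) 0 r) - xi0 (clamp (- Delta) 0 s)) +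
    (x (clamp 0 T r) - x (clamp 0 T s)).
  by apply/matrixP => i j; rewrite !mxE; ring.
apply: le_lt_trans (enormD _ _) _; rewrite [ltRHS](splitr e); apply: ltrD.
  apply: H1; first by rewrite /= in_itv/= clamp_in.
  exact: le_lt_trans (clamp_lipschitz _ _ _ _) rs1.
apply: H2; first by rewrite /= in_itv/= clamp_in.
exact: le_lt_trans (clamp_lipschitz _ _ _ _) rs2.
Qed.

Lemma sol_cont T x : 0 <= T -> sol T x -> cont_on (@enorm R n 1) `[- Delta, T] x.
Proof.
move=> T0 [x0 [L xL] _]; apply: cont_on_initial => //.
have L10 : 0 < `|L| + 1 by rewrite ltr_wpDl.
have lip u v : 0 <= u -> u <= v -> v <= T ->
    enorm (x v - x u) <= (`|L| + 1) * (v - u).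
  move=> u0 uv vT; rewrite (le_trans (xL _ _ u0 uv vT))//.
  by rewrite ler_wpM2r ?subr_ge0// (le_trans (ler_norm L))// lerDl.
move=> s; rewrite /= in_itv/= => /andP[s0 sT] e e0.
exists (e / (`|L| + 1)); first by rewrite divr_gt0.
move=> r; rewrite /= in_itv/= => /andP[r0 rT]; rewrite ltr_pdivlMr// mulrC.
apply: le_lt_trans; have [h|/ltW h] := leP s r.
  by rewrite (ger0_norm (x := r - s)) ?subr_ge0//; exact: lip.
rewrite enorm_distC distrC (ger0_norm (x := s - r)) ?subr_ge0//.
exact: lip.
Qed.

Lemma sol_ac T x : sol T x -> coords_ac 0 T x.
Proof. by move=> [_ [L xL] _]; exact: coords_ac_of_lipschitz xL. Qed.

Lemma sol_restrict T T' x : T' <= T -> sol T x -> sol T' x.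
Proof.
move=> TT [x0 [L xL] dx]; split=> //.
  by exists L => s t s0 st tT; apply: xL => //; exact: le_trans TT.
apply: ae_imp dx => t h /andP[t0 tT]; apply: h.
by rewrite t0 (lt_le_trans tT).
Qed.

Lemma sol_unique T x y : 0 <= T -> sol T x -> sol T y ->
  forall t, - Delta <= t <= T -> x t = y t.
Proof.
move=> T0 hx hy; apply: (solves_unique Delta0 F_reg G_reg d_meas d_bnd
  (sol_cont T0 hx) (sol_cont T0 hy) (sol_ac hx) (sol_ac hy)).
- by case: hx.
- by case: hy.
- by case: hx hy => hx _ _ [hy _ _] s hs; rewrite hx// hy.
Qed.

Lemma ederiv_rhs_eq (x y : R -> 'cV[R]_n) a b t : a < t < b ->
  (forall s, t - Delta <= s <= b -> x s = y s) -> (forall s, a <= s <= b -> x s = y s) ->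
  ederiv x t (rhs (seg x t) (d t)) -> ederiv y t (rhs (seg y t) (d t)).
Proof.
move=> /[dup] htab /andP[at_ tb] xy1 xy2.
rewrite (@eq_segment _ _ _ x y t); first exact: (ederiv_in_itv htab xy2).
by move=> s /andP[s1 s2]; apply: xy1; rewrite s1 (le_trans s2)// ltW.
Qed.

Lemma sol_eq T x y : 0 <= T -> (forall t, - Delta <= t <= T -> x t = y t) ->
  sol T x -> sol T y.
Proof.
move=> T0 xy [x0 [L xL] dx]; have Dpos := Delta0; split.
- move=> s /[dup] hs /andP[s1 s2].
  by rewrite -xy ?x0// s1 (le_trans s2).
- exists L => s t s0 st tT; rewrite -!xy ?xL//; apply/andP; split; lra.
apply: ae_imp dx => t h /[dup] htT /andP[t0 tT].
apply: (ederiv_rhs_eq htT) (h htT) => s /andP[s1 s2]; apply: xy.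
  by rewrite s2 andbT; lra.
by rewrite s2 andbT; lra.
Qed.

Lemma sol0 : sol 0 xi0.
Proof.
split=> //.
  exists 0 => s t s0 st t0; suff -> : t = s by rewrite !subrr enorm0 mulr0.
  by apply/eqP; rewrite eq_le st (le_trans t0).
apply: aeW => t /andP[t0 t1]; by have := lt_trans t0 t1; rewrite ltxx.
Qed.

Lemma sol_extend T x : 0 <= T -> sol T x ->
  exists2 tau : R, 0 < tau & exists z, sol (T + tau) z.
Proof.
move=> T0 hx; have Dpos := Delta0.
have hT : 0 <= T <= T by rewrite T0 lexx.
have CT := spaceC_segment_of (sol_cont T0 hx) hT.
have [tau tau0 [y [yinit [L yL] dy]]] :=
  local_solution Delta0 F_reg G_reg d_meas d_bnd T0 CT.
exists tau => //; pose z t := if t <= T then x t else y t; exists z.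
have zx t : t <= T -> z t = x t by rewrite /z => ->.
have zy t : T - Delta <= t -> z t = y t.
  move=> h; rewrite /z; case: ifPn => // tT.
  have hs : - Delta <= t - T <= 0 by apply/andP; split; lra.
  have := yinit _ hs; rewrite segmentE// => E.
  by rewrite [in RHS](_ : t = T + (t - T)) ?E; [congr x|]; ring.
case: hx => x0 [L' xL] dx; split.
- by move=> s /[dup] hs /andP[s1 s2]; rewrite zx ?x0// (le_trans s2).
- exists (`|L| + `|L'|) => s t s0 st tT.
  have l1 := ler_norm L; have l2 := ler_norm L'.
  have n1 := normr_ge0 L; have n2 := normr_ge0 L'.
  have ly u v : T <= u -> u <= v -> v <= T + tau ->
      enorm (z v - z u) <= (`|L| + `|L'|) * (v - u).
    move=> Tu uv vt; rewrite !zy ?(le_trans (yL _ _ Tu uv vt))//; try lra.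
    by rewrite ler_wpM2r ?subr_ge0//; lra.
  have lx u v : 0 <= u -> u <= v -> v <= T ->
      enorm (z v - z u) <= (`|L| + `|L'|) * (v - u).
    move=> u0 uv vT; rewrite !zx ?(le_trans uv)// (le_trans (xL _ _ u0 uv vT))//.
    by rewrite ler_wpM2r ?subr_ge0//; lra.
  have [tT'|/ltW Tt] := leP t T; first exact: lx.
  have [sT|/ltW Ts] := leP s T; last exact: ly.
  apply: le_trans (enorm_tri _ (z T) _) _.
  have := ly _ _ (lexx T) Tt tT; have := lx _ _ s0 sT (lexx T); lra.
have notT : {ae mu, forall t, t <> T}.
  exists [set T]; split; [exact: measurable_set1|exact: lebesgue_measure_set1|].
  by move=> t /= /contrapT.
apply: ae_imp (ae_and notT (ae_and dx dy)) => t [tT [h1 h2]] /andP[t0 tt].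
have [tltT|Tt] := ltP t T.
  have ht : 0 < t < T by rewrite t0.
  apply: (ederiv_rhs_eq ht) (h1 ht) => s /andP[s1 s2]; by rewrite zx.
have ht : T < t < T + tau by rewrite tt andbT lt_neqAle Tt andbT; apply/eqP => /esym.
apply: (ederiv_rhs_eq ht) (h2 ht) => s /andP[s1 s2]; rewrite zy//; lra.
Qed.

(** Uniqueness makes solutions on various intervals compatible. *)
Lemma sol_glue (T : nat -> R) (X : nat -> R -> 'cV[R]_n) :
  (forall k, 0 <= T k) -> (forall k, sol (T k) (X k)) ->
  exists x, forall k, sol (T k) x.
Proof.
move=> T0 hX.
have H t : exists v, forall k, - Delta <= t <= T k -> v = X k t.
  have [[k hk]|h] := pselect (exists k, - Delta <= t <= T k); last first.
    by exists 0 => k hk; exfalso; apply: h; exists k.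
  exists (X k t) => j hj.
  have [jk|/ltW kj] := leP (T j) (T k).
    exact: (sol_unique (T0 j) (sol_restrict jk (hX k)) (hX j)).
  exact: (sol_unique (T0 k) (hX k) (sol_restrict kj (hX j))).
have [x Hx] := choice H.
by exists x => k; apply: sol_eq (hX k) => // t ht; rewrite (Hx t k).
Qed.

(** A bounded solution has a bounded derivative, hence a limit at the right end
    of its interval. *)
Lemma sol_limit S B x : 0 < S -> (forall T, 0 <= T -> T < S -> sol T x) ->
  (forall t, 0 <= t -> t < S -> enorm (x t) <= B) -> exists z, sol S z.
Proof.
move=> S0 hx xB; have Dpos := Delta0.
have [D [db [D0 _ _ HD]]] := borel_disturbance d_meas d_bnd S.
have [K K0 HK] := vfield_bounded F_reg G_reg (Num.max B (normC xi0)) D0.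
pose L := n%:R * K; have L0 : 0 <= L by rewrite mulr_ge0.
have xL s t : 0 <= s -> s <= t -> t < S -> enorm (x t - x s) <= L * (t - s).
  move=> s0 st tS; have t0 := le_trans s0 st.
  have ht := hx _ t0 tS; apply: ac_enorm_increment_le => //.
    by move=> i; apply: ac_on_subset (sol_ac ht i).
  case: (ht) => x0 _ dx; apply: ae_imp (ae_and dx HD) => u [h1 h2] /andP[su ut].
  have u0 : 0 < u by exact: le_lt_trans su.
  have hu : 0 < u < t by rewrite u0.
  have hu' : 0 <= u <= t by rewrite (ltW u0) ltW.
  exists (rhs (seg x u) (d u)); first exact: h1.
  have Cu := spaceC_segment_of (sol_cont t0 ht) hu'.
  have [_ dD] := h2 (ltW u0) (lt_trans ut tS).
  apply: HK => //; apply: normC_segment_le => //.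
    by rewrite le_max normC_ge0 orbT.
  move=> v /andP[v1 v2]; have [uv|uv] := leP (u + v) 0.
    by rewrite x0 ?le_max ?(le_normC Delta0) ?orbT//; apply/andP; split; lra.
  by rewrite le_max xB ?(ltW uv)//; lra.
have lim_ex (i : 'I_n) : exists l, forall u, 0 <= u -> u < S ->
    `|l - x u i 0| <= L * (S - u).
  pose E := [set x u i 0 - L * (S - u) | u in `[0, S[].
  have Eub v : 0 <= v -> v < S -> ubound E (x v i 0 + L * (S - v)).
    move=> v0 vS _ [u /= + <-]; rewrite in_itv/= => /andP[u0 uS].
    have xi w w' : `|x w i 0 - x w' i 0| <= enorm (x w - x w').
      by have := coord_le_enorm (x w - x w') i 0; rewrite !mxE.
    have [uv|/ltW vu] := leP u v.
      have h1 := xL _ _ u0 uv vS; have := le_trans (xi _ _) h1.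
      rewrite ler_norml => /andP[h2 h3].
      have h4 : 0 <= L * (S - v) by rewrite mulr_ge0// subr_ge0 ltW.
      by lra.
    have h1 := xL _ _ v0 vu uS; have := le_trans (xi _ _) h1.
    rewrite ler_norml => /andP[h2 h3].
    have h4 : 0 <= L * (S - u) by rewrite mulr_ge0// subr_ge0 ltW.
    by lra.
  have E0 : E !=set0.
    by exists (x 0 i 0 - L * (S - 0)), 0 => //=; rewrite in_itv/= lexx.
  exists (sup E) => u u0 uS.
  have h1 : x u i 0 - L * (S - u) <= sup E.
    apply: ub_le_sup; first by exists (x 0 i 0 + L * (S - 0)); exact: Eub.
    by exists u => //=; rewrite in_itv/= u0.
  have h2 : sup E <= x u i 0 + L * (S - u) by apply: ge_sup => //; exact: Eub.
  by rewrite ler_norml; apply/andP; split; lra.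
have [l Hl] := choice lim_ex.
pose z t := if t < S then x t else \col_i l i; exists z.
have zx t : t < S -> z t = x t by rewrite /z => ->.
have x0 : forall s, - Delta <= s <= 0 -> x s = xi0 s by case: (hx 0 (lexx 0) S0).
pose L' := L + n%:R * L; have LL' : L <= L' by rewrite lerDl mulr_ge0.
split.
- by move=> s /[dup] hs /andP[s1 s2]; rewrite zx ?x0// (le_lt_trans s2).
- exists L' => s t s0 st tS.
  have st0 : 0 <= t - s by rewrite subr_ge0.
  have [tltS|St] := ltP t S.
    rewrite !zx ?(le_lt_trans st)// (le_trans (xL _ _ s0 st tltS))//.
    by rewrite ler_wpM2r.
  have tE : t = S by apply/eqP; rewrite eq_le tS.
  have [sltS|Ss] := ltP s S; last first.
    have -> : s = t by apply/eqP; rewrite eq_le st tE.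
    by rewrite !subrr enorm0 mulr0.
  rewrite (zx s)// /z ltNge St/= (@le_trans _ _ (n%:R * (L * (t - s))))//.
    rewrite -[n in n%:R]muln1; apply: enorm_le_coord => i j.
    by rewrite (ord1 j) !mxE tE Hl.
  by rewrite mulrA ler_wpM2r// lerDr.
(* Exhaust the open interval by countably many closed ones. *)
pose T k : R := S - S / k.+1%:R.
have T0 k : 0 <= T k.
  by rewrite subr_ge0 ler_pdivrMr ?ltr0n// ler_peMr ?(ltW S0)// ler1n.
have TS k : T k < S by rewrite ltrBlDr ltrDl divr_gt0.
have dT k : solves Delta F G d (T k) x by case: (hx _ (T0 k) (TS k)).
have ae_all : {ae mu, forall t, forall k, 0 < t < T k ->
    ederiv x t (rhs (seg x t) (d t))}.
  by apply/ae_foralln => k; exact: dT.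
apply: ae_imp ae_all => t h /andP[t0 tS].
have St : 0 < S - t by rewrite subr_gt0.
have hk := archi_boundP (divr_ge0 (ltW S0) (ltW St)).
set k := Num.bound _ in hk.
have tTk : t < T k.
  rewrite /T ltrBrDl -ltrBrDr ltr_pdivrMr ?ltr0n//.
  move: hk; rewrite ltr_pdivrMr// => /lt_trans; apply.
  by rewrite mulrC ltr_pM2l// ltr_nat.
have ht : 0 < t < T k by rewrite t0.
apply: (ederiv_rhs_eq ht) (h k ht) => s /andP[_ s2]; rewrite zx//;
  exact: le_lt_trans s2 (TS k).
Qed.

Hypothesis apriori : forall S, exists B, forall T x, 0 <= T -> T <= S ->
  sol T x -> forall t, 0 <= t -> t <= T -> enorm (x t) <= B.

(** An a priori bound excludes blow-up: [sol_limit] closes the interval of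
    existence on the right and [sol_extend] opens it further. *)
Theorem global_solution : exists x, forall T, 0 <= T -> sol T x.
Proof.
have ex S : 0 <= S -> exists x, sol S x.
  move=> S0.
  suff H : forall t, 0 <= t <= S -> exists x, sol t x by apply: H; rewrite S0 lexx.
  apply: segment_induction => // s /andP[s0 sS] IH.
  have [x hx] : exists x, sol s x.
    have [->|sn0] := eqVneq s 0; first by exists xi0; exact: sol0.
    have spos : 0 < s by rewrite lt_neqAle eq_sym sn0.
    pose T k : R := s - s / k.+1%:R.
    have T0 k : 0 <= T k.
      by rewrite subr_ge0 ler_pdivrMr ?ltr0n// ler_peMr// ler1n.
    have Ts k : T k < s by rewrite ltrBlDr ltrDl divr_gt0.
    have [X HX] := choice (fun k => IH _ (T0 k) (Ts k)).
    have [x Hx] := sol_glue T0 HX.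
    have Hx' t : 0 <= t -> t < s -> sol t x.
      move=> t0 ts; have st : 0 < s - t by rewrite subr_gt0.
      have hk := archi_boundP (divr_ge0 s0 (ltW st)).
      set k := Num.bound _ in hk.
      apply: sol_restrict (Hx k); apply: ltW.
      rewrite /T ltrBrDl -ltrBrDr ltr_pdivrMr ?ltr0n//.
      move: hk; rewrite ltr_pdivrMr// => /lt_trans; apply.
      by rewrite mulrC ltr_pM2l// ltr_nat.
    have [B HB] := apriori s.
    apply: (@sol_limit s B x) => // t t0 ts.
    by apply: (HB t x) => //; [exact: ltW|exact: Hx'].
  have [tau tau0 [z hz]] := sol_extend s0 hx.
  by exists tau => // t st tst _; exists z; exact: sol_restrict hz.
have [X HX] := choice (fun k : nat => ex k%:R (ler0n _ k)).
have [x Hx] := sol_glue (fun k => ler0n R k) HX.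
exists x => T T0; apply: sol_restrict (Hx (Num.bound T)).
by apply: ltW; exact: archi_boundP.
Qed.

End Continuation.

(** * The Lyapunov functional along trajectories *)

Section LyapunovDerivative.
Variables (R : realType) (n : nat) (Delta : R).
Hypothesis Delta0 : 0 < Delta.
Variable V : 'cV[R]_n -> (R -> 'cV[R]_n) -> R.
Local Notation C := (@spaceC R n Delta).
Local Notation Q := (@spaceQ R n Delta).
Local Notation seg := (@segment R n Delta).
Implicit Types phi : R -> 'cV[R]_n.

Lemma restrQE phi (s : R) : - Delta <= s -> s < 0 -> restrQ Delta phi s = phi s.
Proof. by move=> h1 h2; rewrite /restrQ /truncation /patch mem_set//= in_itv/= h1. Qed.

Lemma restrQ_out phi (s : R) : ~~ (- Delta <= s < 0) -> restrQ Delta phi s = 0.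
Proof.
move=> h; rewrite /restrQ /truncation /patch memNset//= in_itv/=; exact/negP.
Qed.

Lemma spaceQ_restrQ phi : C phi -> Q (restrQ Delta phi).
Proof.
move=> Cphi.
have cphi s : - Delta <= s -> s < 0 -> forall e, 0 < e -> exists2 d, 0 < d &
    forall r, - Delta <= r -> r < 0 -> `|r - s| < d ->
      `|restrQ Delta phi s - restrQ Delta phi r| < e.
  move=> s1 s2 e e0; have [|d d0 H] := spaceC_cont Cphi (s := s) _ e0.
    by rewrite /= in_itv/= s1 ltW.
  exists d => // r r1 r2 rs; rewrite !restrQE// distrC.
  apply: le_lt_trans (mx_norm_le_enorm _) _; apply: H => //.
  by rewrite /= in_itv/= r1 ltW.
split.
- have [M HM] := spaceC_bounded Cphi; exists M => s.
  by rewrite in_itv/= => /andP[s1 s2]; rewrite restrQE.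
- exists set0 => // s; rewrite in_itv/= => /andP[s1 s2] _.
  apply/cvgrPdist_lt => e e0; rewrite near_withinE.
  have [d d0 H] := cphi s s1 s2 e e0; apply/nbhs_ballP; exists d => //= r.
  rewrite /ball/= distrC => rs; rewrite in_itv/= => /andP[r1 r2]; exact: H.
- move=> s; rewrite in_itv/= => /andP[s1 s2].
  apply/cvgrPdist_lt => e e0; rewrite /at_right near_withinE.
  have [d d0 H] := cphi s s1 s2 e e0.
  apply/nbhs_ballP; exists (Num.min d (- s)); first by rewrite /= lt_min d0 oppr_gt0.
  move=> r; rewrite /ball/= distrC lt_min => /andP[rs rs2] sr.
  apply: H => //; first by rewrite (le_trans s1)// ltW.
  by move: rs2; rewrite ger0_norm ?subr_ge0 ?(ltW sr)//; lra.
- by move=> s; rewrite in_itv/= => /restrQ_out.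
Qed.

Lemma psi_shift_hold phi h : C phi -> 0 <= h -> h < Delta ->
  restrQ Delta (hold Delta phi h) =
  psi_shift Delta (restrQ Delta phi) (fun=> phi 0) h.
Proof.
move=> Cphi h0 hD; apply/funext => s; rewrite /psi_shift !in_itv/=.
case: ifPn => [/andP[s1 s2]|s1].
  have s0 : s < 0 by rewrite (lt_le_trans s2)// oppr_le0.
  rewrite restrQE// /hold in_itv/= s1 s2/= restrQE//.
    by rewrite (le_trans s1)// lerDl.
  by rewrite -ltrBrDr sub0r.
case: ifPn => [/andP[s2 s3]|s2].
  rewrite restrQE//; last by rewrite (le_trans _ s2)// lerN2 ltW.
  by rewrite /hold !in_itv/= (negbTE s1) s2 (ltW s3).
apply: restrQ_out; apply/negP => /andP[s3 s4].
move: s1 s2; rewrite s3 s4 andbT/= -leNgt => ->.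
by [].
Qed.

(** Continued by the trajectory itself, a segment becomes a later segment: this is
    how the invariant derivative applies to trajectories. *)
Lemma psi_shift_segment x t h : 0 <= h -> h < Delta ->
  psi_shift Delta (restrQ Delta (seg x t)) (fun s => x (t + s)) h =
  restrQ Delta (seg x (t + h)).
Proof.
move=> h0 hD; apply/funext => s; rewrite /psi_shift !in_itv/=.
case: ifPn => [/andP[s1 s2]|s1].
  have s0 : s < 0 by rewrite (lt_le_trans s2)// oppr_le0.
  have sh : s + h < 0 by rewrite -ltrBrDr sub0r.
  have sh' : - Delta <= s + h by rewrite (le_trans s1)// lerDl.
  rewrite !restrQE// !segmentE ?s1 ?sh' ?ltW//.
  by congr x; ring.
case: ifPn => [/andP[s2 s3]|s2].
  have sD : - Delta <= s by rewrite (le_trans _ s2)// lerN2 ltW.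
  by rewrite restrQE// segmentE ?sD ?ltW//; congr x; ring.
apply/esym/restrQ_out; apply/negP => /andP[s3 s4].
move: s1 s2; rewrite s3 s4 andbT/= -leNgt => ->.
by [].
Qed.

Hypothesis V_id : invariantly_differentiable Delta V.

(** The invariant derivative is the limit that defines [dVdh]: freezing the
    present value is one of the admissible continuations. *)
Lemma invariant_expansion phi : C phi -> forall Y,
  {within `[0, Delta], continuous Y} -> Y 0 = phi 0 ->
  forall e : R, 0 < e -> exists2 delta : R, 0 < delta &
  forall (z : 'cV[R]_n) (h : R), 0 <= h < Delta ->
    Num.sqrt (enorm z ^+ 2 + h ^+ 2) < delta ->
    `| V (phi 0 + z) (psi_shift Delta (restrQ Delta phi) Y h)
       - V (phi 0) (restrQ Delta phi)
       - ((dVdx Delta V phi *m z) 0 0 + dVdh Delta V phi * h) |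
      <= e * Num.sqrt (enorm z ^+ 2 + h ^+ 2).
Proof.
move=> Cphi; have [dV [lim_dV _ Hexp]] := V_id (phi 0) (spaceQ_restrQ Cphi).
have -> : dVdh Delta V phi = dV.
  rewrite /dVdh; apply/cvg_lim => //.
  have c0 : {within `[0, Delta], continuous (fun=> phi 0)}.
    by apply: continuous_subspaceT => s; exact: cvg_cst.
  have := lim_dV _ c0 erefl.
  apply: cvg_trans; apply: near_eq_cvg; near=> h.
  have h0 : 0 < h by near: h; exact: nbhs_right_gt.
  have hD : h < Delta by near: h; exact: nbhs_right_lt.
  by rewrite /right_quotient !psi_shift_hold// ltW.
exact: Hexp.
Unshelve. all: by end_near. Qed.

Variables (x : R -> 'cV[R]_n) (T L : R).
Hypothesis x_cont : forall S, cont_on (@enorm R n 1) `[- Delta, S] x.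
Hypothesis x_lip : forall s t, 0 <= s -> s <= t -> t <= T ->
  enorm (x t - x s) <= L * (t - s).

Let w t := V_C Delta V (seg x t).

(** Since the trajectory is Lipschitz, the remainder of the invariant expansion is
    small with respect to [h]. *)
Lemma V_expansion t : 0 <= t -> t < T -> forall e, 0 < e ->
  exists2 delta, 0 < delta & forall h, 0 <= h -> h < delta ->
    `|w (t + h) - w t - ((dVdx Delta V (seg x t) *m (x (t + h) - x t)) 0 0
        + dVdh Delta V (seg x t) * h)| <= e * h.
Proof.
move=> t0 tT e e0; have Dpos := Delta0; have cx := x_cont.
have C_t : C (seg x t).
  by apply: (spaceC_segment_of (cx t)); rewrite t0 lexx.
pose K := `|L| + 1; have K0 : 0 < K by rewrite ltr_wpDl.
have K10 : 0 < K + 1 by rewrite addr_gt0.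
have eK : 0 < e / (K + 1) by rewrite divr_gt0.
have cY : {within `[0, Delta], continuous (fun s => x (t + s))}.
  apply/within_continuous_mxP => s; rewrite /= in_itv/= => /andP[s1 s2] e' e'0.
  have [|d d0 H] := cx (t + Delta) (t + s) _ e' e'0.
    by rewrite /= in_itv/=; apply/andP; split; lra.
  exists d => // r; rewrite /= in_itv/= => /andP[r1 r2] rs; apply: H.
    by rewrite /= in_itv/=; apply/andP; split; lra.
  by rewrite opprD addrACA subrr add0r.
have Y0 : x (t + 0) = seg x t 0 by rewrite addr0 segment0.
have [d d0 Hd] := invariant_expansion C_t cY Y0 eK.
exists (Num.min (Num.min Delta (T - t)) (d / (K + 1))).
  by rewrite !lt_min Delta0 subr_gt0 tT divr_gt0// addr_gt0.
move=> h h0; rewrite !lt_min => /andP[/andP[hD hT] hd].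
set z := x (t + h) - x t.
have zle : enorm z <= K * h.
  apply: (@le_trans _ _ (L * (t + h - t))); first by apply: x_lip; lra.
  by rewrite addrAC subrr add0r ler_wpM2r// (le_trans (ler_norm L))// lerDl.
have sq : Num.sqrt (enorm z ^+ 2 + h ^+ 2) <= (K + 1) * h.
  have K1h : 0 <= (K + 1) * h by rewrite mulr_ge0// addr_ge0// ltW.
  rewrite -(@ler_pXn2r _ 2%N)// ?nnegrE ?sqrtr_ge0//.
  rewrite sqr_sqrtr ?addr_ge0 ?sqr_ge0//.
  have : enorm z ^+ 2 <= (K * h) ^+ 2.
    by rewrite ler_pXn2r// nnegrE ?enorm_ge0// mulr_ge0// ltW.
  have : 0 <= K * h * h by rewrite !mulr_ge0// ltW.
  by move=> h1 h2; nra.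
have hD' : 0 <= h < Delta by rewrite h0.
have sqd : Num.sqrt (enorm z ^+ 2 + h ^+ 2) < d.
  by apply: le_lt_trans sq _; rewrite mulrC -ltr_pdivlMr.
have := Hd z h hD' sqd; rewrite psi_shift_segment//.
rewrite {1 2}segment0// /w /V_C !segment0// /z [x t + _]addrC subrK => H.
apply: le_trans H _.
rewrite -mulrA (le_trans (ler_wpM2l _ (ler_wpM2l _ sq)))//; first exact: ltW.
  by rewrite invr_ge0 addr_ge0// ltW.
by rewrite mulKf// gt_eqF// addr_gt0.
Qed.

End LyapunovDerivative.

Section LyapunovRegularity.
Variables (R : realType) (n : nat) (Delta : R).
Hypothesis Delta0 : 0 < Delta.
Variable V : 'cV[R]_n -> (R -> 'cV[R]_n) -> R.
Local Notation C := (@spaceC R n Delta).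
Local Notation seg := (@segment R n Delta).
Hypothesis V_id : invariantly_differentiable Delta V.
Hypothesis V_lip : lipC Delta (@Num.norm R R) (V_C Delta V).
Hypothesis Vh_reg : regC Delta (@Num.norm R R) (dVdh Delta V).
Hypothesis Vx_reg : regC Delta (@enorm R 1 n) (dVdx Delta V).
Variables (x : R -> 'cV[R]_n) (T L : R).
Hypothesis T0 : 0 <= T.
Hypothesis x_cont : forall S, cont_on (@enorm R n 1) `[- Delta, S] x.
Hypothesis x_lip : forall s t, 0 <= s -> s <= t -> t <= T ->
  enorm (x t - x s) <= L * (t - s).
Let w t := V_C Delta V (seg x t).

Lemma V_traj_cont : cont_onR `[0, T] w.
Proof.
have cx := @x_cont T; move=> t; rewrite /= in_itv/= => ht e e0.
have [d d0 Hd] := lipC_continuousC V_lip (spaceC_segment_of cx ht) e0.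
have d2 : 0 < d / 2 by rewrite divr_gt0.
have [d1 d10 Hd1] := segment_uniformly_continuous cx d2.
exists d1 => // r; rewrite in_itv/= => hr rt.
apply: Hd; first exact: spaceC_segment_of hr.
by rewrite -normCE (le_lt_trans (Hd1 _ _ hr ht rt))// ltr_pdivrMr// ltr_pMr// ltr1n.
Qed.

Lemma V_dini_ederiv t v : 0 <= t -> t < T -> ederiv x t v ->
  dini_le w t ((dVdx Delta V (seg x t) *m v) 0 0 + dVdh Delta V (seg x t)).
Proof.
move=> t0 tT dx e e0; set p := dVdx Delta V (seg x t).
have e2 : 0 < e / 2 by rewrite divr_gt0.
have p1 : 0 < enorm p + 1 by rewrite ltr_wpDl// enorm_ge0.
have e3 : 0 < e / 2 / (enorm p + 1) by rewrite divr_gt0.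
have [d1 d10 H1] := V_expansion Delta0 V_id x_cont x_lip t0 tT e2.
have [d2 d20 H2] := dx _ e3.
exists (Num.min d1 d2); first by rewrite lt_min d10.
move=> h h0; rewrite lt_min => /andP[h1 h2].
have := H1 h h0 h1; rewrite -/p -/(w t) -/(w (t + h)).
set z := x (t + h) - x t; set q := dVdh _ _ _.
have -> : (p *m z) 0 0 = (p *m (z - h *: v)) 0 0 + h * (p *m v) 0 0.
  have -> : p *m z = p *m (z - h *: v) + h *: (p *m v).
    by rewrite [p *m (z - _)]mulmxBr -scalemxAr subrK.
  by move: (p *m (z - _)) (p *m v) => A B; rewrite !mxE.
have : `|(p *m (z - h *: v)) 0 0| <= e / 2 * h.
  apply: le_trans (norm_row_mul_col _ _) _.
  have := H2 h; rewrite ger0_norm// => /(_ h2) h3.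
  apply: le_trans (ler_wpM2l (enorm_ge0 p) h3) _.
  rewrite mulrA ler_wpM2r// mulrCA ger_pMr// ler_pdivrMr// mul1r lerDl.
  exact: ler01.
rewrite !ler_norml => /andP[h3 h4] /andP[h5 h6]; lra.
Qed.

(** The segment at time [t] need not be Lipschitz in [t], the initial function being
    only continuous, so the Lipschitz property of [V] does not suffice. The
    invariant derivative bounds the Dini derivatives of [w] everywhere. *)
Lemma V_traj_ac : ac_on 0 T w.
Proof.
have [M HM] := segment_bounded (@x_cont T).
have [[Bx Bx0 HBx] [Bh Bh0 HBh]] := (Vx_reg.2 M, Vh_reg.2 M).
pose K := Bx * `|L| + Bh.
have dini t : 0 <= t -> t < T -> dini_le w t K /\ dini_le (fun t => - w t) t K.
  move=> t0 tT; have ht : 0 <= t <= T by rewrite t0 ltW.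
  have Ct := spaceC_segment_of (@x_cont T) ht.
  have px := HBx _ Ct (HM t ht); have ph := HBh _ Ct (HM t ht).
  have step e : 0 < e -> exists2 d, 0 < d & forall h, 0 <= h -> h < d ->
      `|w (t + h) - w t| <= (K + e) * h.
    move=> e0; have [d d0 H] := V_expansion Delta0 V_id x_cont x_lip t0 tT e0.
    exists (Num.min d (T - t)); first by rewrite lt_min d0 subr_gt0.
    move=> h h0; rewrite lt_min => /andP[h1 h2].
    have := H h h0 h1; rewrite -/(w t) -/(w (t + h)).
    set z := x (t + h) - x t.
    have zL : enorm z <= `|L| * h.
      apply: (@le_trans _ _ (L * (t + h - t))).
        by apply: x_lip; rewrite ?lerDl// -lerBrDl ltW.
      by rewrite addrAC subrr add0r ler_wpM2r// ler_norm.
    have : `|(dVdx Delta V (seg x t) *m z) 0 0| <= Bx * (`|L| * h).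
      by apply: le_trans (norm_row_mul_col _ _) _; apply: ler_pM => //; exact: enorm_ge0.
    move: ph; set q := dVdh _ _ _; set p := (_ *m z) 0 0 => ph.
    have : `|q * h| <= Bh * h by rewrite normrM (ger0_norm h0) ler_wpM2r.
    rewrite !ler_norml => /andP[h3 h4] /andP[h5 h6] /andP[h7 h8].
    by apply/andP; split; rewrite /K; lra.
  split=> e /step[d d0 H]; exists d => // h h0 hd; have := H h h0 hd.
    by apply: le_trans; exact: ler_norm.
  by apply: le_trans; rewrite -opprD -normrN; exact: ler_norm.
have cont_sub (f : R -> R) s t : 0 <= s -> t <= T -> cont_onR `[0, T] f ->
    cont_onR `[s, t] f.
  move=> s0 tT; apply: (@cont_on_subset _ _ (@Num.norm R R)) => u /=.
  by rewrite !in_itv/= => /andP[h1 h2]; rewrite (le_trans s0)// (le_trans h2).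
apply: (@lipschitz_ac_on _ _ _ _ K) => s t s0 st tT.
have h1 : w t - w s <= K * (t - s).
  apply: continuous_increment_le => //; first exact: cont_sub V_traj_cont.
  move=> u /andP[su ut]; apply: (dini u _ _).1.
    by rewrite (le_trans s0)// ltW.
  exact: lt_le_trans tT.
have h2 : - w t - - w s <= K * (t - s).
  apply: (@continuous_increment_le _ _ _ _ (fun t => - w t)) => //.
    apply: cont_sub => // u hu e e0; have [d d0 H] := V_traj_cont hu e0.
    by exists d => // r hr ru; rewrite -opprD normrN; exact: H.
  move=> u /andP[su ut]; apply: (dini u _ _).2.
    by rewrite (le_trans s0)// ltW.
  exact: lt_le_trans tT.
by rewrite ler_norml; apply/andP; split; lra.
Qed.

End LyapunovRegularity.

(** * Comparison principle *)

Section ComparisonPrinciple.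
Variable R : realType.
Local Notation mu := (@lebesgue_measure R).

(** Above the level where [rho] equals [2 c], the function loses at least half
    of [rho]; below that level it cannot come back up. *)
Lemma comparison_bound (rho : R -> R) (w : R -> R) (T c y r : R) :
  classK rho -> 0 <= T -> ac_on 0 T w ->
  (forall t, 0 <= t <= T -> 0 <= w t) -> 0 <= c ->
  {ae mu, forall t, 0 < t < T -> dini_le w t (- rho (w t) + c)} ->
  0 <= y -> y + T * (rho y / 2) = w 0 -> 0 <= r -> 2 * c <= rho r ->
  w T <= Num.max y r.
Proof.
move=> rhoK T0 wac w0 c0 wd y0 yE r0 rE; set K := Num.max y r.
have K0 : 0 <= K by rewrite le_max y0.
have yK : y <= K by rewrite le_max lexx.
have rK : r <= K by rewrite le_max lexx orbT.
have wc := ac_on_cont wac.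
rewrite leNgt; apply/negP => KwT.
have rate t : 0 <= t <= T -> K <= w t ->
    - rho (w t) + c <= 0 /\ - rho (w t) + c <= - (rho y / 2).
  move=> ht Kw; have h1 : rho y <= rho (w t).
    by apply: (classK_le rhoK) => //; exact: le_trans Kw.
  have h2 : rho r <= rho (w t).
    by apply: (classK_le rhoK) => //; exact: le_trans Kw.
  by split; lra.
pose S := [set t | 0 <= t <= T /\ w t <= K].
have [S0|nS] := pselect (S !=set0); last first.
  have wK t : 0 <= t <= T -> K < w t.
    by move=> ht; rewrite ltNge; apply/negP => wt; apply: nS; exists t.
  have : w T - w 0 <= - (rho y / 2) * (T - 0).
    apply: ac_increment_le => //; apply: ae_imp wd => t h /[dup] ht /andP[t0 tT].
    have ht' : 0 <= t <= T by rewrite !ltW.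
    apply: dini_le_mono (h ht); exact: (rate t ht' (ltW (wK t ht'))).2.
  by rewrite -yE; lra.
have Sub : has_ubound S by exists T => t [/andP[]].
set tau := sup S.
have tau0 : 0 <= tau.
  have [t [/andP[t0 tT] wt]] := S0; apply: (le_trans t0); apply: ub_le_sup => //.
  by split=> //; rewrite t0.
have tauT : tau <= T by apply: ge_sup => // t [/andP[]].
have htau : 0 <= tau <= T by rewrite tau0.
have wtau : w tau <= K.
  rewrite leNgt; apply/negP => Kw.
  have e0 : 0 < w tau - K by rewrite subr_gt0.
  have [|d d0 Hd] := wc tau _ _ e0; first by rewrite /= in_itv.
  have td : tau - d < sup S by rewrite ltrBlDr ltrDl.
  have [t [ht wt] tt] := sup_gt S0 td.
  have ttau : t <= tau by apply: ub_le_sup.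
  have ttd : `|t - tau| < d by rewrite distrC ger0_norm ?subr_ge0//; lra.
  have := Hd t; rewrite /= in_itv/= => /(_ ht ttd).
  by rewrite ltr_norml => /andP[h1 h2]; lra.
have wK t : tau < t -> t <= T -> K < w t.
  move=> tt tT; rewrite ltNge; apply/negP => wt.
  have : t <= tau.
    by apply: ub_le_sup => //; split => //; rewrite tT andbT (le_trans tau0)// ltW.
  by rewrite leNgt tt.
have : w T - w tau <= 0 * (T - tau).
  apply: ac_increment_le => //; first exact: ac_on_subset wac.
  apply: ae_imp wd => t h /andP[t1 t2].
  have t0 : 0 < t by exact: le_lt_trans t1.
  have ht : 0 < t < T by rewrite t0.
  have ht' : 0 <= t <= T by rewrite !ltW.
  by apply: dini_le_mono (h ht); exact: (rate t ht' (ltW (wK _ t1 (ltW t2)))).1.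
by rewrite mul0r; lra.
Qed.

End ComparisonPrinciple.

(** * Dissipation *)

Section Dissipation.
Variable R : realType.

(** The decay of the functional, reduced to scalars: [b] is the norm of the
    gradient in the direction of the control and [s] that of the disturbance.
    Where [b <= r] the feedback does not compensate all of [a + S]; the defect
    is at most [(2 p + r) b] and is absorbed, with [s b], by [q b ^ 2]. *)
Lemma scalar_dissipation (a b r p q s : R) :
  0 <= b -> 0 < r -> 0 < p -> 0 < q -> 0 <= s ->
  (b = 0 -> a <= 0) -> (0 < b -> b <= r -> a <= p * b) ->
  a - (a + Num.sqrt (a ^+ 2 + b ^+ 4)) / Num.max b r ^+ 2 * b ^+ 2
    - q * b ^+ 2 + b * s <=
  - Num.sqrt (a ^+ 2 + b ^+ 4) + (s ^+ 2 + (2 * p + r) ^+ 2) / (2 * q).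
Proof.
move=> b0 r0 p0 q0 s0 h0 hp; set S := Num.sqrt _.
have S2 : S ^+ 2 = a ^+ 2 + (b ^+ 2) ^+ 2.
  by rewrite /S sqr_sqrtr -?exprM// addr_ge0 ?sqr_ge0// exprn_ge0.
have S0 : 0 <= S by exact: sqrtr_ge0.
have aS : `|a| <= S.
  by rewrite -(@ler_pXn2r _ 2%N)// ?nnegrE// S2 real_normK ?num_real// lerDl sqr_ge0.
have Sle : S <= `|a| + b ^+ 2.
  rewrite -(@ler_pXn2r _ 2%N)// ?nnegrE ?addr_ge0 ?sqr_ge0//.
  rewrite S2 sqrrD real_normK ?num_real// lerD2r lerDl mulrn_wge0//.
  by rewrite mulr_ge0// sqr_ge0.
have c0 : 0 <= a + S by have := ler_norm (- a); rewrite normrN; lra.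
have defect : a + S - (a + S) / Num.max b r ^+ 2 * b ^+ 2 <= (2 * p + r) * b.
  have prb : 0 <= (2 * p + r) * b by rewrite mulr_ge0// addr_ge0 ?mulr_ge0// ltW.
  have [br|rb] := leP b r; last first.
    rewrite mulfVK ?subrr// expf_neq0// gt_eqF//; exact: lt_trans rb.
  have : a + S <= (2 * p + r) * b.
    have [bE|bn0] := eqVneq b 0.
      have := h0 bE; move: Sle; rewrite bE expr0n/= addr0 mulr0 => h1 h2.
      by rewrite ler0_norm// in h1; lra.
    have bgt0 : 0 < b by rewrite lt_neqAle eq_sym bn0.
    have ap := hp bgt0 br.
    have b2 : b ^+ 2 <= r * b by rewrite expr2 ler_wpM2r.
    have [a0|/ltW a0] := leP 0 a.
      by rewrite (ger0_norm a0) in Sle; lra.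
    have := mulr_ge0 (ltW p0) b0.
    by rewrite (ler0_norm a0) in Sle; lra.
  have : 0 <= (a + S) / r ^+ 2 * b ^+ 2.
    by rewrite mulr_ge0 ?sqr_ge0// divr_ge0// sqr_ge0.
  by lra.
set P := 2 * p + r in defect *.
have young : (P + s) * b - q * b ^+ 2 <= (s ^+ 2 + P ^+ 2) / (2 * q).
  rewrite ler_pdivlMr ?mulr_gt0//.
  have := sqr_ge0 (2 * q * b - (P + s)); have := sqr_ge0 (P - s).
  by nra.
by lra.
Qed.

End Dissipation.

(** * Input-to-state stability of the closed loop *)

Section ClosedLoop.
Variables (R : realType) (n m : nat) (Delta : R).
Hypothesis Delta0 : 0 < Delta.
Variables (f : (R -> 'cV[R]_n) -> 'cV[R]_n) (g : (R -> 'cV[R]_n) -> 'M[R]_(n, m)).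
Variables (Ma : (R -> 'cV[R]_n) -> R) (V : 'cV[R]_n -> (R -> 'cV[R]_n) -> R).
Local Notation C := (@spaceC R n Delta).
Local Notation seg := (@segment R n Delta).
Local Notation mu := (@lebesgue_measure R).
Local Notation a := (map_a Delta V f).
Local Notation b := (map_b Delta V g).
Local Notation k := (map_k Delta V f g).
Hypothesis f_reg : regC Delta (@enorm R n 1) f.
Hypothesis g_reg : regC Delta (@enorm R n m) g.
Hypothesis V_id : invariantly_differentiable Delta V.
Hypothesis V_lip : lipC Delta (@Num.norm R R) (V_C Delta V).
Hypothesis Vh_reg : regC Delta (@Num.norm R R) (dVdh Delta V).
Hypothesis Vx_reg : regC Delta (@enorm R 1 n) (dVdx Delta V).
Variables (alpha1 alpha2 alpha3 ga ga' : R -> R).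
Hypotheses (alpha1K : classKinfty alpha1) (alpha2K : classKinfty alpha2)
  (alpha3K : classKinfty alpha3) (gaK : classKinfty ga) (ga'K : classKinfty ga').
Hypothesis Ma_bounds : forall phi, C phi ->
  ga (enorm (phi 0)) <= Ma phi <= ga' (norm_infty phi).
Hypothesis V_bounds : forall phi, C phi ->
  alpha1 (enorm (phi 0)) <= V (phi 0) (restrQ Delta phi) <= alpha2 (Ma phi).
Hypothesis ab_sign : forall phi, C phi -> b phi = 0 -> a phi <= 0.
Hypothesis ab_large : forall phi, C phi ->
  alpha3 (Ma phi) ^+ 2 <= a phi ^+ 2 + enorm (b phi) ^+ 4.

Lemma Ma_ge0 phi : C phi -> 0 <= Ma phi.
Proof.
move=> /Ma_bounds/andP[h _]; apply: le_trans h.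
by apply: classK_ge0 (enorm_ge0 _); case: gaK.
Qed.

Section Gains.
Variables (r p q : R).
Hypotheses (r0 : 0 < r) (p0 : 0 < p) (q0 : 0 < q).
Hypothesis ab_ratio : forall phi, C phi -> 0 < enorm (b phi) ->
  enorm (b phi) <= r -> a phi <= p * enorm (b phi).

Definition closed_loop_drift (phi : R -> 'cV[R]_n) : 'cV[R]_n :=
  f phi + g phi *m (k r phi - q *: (b phi)^T).

Lemma closed_loopE phi w : vfield closed_loop_drift g phi w =
  f phi + g phi *m (k r phi - q *: (b phi)^T + w).
Proof. by rewrite /vfield /closed_loop_drift -addrA -mulmxDr. Qed.

Lemma closed_loop_reg : regC Delta (@enorm R n 1) closed_loop_drift.
Proof.
have es := enorm_even_subadditive R.
apply: (regC_add Delta0 (es n 1%N)) => //.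
apply: (regC_mulmx Delta0) => //; apply: (regC_add Delta0 (es m 1%N)).
  exact: map_k_reg.
apply: (regC_op2 Delta0 (op := fun (x _ : 'rV[R]_m) => - (q *: x^T)) _
  (map_b_reg Delta0 Vx_reg g_reg) (map_b_reg Delta0 Vx_reg g_reg)).
move=> B B0; exists (q * B + q); first by rewrite ltr_wpDl// mulr_ge0// ltW.
move=> x x' y y' h1 h2 _ _; split.
  rewrite enormN enormZ enorm_trmx gtr0_norm//.
  by rewrite (le_trans (ler_wpM2l (ltW q0) h1))// lerDl ltW.
rewrite -opprD enormN -scalerBr enormZ -linearB/= enorm_trmx gtr0_norm//.
have e1 := enorm_ge0 (x - x'); have e2 := enorm_ge0 (y - y').
have h3 : 0 <= q * B * (enorm (x - x') + enorm (y - y')).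
  by rewrite !mulr_ge0 ?addr_ge0// ltW.
have h4 := mulr_ge0 (ltW q0) e2.
by lra.
Qed.

Lemma dissipation phi w dn : C phi -> enorm w <= dn ->
  (dVdx Delta V phi *m vfield closed_loop_drift g phi w) 0 0 + dVdh Delta V phi <=
  - alpha3 (Ma phi) + (dn ^+ 2 + (2 * p + r) ^+ 2) / (2 * q).
Proof.
move=> Cphi wdn; set B := enorm (b phi).
have B0 : 0 <= B by exact: enorm_ge0.
have dn0 : 0 <= dn by exact: le_trans (enorm_ge0 _) wdn.
have -> : (dVdx Delta V phi *m vfield closed_loop_drift g phi w) 0 0 +
    dVdh Delta V phi = a phi - (a phi + Num.sqrt (a phi ^+ 2 + B ^+ 4)) /
      Num.max B r ^+ 2 * B ^+ 2 - q * B ^+ 2 + (b phi *m w) 0 0.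
  rewrite closed_loopE mulmxDr mulmxA -/(b phi) !mulmxDr mulmxN map_kE.
  rewrite -!scalemxAr -/B; have := row_mul_trmx (b phi); rewrite -/B.
  have aE : a phi = (dVdx Delta V phi *m f phi) 0 0 + dVdh Delta V phi by [].
  move: (_ / _ : R) => c; rewrite aE.
  move: (b phi *m w) (b phi *m (b phi)^T) (dVdx Delta V phi *m f phi) => X Y Z.
  by rewrite !mxE => ->; ring.
have := @scalar_dissipation R (a phi) B r p q dn B0 r0 p0 q0 dn0.
move=> /(_ _ _)/le_trans H.
apply: (@le_trans _ _ (a phi - (a phi + Num.sqrt (a phi ^+ 2 + B ^+ 4)) /
      Num.max B r ^+ 2 * B ^+ 2 - q * B ^+ 2 + B * dn)).
  rewrite lerD2l (le_trans (ler_norm _))// (le_trans (norm_row_mul_col _ _))//.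
  by rewrite ler_wpM2l.
apply: H.
- by move=> /enorm_eq0; exact: ab_sign.
- by move=> h1 h2; exact: ab_ratio.
rewrite lerD2r lerN2.
have a3 : 0 <= alpha3 (Ma phi).
  by apply: classK_ge0 (Ma_ge0 Cphi); case: alpha3K.
rewrite -[leLHS](ger0_norm a3) -sqrtr_sqr ler_wsqrtr//; exact: ab_large.
Qed.

Variables (a1i a2i rhoi : R -> R) (bt : R -> R -> R).
Local Notation rho := (alpha3 \o a2i).
Hypotheses (a1iK : classKinfty a1i) (a2iK : classKinfty a2i)
  (rhoiK : classKinfty rhoi).
Hypothesis a1i_inv : forall s, 0 <= s -> a1i (alpha1 s) = s.
Hypothesis a2i_inv : forall s, 0 <= s -> a2i (alpha2 s) = s.
Hypothesis rhoi_inv : forall s, 0 <= s -> rho (rhoi s) = s.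
Hypothesis bt_KL : classKL bt.
Hypothesis bt_eq : forall s t, 0 <= s -> 0 <= t ->
  0 <= bt s t /\ bt s t + t * (rho (bt s t) / 2) = s.

Variables (d : R -> 'cV[R]_m) (xi0 : R -> 'cV[R]_n).
Hypothesis xi0_C : C xi0.

(** Along a solution, [w' <= - rho w + c], where [2 c] is the mean of the squares
    of the arguments of the gain [gamma]. Then [w] is below the larger of a
    decaying term and of the level at which [rho] is the larger of these squares.
    As maxima only are involved, the inverse of [alpha1] splits into three
    terms. *)
Lemma iss_estimate T x dn : 0 <= T -> 0 <= dn ->
  sol Delta closed_loop_drift g d xi0 T x ->
  {ae mu, forall t, 0 < t < T -> enorm (d t) <= dn} ->
  enorm (x T) <= a1i (bt (alpha2 (ga' (norm_infty xi0))) T)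
    + a1i (rhoi ((Num.sqrt (2 / q) * dn) ^+ 2))
    + a1i (rhoi ((Num.sqrt (2 / q) * (2 * p + r)) ^+ 2)).
Proof.
move=> T0 dn0 hx d_le; have Dpos := Delta0.
have [alpha1K' _] := alpha1K; have [alpha2K' _] := alpha2K.
have [alpha3K' _] := alpha3K; have [ga'K' _] := ga'K.
have [a1iK' _] := a1iK; have [a2iK' _] := a2iK; have [rhoiK' _] := rhoiK.
have DT : - Delta <= T by lra.
(* Freezing the trajectory after time [T] makes it continuous everywhere. *)
pose z t := x (clamp (- Delta) T t).
have zx t : - Delta <= t <= T -> z t = x t by move=> h; rewrite /z clamp_id.
have z_cont S : cont_on (@enorm R n 1) `[- Delta, S] z.
  move=> s _ e e0; have cl := clamp_in s DT.
  have [|del del0 H] := sol_cont Delta0 xi0_C T0 hx (s := clamp (- Delta) T s) _ e0.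
    by rewrite /= in_itv.
  exists del => // u _ us; apply: H; first by rewrite /= in_itv/= clamp_in.
  exact: le_lt_trans (clamp_lipschitz _ _ _ _) us.
have hz : sol Delta closed_loop_drift g d xi0 T z.
  by apply: (sol_eq Delta0 T0 _ hx) => t ht; rewrite zx.
have [z0 [L zL] dz] := hz.
pose w t := V_C Delta V (seg z t).
have w_ac : ac_on 0 T w by exact: (V_traj_ac Delta0 V_id V_lip Vh_reg Vx_reg z_cont zL).
have Cz t : 0 <= t <= T -> C (seg z t).
  exact: spaceC_segment_of (z_cont T).
have w_bounds t : 0 <= t <= T ->
    alpha1 (enorm (z t)) <= w t /\ w t <= alpha2 (Ma (seg z t)).
  move=> ht; have /andP[] := V_bounds (Cz t ht).
  by rewrite /w /V_C segment0.
have w_ge0 t : 0 <= t <= T -> 0 <= w t.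
  move=> ht; apply: le_trans (w_bounds t ht).1.
  exact: (classK_ge0 alpha1K' (enorm_ge0 _)).
set c := (dn ^+ 2 + (2 * p + r) ^+ 2) / (2 * q).
have c0 : 0 <= c.
  by rewrite divr_ge0 ?addr_ge0 ?sqr_ge0// mulr_ge0// ltW.
have rhoK : classK rho by exact: classK_comp.
have w_dini : {ae mu, forall t, 0 < t < T -> dini_le w t (- rho (w t) + c)}.
  apply: ae_imp (ae_and dz d_le) => t [h1 h2] /[dup] ht /andP[t0 tT].
  have ht' : 0 <= t <= T by rewrite !ltW.
  have := V_dini_ederiv Delta0 V_id z_cont zL (ltW t0) tT (h1 ht).
  apply: dini_le_mono; apply: le_trans (dissipation (Cz t ht') (h2 ht)) _.
  rewrite lerD2r lerN2 /=; have Ma0 := Ma_ge0 (Cz t ht').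
  apply: (classK_le alpha3K'); first exact: (classK_ge0 a2iK' (w_ge0 t ht')).
  rewrite -[leRHS]a2i_inv//; apply: (classK_le a2iK'); first exact: w_ge0.
  exact: (w_bounds t ht').2.
have h0T : 0 <= (0 : R) <= T by rewrite lexx.
have hTT : 0 <= T <= T by rewrite T0 lexx.
have [y0 yE] := bt_eq (w_ge0 0 h0T) T0.
set D2 := (Num.sqrt (2 / q) * dn) ^+ 2.
set P2 := (Num.sqrt (2 / q) * (2 * p + r)) ^+ 2.
have D20 : 0 <= D2 by exact: sqr_ge0.
have P20 : 0 <= P2 by exact: sqr_ge0.
have max0 : 0 <= Num.max D2 P2 by rewrite le_max D20.
have c_le : 2 * c <= rho (rhoi (Num.max D2 P2)).
  rewrite rhoi_inv//.
  have cE : 2 * c = (D2 + P2) / 2.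
    rewrite /D2 /P2 !exprMn !sqr_sqrtr; last by rewrite divr_ge0// ltW.
    by rewrite /c; field; rewrite gt_eqF.
  have h1 : D2 <= Num.max D2 P2 by rewrite le_max lexx.
  have h2 : P2 <= Num.max D2 P2 by rewrite le_max lexx orbT.
  by rewrite cE; lra.
have wT := comparison_bound rhoK T0 w_ac w_ge0 c0 w_dini y0 yE
  (classK_ge0 rhoiK' max0) c_le.
have xT : enorm (x T) <= a1i (Num.max (bt (w 0) T) (rhoi (Num.max D2 P2))).
  rewrite -zx ?DT ?lexx// -(a1i_inv (enorm_ge0 (z T))).
  apply: (classK_le a1iK'); first exact: (classK_ge0 alpha1K' (enorm_ge0 _)).
  exact: le_trans (w_bounds T hTT).1 wT.
have bt_mono : a1i (bt (w 0) T) <= a1i (bt (alpha2 (ga' (norm_infty xi0))) T).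
  apply: (classK_le a1iK' y0); apply: (classK_le (bt_KL.1 T T0)).
    exact: w_ge0.
  apply: le_trans (w_bounds 0 h0T).2 _.
  have segE : seg z 0 = xi0.
    rewrite -(segment_id xi0_C); apply: eq_segment => s.
    by rewrite sub0r => /z0.
  rewrite segE; apply: (classK_le alpha2K'); first exact: Ma_ge0.
  by case/andP: (Ma_bounds xi0_C).
have a1i0 s : 0 <= s -> 0 <= a1i s by exact: classK_ge0.
have rhoi0 s : 0 <= s -> 0 <= rhoi s by exact: classK_ge0.
have e1 : 0 <= a1i (bt (alpha2 (ga' (norm_infty xi0))) T) by apply: le_trans bt_mono; exact: a1i0.
have e2 : 0 <= a1i (rhoi D2) by apply/a1i0/rhoi0.
have e3 : 0 <= a1i (rhoi P2) by apply/a1i0/rhoi0.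
apply: le_trans xT _.
move: (a1i (bt (alpha2 _) T)) bt_mono e1 => e bt_mono e1.
case: (leP (bt (w 0) T)) => _; last by lra.
by case: (leP D2 P2) => _; lra.
Qed.

End Gains.
End ClosedLoop.

(** * Caratheodory solutions *)

Section CaratheodorySolutions.
Variables (R : realType) (n m : nat) (Delta : R).
Local Notation mu := (@lebesgue_measure R).
Local Notation seg := (@segment R n Delta).

Lemma absolutely_continuous_of_lipschitz T (x : R -> 'cV[R]_n) L :
  (forall s t, 0 <= s -> s <= t -> t <= T -> enorm (x t - x s) <= L * (t - s)) ->
  absolutely_continuous T x.
Proof.
move=> xL e e0; have L0 : 0 < `|L| + 1 by rewrite ltr_wpDl.
exists (e / (`|L| + 1)); first by rewrite divr_gt0.
move=> s sT _; rewrite ltr_pdivlMr// => h.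
apply: le_lt_trans h; rewrite mulrC mulr_sumr.
rewrite !big_seq; apply: ler_sum => p ps; have [p1 [p2 p3]] := sT p ps.
rewrite (le_trans (xL _ _ p1 p2 p3))// ler_wpM2r ?subr_ge0//.
by rewrite (le_trans (ler_norm _))// lerDl.
Qed.

Lemma coords_ac_of_absolutely_continuous T (x : R -> 'cV[R]_n) :
  absolutely_continuous T x -> coords_ac 0 T x.
Proof.
move=> xac i e e0; have [del del0 H] := xac e e0.
exists del => // s s1 s2 s3; apply: le_lt_trans (H s s1 s2 s3).
apply: ler_sum => p _.
by have := coord_le_enorm (x p.2 - x p.1) i 0; rewrite !mxE.
Qed.

Lemma cont_on_of_absolutely_continuous T (x : R -> 'cV[R]_n) :
  absolutely_continuous T x -> cont_on (@enorm R n 1) `[0, T] x.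
Proof.
move=> xac s; rewrite /= in_itv/= => /andP[sa sb] e e0.
have [del del0 H] := xac e e0.
exists del => // r; rewrite in_itv/= => /andP[ra rb] rs.
have [rles|slr] := leP r s.
  have := H [:: (r, s)]; rewrite !big_seq1/= enorm_distC; apply => //.
    by move=> p; rewrite inE => /eqP ->.
  by move: rs; rewrite distrC ger0_norm ?subr_ge0.
have := H [:: (s, r)]; rewrite !big_seq1/=; apply => //.
  by move=> p; rewrite inE => /eqP ->; rewrite (ltW slr).
by move: rs; rewrite ger0_norm ?subr_ge0 ?(ltW slr).
Qed.

End CaratheodorySolutions.

Theorem theorem1 (R : realType) (n m : nat) (hn : (0 < n)%N) (hm : (0 < m)%N)
  (Delta : R) (hDelta : 0 < Delta)
  (f : (R -> 'cV[R]_n) -> 'cV[R]_n)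
  (g : (R -> 'cV[R]_n) -> 'M[R]_(n, m))
  (f_cc : completely_continuous Delta (@enorm R n 1) f)
  (f_lip : locally_lipschitz Delta (@enorm R n 1) f)
  (g_cc : completely_continuous Delta (@opnorm R n m) g)
  (g_lip : locally_lipschitz Delta (@opnorm R n m) g)
  (Ma : (R -> 'cV[R]_n) -> R) (hMa : Ma_functional Delta Ma)
  (V : 'cV[R]_n -> (R -> 'cV[R]_n) -> R) (hV : classV Delta V)
  (alpha1 alpha2 alpha3 : R -> R)
  (h1 : classKinfty alpha1) (h2 : classKinfty alpha2) (h3 : classKinfty alpha3)
  (hi : forall phi, spaceC Delta phi ->
     alpha1 (enorm (phi 0)) <= V (phi 0) (restrQ Delta phi) <= alpha2 (Ma phi))
  (hii : forall phi, spaceC Delta phi ->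
     map_b Delta V g phi = 0 -> map_a Delta V f phi <= 0)
  (hiii : forall phi, spaceC Delta phi ->
     alpha3 (Ma phi) ^+ 2 <=
       map_a Delta V f phi ^+ 2 + enorm (map_b Delta V g phi) ^+ 4) :
  let a := map_a Delta V f in
  let b := map_b Delta V g in
  let k := map_k Delta V f g in
  let condition_iv (r p : R) :=
    (ereal_sup [set (a psi / enorm (b psi))%:E | psi in
       [set psi | spaceC Delta psi /\ (0 < enorm (b psi) <= r)%R]] <= p%:E)%E in
  (forall r p : R, 0 < r -> 0 < p -> condition_iv r p ->
     completely_continuous Delta (@enorm R m 1) (k r) /\
     locally_lipschitz Delta (@enorm R m 1) (k r))
  /\
  (exists (beta : R -> R -> R) (gamma : R -> R),
   [/\ classKL beta, classK gamma &
    forall r p : R, 0 < r -> 0 < p -> condition_iv r p ->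
    forall q : R, 0 < q ->
    forall (xi0 : R -> 'cV[R]_n) (d : R -> 'cV[R]_m), spaceC Delta xi0 ->
    lebesgue_measurable_fun d -> locally_ess_bounded d ->
    let closed_loop_solution (c : \bar R) (x : R -> 'cV[R]_n) :=
      solution_on Delta f g
        (fun t => k r (segment Delta x t) - q *: (b (segment Delta x t))^T)
        d xi0 c x in
    exists x : R -> 'cV[R]_n,
    [/\ closed_loop_solution +oo%E x,
        forall (c : \bar R) (y : R -> 'cV[R]_n), (0%:E < c)%E ->
          closed_loop_solution c y ->
          forall t : R, - Delta <= t -> (t%:E < c)%E -> y t = x t &
        forall t : R, 0 <= t ->
          enorm (x t) <=
            beta (norm_infty xi0) t
            + gamma (Num.sqrt (2 / q) * norm_infty (truncation `[0%R, t[ d))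
            + gamma (Num.sqrt (2 / q) * (2 * p + r))]]).
Proof.
move=> a b k condition_iv.
have [V_ge0 V_ll V_id [Vh_cc Vh_ll] [Vx_cc Vx_ll]] := hV.
have Vh_reg := regC_of_cc_lip hDelta Vh_cc Vh_ll.
have Vx_reg := regC_of_cc_lip hDelta Vx_cc Vx_ll.
have V_lip := lipC_of_locally_lipschitz V_ll.
have f_reg := regC_of_cc_lip hDelta f_cc f_lip.
have g_reg : regC Delta (@enorm R n m) g.
  apply: (regC_norm_equiv (c := m%:R)) (regC_of_cc_lip hDelta g_cc g_lip).
    by rewrite ltr0n.
  by move=> A; exact: enorm_le_opnorm.
split.
  move=> r p r0 _ _.
  have k_reg := map_k_reg hDelta Vh_reg Vx_reg f_reg g_reg r0.
  split; first exact: completely_continuous_of_regC.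
  by apply: locally_lipschitz_of_lipC => //; case: k_reg.
have [ga [ga' [gaK ga'K Ma_bounds]]] := hMa.
have [a1i a1iK a1i_inv] := classKinfty_inverse h1.
have [a2i a2iK a2i_inv] := classKinfty_inverse h2.
have rhoK := classKinfty_comp h3 a2iK.
have [rhoi rhoiK rhoi_inv] := classKinfty_inverse rhoK.
have [bt bt_KL bt_eq] := implicit_KL (classKinfty_comp (classKinfty_half R) rhoK).
(* Both functions are chosen before [r], [p] and [q]. *)
exists (fun s t => a1i (bt (alpha2 (ga' s)) t)), (fun s => a1i (rhoi (s ^+ 2))).
have [[a1iK' _] [rhoiK' _]] := (a1iK, rhoiK).
split.
- have [[h2' _] [ga'K' _]] := (h2, ga'K).
  exact: (classKL_comp bt_KL a1iK' (classK_comp h2' ga'K')).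
- exact: (classK_comp a1iK' (classK_comp rhoiK' (classK_sqr R))).
move=> r p r0 p0 iv q q0 xi0 d xi0_C d_meas d_bnd closed_loop_solution.
have ab_ratio phi : spaceC Delta phi -> 0 < enorm (b phi) ->
    enorm (b phi) <= r -> a phi <= p * enorm (b phi).
  move=> Cphi b0 br; rewrite -ler_pdivrMr// -lee_fin.
  apply: le_trans iv; apply: ereal_sup_ubound; exists phi => //.
  by split=> //; rewrite b0.
have F_reg := closed_loop_reg hDelta f_reg g_reg Vh_reg Vx_reg r0 q0.
set F := closed_loop_drift Delta f g V r q in F_reg.
have iss T x dn := @iss_estimate R n m Delta hDelta f g Ma V V_id V_lip Vh_reg
  Vx_reg alpha1 alpha2 alpha3 ga ga' h1 h2 h3 gaK ga'K Ma_bounds hi hii hiii r p q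
  r0 p0 q0 ab_ratio a1i a2i rhoi bt a1iK a2iK rhoiK (fun s hs => (a1i_inv s hs).2)
  (fun s hs => (a2i_inv s hs).2) (fun s hs => (rhoi_inv s hs).1) bt_KL bt_eq d
  xi0 xi0_C T x dn.
have d_le T t : T <= t -> {ae lebesgue_measure, forall s : R, 0 < s < T ->
    enorm (d s) <= norm_infty (truncation `[0, t[ d)}.
  move=> Tt; apply: ae_imp (ae_disturbance_le d_bnd t) => s h /andP[s0 sT].
  by apply: h; [exact: ltW|exact: lt_le_trans Tt].
have [x Hx] : exists x, forall T, 0 <= T -> sol Delta F g d xi0 T x.
  apply: (global_solution hDelta F_reg g_reg d_meas d_bnd xi0_C) => S.
  exists (a1i (bt (alpha2 (ga' (norm_infty xi0))) 0) +
    a1i (rhoi ((Num.sqrt (2 / q) * norm_infty (truncation `[0, S[ d)) ^+ 2)) +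
    a1i (rhoi ((Num.sqrt (2 / q) * (2 * p + r)) ^+ 2))) => T y T0 TS hy t t0 tT.
  have := iss t y _ t0 (norm_infty_ge0 _) (sol_restrict tT hy)
    (d_le _ _ (le_trans tT TS)).
  move/le_trans; apply; rewrite !lerD2r; apply: (classK_le a1iK').
    apply: classK_ge0 (bt_KL.1 t t0) _ _; apply: (classK_ge0 h2.1).
    by apply: (classK_ge0 ga'K.1); exact: norm_infty_ge0.
  have s0 : 0 <= alpha2 (ga' (norm_infty xi0)).
    apply: (classK_ge0 h2.1); apply: (classK_ge0 ga'K.1).
    exact: norm_infty_ge0.
  by case: (bt_KL.2 _ s0) => _ mono _; exact: mono.
have rhsE y t : f (segment Delta y t) + g (segment Delta y t) *m
    (k r (segment Delta y t) - q *: (b (segment Delta y t))^T + d t) =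
    vfield F g (segment Delta y t) (d t).
  by rewrite closed_loopE.
exists x; split.
- split.
  + by move=> tau; rewrite in_itv/=; case: (Hx 0 (lexx 0)) => + _ _; exact.
  + move=> T T0 _; have [_ [L xL] _] := Hx T T0.
    exact: absolutely_continuous_of_lipschitz xL.
  have ae_all : {ae lebesgue_measure, forall t : R, forall i : nat, 0 < t < i%:R ->
      ederiv x t (vfield F g (segment Delta x t) (d t))}.
    by apply/ae_foralln => i; case: (Hx i%:R (ler0n _ _)).
  have not0 : {ae lebesgue_measure, forall t : R, t <> 0}.
    exists [set 0]; split; [exact: measurable_set1|exact: lebesgue_measure_set1|].
    by move=> t /= /contrapT.
  apply: ae_imp (ae_and not0 ae_all) => t [t_n0 h] t0 _.
  apply/is_deriveP; rewrite rhsE; apply: (h (Num.bound t)).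
  by rewrite archi_boundP// andbT lt_neqAle t0 andbT; apply/eqP => /esym.
- move=> c y c0 [y0 y_ac dy] t Dt tc.
  pose T := Num.max 0 t; have T0 : 0 <= T by rewrite le_max lexx.
  have tT : t <= T by rewrite le_max lexx orbT.
  have Tc : (T%:E < c)%E by rewrite /T; case: (leP 0 t).
  have y0' s : - Delta <= s <= 0 -> y s = xi0 s by move=> hs; apply: y0; rewrite in_itv.
  have [x0 _ dx] := Hx T T0.
  have y_ac' := y_ac T T0 Tc.
  have cy := cont_on_initial hDelta xi0_C T0 y0' (cont_on_of_absolutely_continuous y_ac').
  apply/esym; apply: (solves_unique hDelta F_reg g_reg d_meas d_bnd
    (sol_cont hDelta xi0_C T0 (Hx T T0)) cy (sol_ac (Hx T T0))
    (coords_ac_of_absolutely_continuous y_ac') dx).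
  + apply: ae_imp dy => s h /andP[s0 sT]; apply/is_deriveP; rewrite -rhsE.
    by apply: h; [exact: ltW|apply: lt_trans Tc; rewrite lte_fin].
  + by move=> s hs; rewrite x0// y0'.
  + by rewrite Dt.
- move=> t t0.
  exact: iss t x _ t0 (norm_infty_ge0 _) (Hx t t0) (d_le t t (lexx t)).
Qed.
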